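(* Let $N\geq 3$, $\lambda\in(0,N)$ and $p=\frac{2N-\lambda}{N-2}$. Let $c\in\mathbb{R}\setminus\{0\}$, $\delta>0$, $x_0\in\mathbb{R}^N$ be such that $$U(x)=U_{c,\delta,x_0}(x)=c\,(\delta^2+|x-x_0|^2)^{-\frac{N-2}{2}}$$ is a (nontrivial, constant-sign) solution of the generalized energy-critical Hartree equation $$-\Delta u(x)-\boldsymbol{\alpha}(N,\lambda)\int_{\mathbb{R}^N}\frac{u^p(y)}{|x-y|^\lambda}\,dy\;u^{p-1}(x)=0,\qquad x\in\mathbb{R}^N,$$ where $$\boldsymbol{\alpha}(N,\lambda)=\frac{N(N-2)}{\pi^{N/2}}\cdot\frac{\Gamma\left(N-\frac{\lambda}{2}\right)}{\Gamma\left(\frac{N-\lambda}{2}\right)}.$$ Then $U$ is nondegenerate: every bounded solution $\varphi:\mathbb{R}^N\to\mathbb{R}$, vanishing at infinity, of the linearized equation $$-\Delta\varphi=\boldsymbol{\alpha}(N,\lambda)\left[p\left(\frac{1}{|\cdot|^\lambda}*(U^{p-1}\varphi)\right)U^{p-1}+(p-1)\left(\frac{1}{|\cdot|^\lambda}*U^p\right)U^{p-2}\varphi\right]\quad\text{on }\mathbb{R}^N$$ is a linear combination of the $N+1$ functions $$\frac{\partial U}{\partial x_j}\ (1\le j\le N),\qquad \frac{N-2}{2}U+(x-x_0)\cdot\nabla U .$$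
   Context: All functions are real-valued. Here $*$ denotes convolution on $\mathbb{R}^N$. For $U<0$ the powers are understood as in the nonlinearity $|u|^p$, $|u|^{p-2}u$: $U^p$ means $|U|^p$, $U^{p-1}$ means $|U|^{p-2}U$ and $U^{p-2}$ means $|U|^{p-2}$; for $U>0$ these are the usual powers. Solutions of the linearized equation are functions in $L^\infty(\mathbb{R}^N)$ satisfying it in the sense of distributions; ''vanishing at infinity'' means $\varphi(x)\to0$ as $|x|\to\infty$. For the normalized solution $u=U_{1,1,0}=(1+|x|^2)^{-\frac{N-2}{2}}$ the $N+1$ functions above are $\varphi_j(x)=(2-N)u(x)\frac{x_j}{1+|x|^2}$, $1\le j\le N$, and $\varphi_{N+1}(x)=\frac{N-2}{2}u(x)\frac{1-|x|^2}{1+|x|^2}$. *)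

(* Defs.v *)
From HB Require Import structures.
From mathcomp Require Import all_boot all_order all_algebra.
From mathcomp Require Import all_classical all_reals all_analysis.

Set Implicit Arguments.
Unset Strict Implicit.
Unset Printing Implicit Defensive.

Import Order.TTheory GRing.Theory Num.Theory.
Import numFieldNormedType.Exports.

Local Open Scope classical_set_scope.
Local Open Scope ring_scope.

(* R^n is 'rV[R]_n with the product sigma-algebra of the Borel sets of R, that
   is, its Borel sigma-algebra. *)
Definition measure_rV_display : measure_display -> measure_display.
Proof. exact. Qed.

Section measurable_rV.
Context {R : realType}.
Variable n : nat.

Let coors (i : 'I_n) (x : 'rV[R]_n) : R := x ord0 i.

Let rV_set0 : g_sigma_preimage coors set0.
Proof. exact: sigma_algebra0. Qed.

Let rV_setC A : g_sigma_preimage coors A -> g_sigma_preimage coors (~` A).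
Proof. exact: sigma_algebraC. Qed.

Let rV_bigcup (F : _^nat) : (forall i, g_sigma_preimage coors (F i)) ->
  g_sigma_preimage coors (\bigcup_i (F i)).
Proof. exact: sigma_algebra_bigcup. Qed.

HB.instance Definition _ :=
  @isMeasurable.Build (measure_rV_display default_measure_display)
    'rV[R]_n (g_sigma_preimage coors) rV_set0 rV_setC rV_bigcup.

End measurable_rV.

Definition cons_rV (R : realType) n (p : R * 'rV[R]_n) : 'rV[R]_n.+1 :=
  row_mx p.1%:M p.2.

Fixpoint lebesgue_rV {R : realType} (n : nat) : set 'rV[R]_n -> \bar R :=
  match n with
  | 0 => \d_(0 : 'rV[R]_0)
  | m.+1 => pushforward (lebesgue_measure \x @lebesgue_rV R m)%E (@cons_rV R m)
  end.

Section lebesgue_rV_measure.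
Context {R : realType}.

Lemma cons_rV0 n (p : R * 'rV[R]_n) : cons_rV p ord0 ord0 = p.1.
Proof.
rewrite /cons_rV (_ : ord0 = lshift n (ord0 : 'I_1)); last exact: val_inj.
by rewrite [LHS](@row_mxEl _ 1 1 n) mxE eqxx mulr1n.
Qed.

Lemma cons_rVS n (p : R * 'rV[R]_n) j :
  cons_rV p ord0 (lift ord0 j) = p.2 ord0 j.
Proof.
rewrite /cons_rV (_ : lift _ _ = rshift 1 j); last exact: val_inj.
by rewrite [LHS](@row_mxEr _ 1 1 n).
Qed.

Definition uncons_rV n (x : 'rV[R]_n.+1) : R * 'rV[R]_n :=
  (x ord0 ord0, \row_j x ord0 (lift ord0 j)).

Lemma cons_rVK n : cancel (@cons_rV R n) (@uncons_rV n).
Proof.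
move=> [a v]; rewrite /uncons_rV cons_rV0; congr (_, _).
by apply/rowP => j; rewrite mxE cons_rVS.
Qed.

Lemma measurable_rV_coord n (i : 'I_n) :
  measurable_fun setT (fun x : 'rV[R]_n => x ord0 i).
Proof.
move=> _ Y mY; rewrite setTI; apply: sub_sigma_algebra => /=.
rewrite -bigcup_seq/=; exists i => /=; first by rewrite mem_index_enum.
by exists Y => //; rewrite setTI.
Qed.

Lemma measurable_rVP d (T : measurableType d) n (f : T -> 'rV[R]_n) :
  (forall i, measurable_fun setT (fun t => f t ord0 i)) ->
  measurable_fun setT f.
Proof.
move=> mf; suff : preimage_set_system setT f measurable `<=` measurable.
  by move=> fS _ A mA; apply: fS; exists A.
rewrite {1}/measurable/= -g_sigma_preimage_comp.
apply: smallest_sub; first exact: sigma_algebra_measurable.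
case: n => [|n] in f mf *; first by rewrite big_ord0.
rewrite -bigcup_mkord_ord; apply: bigcup_sub => i Ii.
by move=> A [B mB <-]; exact: mf.
Qed.

Lemma measurable_cons_rV n : measurable_fun setT (@cons_rV R n).
Proof.
apply: measurable_rVP => i; have [j ->|->] := unliftP ord0 i.
  under eq_fun do rewrite cons_rVS.
  by apply: (measurableT_comp (measurable_rV_coord j)); exact: measurable_snd.
by under eq_fun do rewrite cons_rV0; exact: measurable_fst.
Qed.

Lemma measurable_uncons_rV n : measurable_fun setT (@uncons_rV n).
Proof.
apply: measurable_fun_pair; first exact: measurable_rV_coord.
apply: measurable_rVP => j; under eq_fun do rewrite mxE.
exact: measurable_rV_coord.
Qed.

Section step.
Variables (n : nat) (mu : {sigma_finite_measure set 'rV[R]_n -> \bar R}).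

Let nu := pushforward (lebesgue_measure \x mu)%E (@cons_rV R n).

Let nu0 : nu set0 = 0%E.
Proof. by rewrite /nu /pushforward preimage_set0 measure0. Qed.

Let nu_ge0 A : (0 <= nu A)%E.
Proof. exact: (measure_ge0 (lebesgue_measure \x mu)%E). Qed.

Let nu_sigma_additive : semi_sigma_additive nu.
Proof.
move=> F mF tF mUF.
have mc A : measurable A -> measurable (@cons_rV R n @^-1` A).
  by move=> mA; rewrite -[X in measurable X]setTI; exact: measurable_cons_rV.
rewrite /nu /pushforward preimage_bigcup.
apply: (measure_semi_sigma_additive (s := (lebesgue_measure \x mu)%E)).
- by move=> k; exact: mc.
- apply/trivIsetP => /= i j _ _ ij; rewrite -preimage_setI.
  by move/trivIsetP : tF => /(_ _ _ _ _ ij) ->//; rewrite preimage_set0.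
- by rewrite -preimage_bigcup; exact: mc.
Qed.

HB.instance Definition _ :=
  isMeasure.Build _ _ _ nu nu0 nu_ge0 nu_sigma_additive.

Let nu_sigma_finite : sigma_finite setT nu.
Proof.
have /sigma_finiteP[F [TF ndF Foo]] := sigma_finiteT (@lebesgue_measure R).
have /sigma_finiteP[G [TG ndG Goo]] := sigma_finiteT mu.
exists (fun k => @uncons_rV n @^-1` (F k `*` G k)).
  rewrite -preimage_bigcup -[LHS](preimage_setT (@uncons_rV n)).
  congr (_ @^-1` _); rewrite -setXTT TF TG predeqE => -[x y]; split.
    move=> [/= [k _ Fkx] [l _ Gly]]; exists (maxn k l) => //; split.
    - by move: x Fkx; exact/subsetPset/ndF/leq_maxl.
    - by move: y Gly; exact/subsetPset/ndG/leq_maxr.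
  by move=> [k _ []/= ? ?]; split; exists k.
move=> k; have [mF Fk] := Foo k; have [mG Gk] := Goo k; split.
  rewrite -[X in measurable X]setTI.
  by apply: measurable_uncons_rV => //; exact: measurableX.
rewrite /nu /pushforward -comp_preimage.
rewrite (_ : _ \o _ = id); last by apply/funext => p /=; rewrite cons_rVK.
rewrite preimage_id product_measure1E// lte_mul_pinfty//.
by rewrite ge0_fin_numE.
Qed.

HB.instance Definition _ :=
  Measure_isSigmaFinite.Build _ _ _ nu nu_sigma_finite.

Lemma lebesgue_rVS_sigma_finite :
  exists m : {sigma_finite_measure set 'rV[R]_n.+1 -> \bar R},
    m = nu :> (set _ -> \bar R).
Proof. by exists nu. Qed.

End step.

Let lebesgue_rV_ex n :
  exists mu : {sigma_finite_measure set 'rV[R]_n -> \bar R},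
    mu = @lebesgue_rV R n :> (set _ -> \bar R).
Proof.
elim: n => [|n [mu /= <-]]; first by exists (\d_(0 : 'rV[R]_0)).
exact: lebesgue_rVS_sigma_finite.
Qed.

Let lebesgue_rV0 n : @lebesgue_rV R n set0 = 0%E.
Proof. by have [mu <-] := lebesgue_rV_ex n; rewrite measure0. Qed.

Let lebesgue_rV_ge0 n A : (0 <= @lebesgue_rV R n A)%E.
Proof. by have [mu <-] := lebesgue_rV_ex n; exact: measure_ge0. Qed.

Let lebesgue_rV_sigma_additive n : semi_sigma_additive (@lebesgue_rV R n).
Proof.
by have [mu <-] := lebesgue_rV_ex n; exact: measure_semi_sigma_additive.
Qed.

HB.instance Definition _ n := isMeasure.Build _ _ _ (@lebesgue_rV R n)
  (lebesgue_rV0 n) (@lebesgue_rV_ge0 n) (@lebesgue_rV_sigma_additive n).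

Let lebesgue_rV_sigma_finite n : sigma_finite setT (@lebesgue_rV R n).
Proof. by have [mu <-] := lebesgue_rV_ex n; exact: sigma_finiteT. Qed.

HB.instance Definition _ n := Measure_isSigmaFinite.Build _ _ _
  (@lebesgue_rV R n) (lebesgue_rV_sigma_finite n).

End lebesgue_rV_measure.

Section euclidean_calculus.
Context {R : realType} {n : nat}.
Implicit Types (f g : 'rV[R]_n -> R) (x : 'rV[R]_n).

(* The norm `|x| of the library is the sup norm. *)
Definition enorm x : R := Num.sqrt (\sum_(i < n) x ord0 i ^+ 2).

Definition partial (j : 'I_n) f : 'rV[R]_n -> R :=
  fun x => 'D_(delta_mx ord0 j) f x.

Definition laplacian f x : R := \sum_(j < n) partial j (partial j f) x.

(* C^oo: the iterated partial derivatives of all orders (s lists the indices)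
   exist and are continuous. *)
Definition smooth f : Prop := forall s : seq 'I_n,
  continuous (foldr partial f s) /\
  forall (j : 'I_n) x, derivable (foldr partial f s) x (delta_mx ord0 j).

Definition test_function f : Prop :=
  smooth f /\ compact (closure [set x | f x != 0]).

Definition vanishes_at_infinity f : Prop :=
  forall e : R, 0 < e -> exists r : R, forall x, r < enorm x -> `|f x| < e.

Definition convolution f g x : R :=
  \int[@lebesgue_rV R n]_y (f (x - y) * g y).

End euclidean_calculus.

Definition Gamma {R : realType} (s : R) : R :=
  \int[@lebesgue_measure R]_(t in `]0, +oo[) (t `^ (s - 1) * expR (- t)).

Section hartree.
Context {R : realType} {N : nat}.
Implicit Types (lam p : R) (u phi : 'rV[R]_N -> R) (x : 'rV[R]_N).

Definition hartree_constant lam : R :=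
  N%:R * (N%:R - 2) / pi `^ (N%:R / 2) *
  (Gamma (N%:R - lam / 2) / Gamma ((N%:R - lam) / 2)).

(* The value of this kernel at 0 (0, as powR 0 r = 0 for r != 0) is immaterial:
   it is only integrated. *)
Definition riesz_kernel lam x : R := enorm x `^ (- lam).

(* Rintegral returns a junk value on non-integrable functions and 'D_v f x one
   where f is not derivable.  Neither occurs for a bubble u (defined below) and
   phi in L^oo, with 0 < lam < N and p = (2N - lam) / (N - 2): u is smooth and
   all the integrals converge absolutely.
   In the next two definitions the powers u^p, u^(p-1) and u^(p-2) are read as
   |u|^p, |u|^(p-2) u and |u|^(p-2). *)

Definition hartree_solution lam p u : Prop := forall x,
  - laplacian u x
  - hartree_constant lam
    * convolution (riesz_kernel lam) (fun y => `|u y| `^ p) x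
    * (`|u x| `^ (p - 2) * u x) = 0.

Definition linearized_rhs lam p u phi x : R :=
  hartree_constant lam *
  (p * convolution (riesz_kernel lam)
         (fun y => `|u y| `^ (p - 2) * u y * phi y) x
     * (`|u x| `^ (p - 2) * u x)
   + (p - 1) * convolution (riesz_kernel lam) (fun y => `|u y| `^ p) x
     * `|u x| `^ (p - 2) * phi x).

Definition linearized_solution lam p u phi : Prop :=
  forall psi : 'rV[R]_N -> R, test_function psi ->
    \int[@lebesgue_rV R N]_x (phi x * - laplacian psi x) =
    \int[@lebesgue_rV R N]_x (linearized_rhs lam p u phi x * psi x).

Definition bubble (c delta : R) (x0 x : 'rV[R]_N) : R :=
  c * (delta ^+ 2 + enorm (x - x0) ^+ 2) `^ (- ((N%:R - 2) / 2)).

Definition dilation_generator (x0 : 'rV[R]_N) u x : R :=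
  (N%:R - 2) / 2 * u x + \sum_(j < N) (x - x0) ord0 j * partial j u x.

End hartree.

(* Main.v *)
(* Put q = delta^2 + |x - x0|^2.  The linear forms on the sphere, read in
   stereographic coordinates, are the functions h_u = (quadratic polynomial) / q,
   with u in R^(N+1), and the functions named in the theorem are the q^(-k) h_u,
   k = (N-2)/2.  Testing the linearized equation against q^(-k) (1 + h_u)^(-s),
   s = N - lambda/2, gives an identity between the moments of phi: the Laplacian of
   the test function is a combination of powers of 1 + h_u, and so is its Riesz
   potential, because q (1 + h_u) is the image of q under an affine map.  The Hartree
   equation itself supplies the Riesz potential of q^(-s), so that the value of the
   constant alpha is never needed.  The zero modes q^(-k) h_u satisfy the same
   identity, hence one can subtract one of them and assume that phi is orthogonal to
   all of them.  Expanding in powers of u, the l-th moment of phi against h_u is then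
   multiplied by the gap between the eigenvalues of the two sides on spherical
   harmonics of degree l, which vanishes for l = 1 only.  So all moments vanish, phi is
   orthogonal to all exponentials exp(h_u), and phi = 0. *)

(* The exponent s = N - lambda/2 is forced: U^(p-1) is proportional to q^(-e) with e = s - k, so the
   test function times q^(-e) is exactly (q (1 + h_u))^(-s), and only for this power does the Riesz
   potential follow from that of q^(-s) by a homothety and a translation. The eigenvalues of the two
   sides then show up as binomial coefficients in Taylor expansions at u = 0.

   The test functions decay only like |x|^(2-N). After a cutoff at radius r, the commutator terms
   with the Laplacian have an L^1 norm that is bounded in r but not small; it is the decay of phi at
   infinity that makes their pairing with phi tend to 0. For the zero modes the identity rests on
   Green's formula; in dimension 3 the plain decay rates just miss what it needs, and a cancellation
   in the Wronskian supplies the missing half power of q.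

   Finiteness of the Riesz potential of q^(-s) is also extracted from the Hartree equation: an
   infinite integral would be read as 0 there, against the nonzero Laplacian of U.

   Completeness holds because the sublevel sets of the h_u include all coordinate half-spaces. *)
From HB Require Import structures.
From mathcomp Require Import all_boot all_order all_algebra.
From mathcomp Require Import all_classical all_reals all_analysis.
From mathcomp Require Import measurable_realfun ring lra.
Require Import Defs.
Set Implicit Arguments.
Unset Strict Implicit.
Unset Printing Implicit Defensive.
Import Order.TTheory GRing.Theory Num.Theory.
Import numFieldNormedType.Exports.
Local Open Scope classical_set_scope.
Local Open Scope ring_scope.

(** * Affine changes of variables *)

Section lebesgue_affine.
Context {R : realType}.
Local Notation mu := (@lebesgue_measure R).

Lemma measurable_affine (r a : R) :
  measurable_fun setT (fun x : measurableTypeR R => r * x + a : measurableTypeR R).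
Proof. by apply: measurable_funD => //; exact: measurable_funM. Qed.

(** The rescaled pushforward [m] gives every half-open interval its length, and Lebesgue measure is
    the only measure that does so. *)
Lemma lebesgue_measure_affine (r a : R) (A : set R) : 0 < r -> measurable A ->
  (r%:E * mu ((fun x => r * x + a)%R @^-1` A))%E = mu A.
Proof.
move=> r0 mA.
pose m0 := mscale (NngNum (ltW r0))
  (pushforward mu (fun x : measurableTypeR R => r * x + a : measurableTypeR R)).
pose m := m0 (measurable_affine r a).
apply/esym.
have -> : (r%:E * mu ((fun x => r * x + a)%R @^-1` A))%E = m A by [].
apply: lebesgue_measure_unique => // _ [[b c] /= _ <-].
rewrite /m /m0 /mscale /= /pushforward.
have -> : (fun x : measurableTypeR R => r * x + a : measurableTypeR R) @^-1` `]b, c]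
    = `](b - a) / r, (c - a) / r]%classic.
  apply/seteqP; split => x /=; rewrite !in_itv/= => /andP[h1 h2];
    apply/andP; split.
  - by rewrite ltr_pdivrMr// mulrC ltrBlDr.
  - by rewrite ler_pdivlMr// mulrC lerBrDr.
  - by move: h1; rewrite ltr_pdivrMr// mulrC ltrBlDr.
  - by move: h2; rewrite ler_pdivlMr// mulrC lerBrDr.
rewrite !lebesgue_measure_itv/= !lte_fin ltr_pM2r ?invr_gt0// ltrD2r.
case: ifPn => bc; last by rewrite mule0.
by rewrite -!EFinB -EFinM; congr EFin; field; rewrite gt_eqF.
Qed.

Lemma ge0_integral_affine (r a : R) (f : R -> \bar R) : 0 < r ->
  measurable_fun setT f -> (forall x, 0 <= f x)%E ->
  (r%:E * \int[mu]_x f (r * x + a)%R = \int[mu]_x f x)%E.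
Proof.
move=> r0 mf f0.
pose m0 := mscale (NngNum (ltW r0))
  (pushforward mu (fun x : measurableTypeR R => r * x + a : measurableTypeR R)).
pose m := m0 (measurable_affine r a).
transitivity (\int[m]_x f x)%E; last first.
  apply: eq_measure_integral => A mA _.
  by rewrite -[RHS](lebesgue_measure_affine a r0 mA).
rewrite ge0_integral_mscale//=.
congr (_ * _)%E.
by rewrite ge0_integral_pushforward//; exact: measurable_affine.
Qed.

End lebesgue_affine.

Section lebesgue_rV_affine.
Context {R : realType}.
Local Notation mu := (@lebesgue_measure R).

Lemma ge0_integral_rVS n (f : 'rV[R]_n.+1 -> \bar R) :
  measurable_fun setT f -> (forall x, 0 <= f x)%E ->
  (\int[@lebesgue_rV R n.+1]_x f x = \int[mu]_t \int[@lebesgue_rV R n]_v f (cons_rV (t, v)))%E.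
Proof.
move=> mf f0.
transitivity (\int[pushforward (mu \x @lebesgue_rV R n) (@cons_rV R n)]_x f x)%E.
  by [].
rewrite ge0_integral_pushforward//; last exact: measurable_cons_rV.
rewrite fubini_tonelli1//=.
by apply: measurableT_comp => //; exact: measurable_cons_rV.
Qed.

Lemma measurable_affine_rV n (r : R) (a : 'rV[R]_n) :
  measurable_fun setT (fun x : 'rV[R]_n => r *: x + a).
Proof.
apply: measurable_rVP => i; under eq_fun do rewrite !mxE.
apply: measurable_funD => //; apply: measurable_funM => //.
exact: measurable_rV_coord.
Qed.

Lemma affine_cons_rV n (r : R) (a : 'rV[R]_n.+1) t v :
  r *: cons_rV (t, v) + a =
  cons_rV (r * t + a ord0 ord0, r *: v + (uncons_rV a).2).
Proof.
apply/rowP => i; have [j ->|->] := unliftP ord0 i.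
  by rewrite [RHS]cons_rVS/= [LHS]mxE [X in X + _ = _]mxE cons_rVS !mxE.
by rewrite [RHS]cons_rV0/= [LHS]mxE [X in X + _ = _]mxE cons_rV0.
Qed.

(** Induction on the dimension through Tonelli, one coordinate at a time. Homotheties and
    translations are the only changes of variables of the whole proof: they already carry [qf] to
    every [Qf B b], up to a factor. *)
Lemma ge0_integral_rV_affine n (r : R) (a : 'rV[R]_n) (f : 'rV[R]_n -> \bar R) :
  0 < r -> measurable_fun setT f -> (forall x, 0 <= f x)%E ->
  ((r ^+ n)%:E * \int[@lebesgue_rV R n]_x f (r *: (x : 'rV[R]_n) + a)%R = \int[@lebesgue_rV R n]_x f x)%E.
Proof.
move=> r0; elim: n a f => [|n IH] a f mf f0.
  rewrite expr0 mul1e; apply: eq_integral => x _.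
  by congr f; apply/rowP => -[].
have mfc t : measurable_fun setT (fun v : 'rV[R]_n => f (cons_rV (t, v))).
  apply: measurableT_comp => //.
  have -> : (fun v => cons_rV (t, v)) = @cons_rV R n \o pair t by [].
  by apply: measurableT_comp => //; exact: measurable_cons_rV.
rewrite !ge0_integral_rVS//; last first.
  by apply: measurableT_comp => //; exact: measurable_affine_rV.
under eq_integral do under eq_integral do rewrite affine_cons_rV.
rewrite -(ge0_integral_affine (a ord0 ord0) r0); last 2 first.
- apply: (@measurable_fun_fubini_tonelli_F _ _ _ _ _ (@lebesgue_rV R n)
     (f \o @cons_rV R n)) => //=.
  by apply: measurableT_comp => //; exact: measurable_cons_rV.
- by move=> x; exact: integral_ge0.
rewrite exprS EFinM -muleA; congr (_ * _)%E.
rewrite -ge0_integralZl//; last 3 first.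
- pose g (w : R * 'rV[R]_n) := f (cons_rV (r * w.1 + a ord0 ord0, r *: w.2 + (uncons_rV a).2)).
  apply: (@measurable_fun_fubini_tonelli_F _ _ _ _ _ (@lebesgue_rV R n) g);
    last by move=> ?; exact: f0.
  rewrite /g; apply: measurableT_comp => //.
  apply: (measurableT_comp (@measurable_cons_rV R n)) => //=.
  apply: measurable_fun_pair => /=.
    by apply: measurable_funD => //; exact: measurable_funM.
  by apply: (measurableT_comp (@measurable_affine_rV n r (uncons_rV a).2)) => //.
- by move=> x _; exact: integral_ge0.
- by rewrite lee_fin exprn_ge0// ltW.
apply: eq_integral => t _.
by rewrite -[in RHS](IH (uncons_rV a).2)//.
Qed.

Lemma integral_rV_affine n (r : R) (a : 'rV[R]_n) (f : 'rV[R]_n -> R) :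
  0 < r -> measurable_fun setT f ->
  r ^+ n * \int[@lebesgue_rV R n]_x f (r *: (x : 'rV[R]_n) + a) = \int[@lebesgue_rV R n]_x f x.
Proof.
move=> r0 mf; have rn0 : (0 < r ^+ n)%R by rewrite exprn_gt0.
have mf' : measurable_fun setT (fun x : 'rV[R]_n => f (r *: x + a)).
  by apply: measurableT_comp => //; exact: measurable_affine_rV.
have E (g : 'rV[R]_n -> \bar R) : (forall x, 0 <= g x)%E -> measurable_fun setT g ->
    (\int[@lebesgue_rV R n]_x g x = (r ^+ n)%:E * \int[@lebesgue_rV R n]_x g (r *: (x : 'rV[R]_n) + a)%R)%E.
  by move=> g0 mg; rewrite ge0_integral_rV_affine.
pose F (x : 'rV[R]_n) := (f (r *: x + a))%:E.
have EP : (\int[@lebesgue_rV R n]_x (EFin \o f)^\+ x =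
    (r ^+ n)%:E * \int[@lebesgue_rV R n]_x F^\+ x)%E.
  rewrite [LHS]E//; last by apply: measurable_funepos; exact/measurable_EFinP.
  by congr (_ * _)%E; apply: eq_integral => x _; rewrite /F !(funeposE,funenegE).
have EN : (\int[@lebesgue_rV R n]_x (EFin \o f)^\- x =
    (r ^+ n)%:E * \int[@lebesgue_rV R n]_x F^\- x)%E.
  rewrite [LHS]E//; last by apply: measurable_funeneg; exact/measurable_EFinP.
  by congr (_ * _)%E; apply: eq_integral => x _; rewrite /F !(funeposE,funenegE).
rewrite /Rintegral.
have -> : (\int[@lebesgue_rV R n]_x (f x)%:E =
  (r ^+ n)%:E * \int[@lebesgue_rV R n]_x F^\+ x -
  (r ^+ n)%:E * \int[@lebesgue_rV R n]_x F^\- x)%E by rewrite integralE EP EN.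
have -> : (\int[@lebesgue_rV R n]_x (f (r *: (x : 'rV[R]_n) + a))%:E =
   \int[@lebesgue_rV R n]_x F^\+ x - \int[@lebesgue_rV R n]_x F^\- x)%E.
  by rewrite integralE.
(* If a part is infinite, both sides are 0, the value of [fine] at infinity; this is why
   measurability of [f] suffices. *)
move: (\int[_]_x F^\+ x)%E (\int[_]_x F^\- x)%E => A B.
case: A B => [A||] [B||]; rewrite /= ?(gt0_muley, gt0_muleNy) ?lte_fin//= ?mulr0//.
by rewrite mulrBr.
Qed.

End lebesgue_rV_affine.

(** * Integrability of negative powers of 1 + |x|^2 *)

Section decay.
Context {R : realType}.
Local Notation mu := (@lebesgue_measure R).

(** Cubes replace Euclidean balls because their volume can be read off the product structure of
    [lebesgue_rV]. *)
Definition box n (r : R) : set 'rV[R]_n := [set x | forall i, `|x ord0 i| <= r].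

Lemma measurable_box n r : measurable (@box n r).
Proof.
have -> : @box n r = \bigcap_(i in [set: 'I_n]) [set x | `|x ord0 i| <= r].
  by apply/seteqP; split => x /= xr i; move: (xr i) => //; exact.
apply: fin_bigcap_measurable => // i _.
rewrite -[X in measurable X]setTI.
apply: (measurable_fun_ler _ (@measurable_cst _ _ _ _ _ r)) => //.
by apply: measurableT_comp => //; exact: measurable_rV_coord.
Qed.

Lemma lebesgue_rV_box n (r : R) : 0 <= r ->
  @lebesgue_rV R n (@box n r) = ((2 * r) ^+ n)%:E.
Proof.
move=> r0; elim: n => [|n IH].
  by rewrite expr0 /= diracE mem_set// => -[].
have mb k : measurable (@box k r) := @measurable_box k r.
transitivity (\int[@lebesgue_rV R n.+1]_x (\1_(@box n.+1 r) x)%:E)%E.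
  by rewrite integral_indic ?setIT//; exact: mb.
rewrite ge0_integral_rVS//; last first.
  by apply/measurable_EFinP/measurable_indicP; exact: mb.
transitivity (\int[mu]_t ((\1_(`[- r, r]) t)%:E * ((2 * r) ^+ n)%:E)%E)%E.
  apply: eq_integral => t _; rewrite -IH.
  transitivity (\int[@lebesgue_rV R n]_v
     ((\1_(`[- r, r]) t)%:E * (\1_(@box n r) v)%:E))%E; last first.
    rewrite ge0_integralZl//; last by apply/measurable_EFinP/measurable_indicP; exact: mb.
    by rewrite integral_indic ?setIT//; exact: mb.
  apply: eq_integral => v _; rewrite -EFinM; congr EFin.
  rewrite !indicE -natrM mulnb; congr (_%:R); congr nat_of_bool.
  apply/idP/andP.
    rewrite !inE => bx; split.
      by have := bx ord0; rewrite cons_rV0 ler_norml /= in_itv.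
    by move=> i; have := bx (lift ord0 i); rewrite cons_rVS.
  rewrite !inE /= in_itv/= -ler_norml => -[tr bv] i.
  by have [j ->|->] := unliftP ord0 i; rewrite ?cons_rVS ?cons_rV0.
rewrite ge0_integralZr ?lee_fin ?exprn_ge0 ?mulr_ge0//; last first.
  by apply/measurable_EFinP/measurable_indicP.
rewrite integral_indic// setIT/=.
rewrite lebesgue_measure_itv/= lte_fin.
rewrite exprS.
case: ifPn => h.
  by rewrite -EFinB -EFinM; congr EFin; ring.
suff -> : r = 0 by rewrite !mulr0 !mul0r mul0e.
lra.
Qed.

Lemma dyadic_bracket (t : R) : 1 <= t -> exists k, 4 ^+ k <= t < 4 ^+ k.+1.
Proof.
move=> t1.
have ex : exists k, t < 4 ^+ k.+1.
  exists (Num.truncn t).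
  apply: (lt_le_trans (truncnS_gt t)).
  elim: (Num.truncn t) => [|k IH]; first by rewrite expr1; lra.
  rewrite exprS -[k.+2%:R]natr1.
  have : 1 <= k.+1%:R :> R by rewrite ler1n.
  lra.
case: (ex_minnP ex) => -[|k] tk kmin; first by exists 0; rewrite expr0 t1.
exists k.+1; rewrite tk andbT leNgt; apply/negP => tk'.
by have := kmin _ tk'; rewrite ltnn.
Qed.

Lemma measurable_sumsq n : measurable_fun setT (fun x : 'rV[R]_n => \sum_(i < n) x ord0 i ^+ 2).
Proof.
apply: measurable_sum => i.
by apply: measurable_funX; exact: measurable_rV_coord.
Qed.

(** With 1 + |x|^2 between 4^k and 4^(k+1), the integrand is at most [th ^+ k] and x lies in the
    cube of half-side 2^(k+1); so the sum of the [g k] is a majorant, whose integrals form a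
    geometric series. *)
Lemma integrable_decay n (m : R) : n%:R / 2 < m ->
  (@lebesgue_rV R n).-integrable setT
    (fun x => ((1 + \sum_(i < n) x ord0 i ^+ 2) `^ (- m))%:E).
Proof.
move=> nm.
have m0 : 0 < m by apply: le_lt_trans nm; rewrite divr_ge0.
pose th := 4 `^ (- m) : R.
have th0 : 0 < th by rewrite powR_gt0.
have mf : measurable_fun setT
    (fun x : 'rV[R]_n => (1 + \sum_(i < n) x ord0 i ^+ 2) `^ (- m)).
  apply: (measurableT_comp (@measurable_powR R (- m))).
  by apply: measurable_funD => //; exact: measurable_sumsq.
apply/integrableP; split; first exact/measurable_EFinP.
pose g k (x : 'rV[R]_n) : \bar R := ((th ^+ k)%:E * (\1_(@box n (2 ^+ k.+1)) x)%:E)%E.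
have g0 k x : (0 <= g k x)%E by rewrite /g mule_ge0// lee_fin ?exprn_ge0// ltW.
have mg k : measurable_fun setT (g k).
  apply: emeasurable_funM => //; apply/measurable_EFinP/measurable_indicP; exact: measurable_box.
apply: (@le_lt_trans _ _ (\int[@lebesgue_rV R n]_x \sum_(0 <= k <oo) g k x)%E).
  apply: ge0_le_integral => //.
  - by apply: measurableT_comp => //; exact/measurable_EFinP.
  - by apply: (@ge0_emeasurable_sum _ _ _ _ g xpredT) => k *; [exact: g0|exact: mg].
  move=> x _.
  set t : R := 1 + \sum_(i < n) x ord0 i ^+ 2.
  have t1 : 1 <= t by rewrite /t lerDl sumr_ge0// => i _; exact: sqr_ge0.
  have [k /andP[kt tk]] := dyadic_bracket t1.
  apply: (@le_trans _ _ (g k x)).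
    rewrite /g indicE mem_set ?mule1/=; last first.
      move=> i; rewrite -ler_sqr ?nnegrE ?exprn_ge0// real_normK ?num_real//.
      rewrite -exprM mulnC exprM -natrX.
      apply: le_trans (ltW tk); rewrite /t (bigD1 i)//=.
      by rewrite addrCA lerDl addr_ge0// sumr_ge0// => j _; exact: sqr_ge0.
    rewrite lee_fin ger0_norm ?powR_ge0// /th -powR_mulrn ?powR_ge0//.
    rewrite -powRrM mulrC powRrM powR_mulrn// !powRN.
    rewrite lef_pV2 ?posrE ?powR_gt0 ?exprn_gt0//; last by apply: lt_le_trans t1.
    by rewrite ge0_ler_powR ?nnegrE ?exprn_ge0 ?(ltW m0)// (le_trans ler01).
  apply: le_trans (nneseries_lim_ge k.+1 _) => //.
  by rewrite big_nat_recr//= leeDr// sume_ge0.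
rewrite integral_nneseries//.
(* The k-th cube has volume 4^n 2^(nk), so the k-th integral is 4^n z^k. Since z = 4^(n/2 - m), the
   ratio is below 1 exactly when m > n/2. *)
pose z := th * 2 ^+ n.
have z0 : 0 < z by rewrite mulr_gt0// exprn_gt0.
have z1 : z < 1.
  rewrite /z /th.
  have -> : 2 ^+ n = 4 `^ (n%:R / 2) :> R.
    have -> : 4 = 2 `^ 2 :> R by rewrite powR_mulrn//; lra.
    rewrite -powRrM mulrCA divff ?mulr1 ?powR_mulrn//.
  rewrite -powRD; last by rewrite implybE; apply/orP; right; lra.
  rewrite (_ : - m + n%:R / 2 = - (m - n%:R / 2)); last by ring.
  rewrite powRN invf_lt1 ?powR_gt0//.
  have d0 : 0 < m - n%:R / 2 by rewrite subr_gt0.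
  have h : 1 `^ (m - n%:R / 2) < 4 `^ (m - n%:R / 2).
    by apply: (gt0_ltr_powR d0); rewrite ?nnegrE; lra.
  by rewrite powR1 in h.
apply: (@le_lt_trans _ _ ((4 ^+ n / (1 - z))%:E)); last exact: ltry.
apply: lime_le; first by apply: is_cvg_nneseries => k _ _; exact: integral_ge0.
apply: nearW => K.
apply: le_trans (_ : (series (geometric (4 ^+ n) z) K)%:E <= _)%E; last first.
  rewrite lee_fin; apply: geometric_le_lim => //; rewrite ?exprn_ge0//.
  by rewrite ger0_norm// ltW.
rewrite /series/= -sumEFin; apply: lee_sum => k _.
rewrite /g ge0_integralZl//; last 2 first.
- apply/measurable_EFinP/measurable_indicP; exact: measurable_box.
- by rewrite lee_fin exprn_ge0// ltW.
rewrite integral_indic//; last exact: measurable_box.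
rewrite setIT/= lebesgue_rV_box ?exprn_ge0// -EFinM lee_fin.
rewrite /z le_eqVlt; apply/orP; left; apply/eqP.
rewrite exprS !exprMn -!exprM.
have -> : 4 ^+ n = 2 ^+ n * 2 ^+ n :> R by rewrite -exprMn; congr (_ ^+ _); lra.
by rewrite [(k * n)%N]mulnC; ring.
Qed.

End decay.

(** * Symbolic calculus of smooth functions *)

Section directional.
Context {R : realType} {n : nat}.
Implicit Types (f : 'rV[R]_n -> R) (x v : 'rV[R]_n).

(** The two difference quotients are the same function of h. Directional derivatives thus reduce to
    the one-variable calculus along a line. *)
Lemma is_derive_line f x v df :
  is_derive x v f df <-> is_derive (0 : R) 1 (fun t : R => f (x + t *: v)) df.
Proof.
have E : (fun h : R => h^-1 *: ((f \o shift x) (h *: v) - f x)) =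
  (fun h : R => h^-1 *: (((fun t : R => f (x + t *: v)) \o shift 0) (h *: 1)
     - (fun t : R => f (x + t *: v)) 0)).
  apply/funext => h; congr (_ *: (f _ - f _)) => /=.
    by rewrite addr0 addrC (_ : h *: (1 : R) = h)//; exact: mulr1.
  by rewrite scale0r addr0.
split => -[D1 D2]; split.
- by move: D1; rewrite /derivable E.
- by move: D2; rewrite /derive E.
- by move: D1; rewrite /derivable E.
- by move: D2; rewrite /derive E.
Qed.

Lemma is_derive_comp1 (g : R -> R) f x v df dg :
  is_derive x v f df -> is_derive (f x) 1 g dg ->
  is_derive x v (fun y => g (f y)) (dg * df).
Proof.
move=> /is_derive_line Df Dg; apply/is_derive_line.
have Dg' : is_derive ((fun t : R => f (x + t *: v)) 0) 1 g dg.
  by rewrite scale0r addr0.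
exact: (is_derive1_comp (f := g) (g := fun t : R => f (x + t *: v))).
Qed.

End directional.

Section flat.
Context {R : realType}.

(* flat 0 is the classical C^oo function exp(-1/t) 1_{t>0}; the family is closed
   under differentiation. *)
Definition flat (k : nat) (t : R) : R :=
  if 0 < t then t^-1 ^+ k * expR (- t^-1) else 0.

Lemma flat_ge0 k t : 0 <= flat k t.
Proof.
rewrite /flat; case: ifPn => // t0.
by rewrite mulr_ge0 ?expR_ge0// exprn_ge0// invr_ge0 ltW.
Qed.

Lemma expR_ge_exprn (m : nat) (x : R) : 0 <= x -> x ^+ m.+1 <= m.+1`!%:R * expR x.
Proof.
move=> x0; rewrite -ler_pdivrMl ?ltr0n ?fact_gt0// mulrC.
by apply: le_trans (expR_ge1Dxn m x0); rewrite lerDr.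
Qed.

(** From exp(1/t) >= t^(-(k+2)) / (k+2)!. The quadratic order makes the difference quotient at 0
    vanish in the limit, and the same estimate bounds [flat k] on t <= 1. *)
Lemma flat_le k t : flat k t <= k.+2`!%:R * t ^+ 2.
Proof.
rewrite /flat; case: ifPn => t0; last by rewrite mulr_ge0 ?sqr_ge0.
have tn0 : t != 0 by rewrite gt_eqF.
rewrite expRN ler_pdivrMr ?expR_gt0// mulrAC -ler_pdivrMr ?exprn_gt0//.
have ti : 0 <= t^-1 by rewrite invr_ge0 ltW.
apply: le_trans (expR_ge_exprn k.+1 ti).
by rewrite -exprVn -exprD addn2.
Qed.

Lemma is_derive_flat k (t : R) :
  is_derive t 1 (flat k) (flat k.+2 t - k%:R * flat k.+1 t).
Proof.
have [t0|t0|->] := ltgtP t 0.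
- have -> : flat k.+2 t - k%:R * flat k.+1 t = 0.
    by rewrite /flat ltNge (ltW t0)/= mulr0 subr0.
  apply: (@near_eq_is_derive _ _ _ (cst 0)) => //.
    near=> u; rewrite /flat ltNge ltW//=; near: u; exact: lt_nbhsl.
- apply: (@near_eq_is_derive _ _ _ (fun t : R => t^-1 ^+ k * expR (- t^-1))) => //.
    near=> u; rewrite /flat ifT//; near: u; exact: lt_nbhsr.
  have tn0 : t != 0 by rewrite gt_eqF.
  have D1 : is_derive t 1 (fun t : R => t^-1) (- t^-1 ^+ 2).
    have D := @is_deriveV R id t 1 1 tn0 (is_derive_id _ _).
    by apply: (is_derive_eq D); rewrite exprVn; exact: mulr1.
  have D1N : is_derive t 1 (fun t : R => - t^-1) (t^-1 ^+ 2).
    by apply: (is_derive_eq (is_deriveN D1)); rewrite opprK.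
  have D2 : is_derive t 1 (fun t : R => expR (- t^-1)) (expR (- t^-1) * t^-1 ^+ 2).
    exact: (is_derive1_comp (f := expR) (g := fun t : R => - t^-1)).
  have D3 : is_derive t 1 (fun t : R => t^-1 ^+ k) (k%:R * t^-1 ^+ k.-1 * - t^-1 ^+ 2).
    have -> : (fun t : R => t^-1 ^+ k) = (fun t : R => t^-1) ^+ k.
      by apply/funext => u; rewrite exprfctE.
    by apply: (is_derive_eq (is_deriveX k D1)).
  apply: (is_derive_eq (is_deriveM D3 D2)).
  rewrite /flat t0 /GRing.scale/=.
  case: k {D3} => [|k]; first by rewrite !expr0; ring.
  by rewrite /= !exprS; ring.
- have -> : flat k.+2 0 - k%:R * flat k.+1 0 = 0 :> R.
    by rewrite /flat ltxx mulr0 subr0.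
  have L : h^-1 *: ((flat k \o shift 0) (h *: (1 : R)) - flat k 0) @[h --> (0:R)^'] --> (0 : R).
    pose C : R := k.+2`!%:R.
    have C0 : 0 < C by rewrite ltr0n fact_gt0.
    apply/cvgrPdist_le => e e0; near=> h.
    rewrite sub0r normrN /= addr0 {2}/flat ltxx subr0 [h *: 1]mulr1.
    rewrite normrM normfV.
    have h0 : h != 0 by near: h; exact: nbhs_dnbhs_neq.
    rewrite ler_pdivrMl ?normr_gt0// ger0_norm ?flat_ge0//.
    apply: le_trans (flat_le _ _) _; rewrite -/C -real_normK ?num_real//.
    rewrite expr2 mulrCA ler_pM2l ?normr_gt0// -ler_pdivlMl//.
    near: h; apply: dnbhs0_le; by rewrite mulr_gt0 ?invr_gt0.
  by apply: DeriveDef; [apply/cvg_ex; exists 0|exact: cvg_lim].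
Unshelve. all: by end_near. Qed.

Lemma continuous_flat k : continuous (flat k).
Proof.
move=> t; apply: differentiable_continuous; apply/derivable1_diffP.
exact: (@ex_derive _ _ _ _ _ _ _ (is_derive_flat k t)).
Qed.

Lemma measurable_flat k : measurable_fun setT (flat k).
Proof. exact: continuous_measurable_fun (@continuous_flat k). Qed.

End flat.

Section expressions.
Context {R : realType} {n : nat}.
Variable x0 : 'rV[R]_n.
Implicit Types (x B : 'rV[R]_n).

Definition quad (A : R) B (C : R) x : R :=
  A * (\sum_i (x - x0) ord0 i ^+ 2) + 2 * (\sum_i B ord0 i * (x - x0) ord0 i) + C.

(* Smoothness, partial derivatives and growth are read off the syntax; ePow is the
   real power of a positive expression. *)
Inductive expr :=
| eCst of R
| eCoord of 'I_n
| eQuad of R & 'rV[R]_n & R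
| eAdd of expr & expr
| eMul of expr & expr
| ePow of expr & R
| eFlat of nat & expr.

Fixpoint eval (e : expr) x : R :=
  match e with
  | eCst r => r
  | eCoord i => (x - x0) ord0 i
  | eQuad A B C => quad A B C x
  | eAdd a b => eval a x + eval b x
  | eMul a b => eval a x * eval b x
  | ePow a r => eval a x `^ r
  | eFlat k a => flat k (eval a x)
  end.

Fixpoint ediff (j : 'I_n) (e : expr) : expr :=
  match e with
  | eCst _ => eCst 0
  | eCoord i => eCst (i == j)%:R
  | eQuad A B C => eAdd (eMul (eCst (2 * A)) (eCoord j)) (eCst (2 * B ord0 j))
  | eAdd a b => eAdd (ediff j a) (ediff j b)
  | eMul a b => eAdd (eMul a (ediff j b)) (eMul b (ediff j a))
  | ePow a r => eMul (eMul (eCst r) (ePow a (r - 1))) (ediff j a)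
  | eFlat k a =>
      eMul (eAdd (eFlat k.+2 a) (eMul (eCst (- k%:R)) (eFlat k.+1 a))) (ediff j a)
  end.

Fixpoint wf (e : expr) : Prop :=
  match e with
  | eAdd a b | eMul a b => wf a /\ wf b
  | ePow a _ => wf a /\ forall x, 0 < eval a x
  | eFlat _ a => wf a
  | _ => True
  end.

Lemma wf_ediff j e : wf e -> wf (ediff j e).
Proof.
elim: e => //= [a IHa b IHb [/IHa ? /IHb ?]//|a IHa b IHb [wa wb]|a IHa r [wa a0]|k a IHa wa].
- by split; split => //; [exact: IHb|exact: IHa].
- by split=> //; exact: IHa.
- by split=> //; exact: IHa.
Qed.

Lemma coord_line x j i (t : R) :
  (x + t *: delta_mx ord0 j - x0) ord0 i = (x - x0) ord0 i + t * (i == j)%:R.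
Proof. by rewrite !mxE/= addrAC. Qed.

Lemma quad_line A B C x j (t : R) :
  quad A B C (x + t *: delta_mx ord0 j) =
  quad A B C x + t * (2 * A * (x - x0) ord0 j + 2 * B ord0 j) + A * t ^+ 2.
Proof.
rewrite /quad.
have -> : \sum_i (x + t *: delta_mx ord0 j - x0) ord0 i ^+ 2 =
    \sum_i (x - x0) ord0 i ^+ 2 + 2 * t * (x - x0) ord0 j + t ^+ 2.
  rewrite (bigD1 j)//= [in RHS](bigD1 j)//= coord_line eqxx mulr1.
  under eq_bigr => i ij do rewrite coord_line (negPf ij) mulr0 addr0.
  ring.
have -> : \sum_i B ord0 i * (x + t *: delta_mx ord0 j - x0) ord0 i =
    \sum_i B ord0 i * (x - x0) ord0 i + t * B ord0 j.
  rewrite (bigD1 j)//= [in RHS](bigD1 j)//= coord_line eqxx mulr1.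
  under eq_bigr => i ij do rewrite coord_line (negPf ij) mulr0 addr0.
  ring.
ring.
Qed.

Lemma is_derive_poly2 (a b c : R) :
  is_derive (0 : R) 1 (fun t : R => a + t * b + c * t ^+ 2) b.
Proof.
have Did : is_derive (0 : R) 1 (fun t : R => t) 1 by exact: is_derive_id.
have D1 : is_derive (0 : R) 1 (fun t : R => t * b) b.
  apply: (is_derive_eq (is_deriveM Did (is_derive_cst b _ _))).
  by rewrite scaler0 add0r; exact: mulr1.
have D2 : is_derive (0 : R) 1 (fun t : R => c * t ^+ 2) 0.
  have D := is_deriveM (is_derive_cst c (0 : R) 1) (is_deriveM Did Did).
  by apply: (is_derive_eq D); rewrite !scaler0 !scale0r !addr0 scaler0.
have D3 := is_deriveD (is_deriveD (is_derive_cst a (0 : R) 1) D1) D2.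
by apply: (is_derive_eq D3); rewrite add0r addr0.
Qed.

Lemma is_derive_eval j e x : wf e ->
  is_derive x (delta_mx ord0 j) (eval e) (eval (ediff j e) x).
Proof.
elim: e => [r|i|A B C|a IHa b IHb|a IHa b IHb|a IHa r|k a IHa] /=.
- by move=> _; exact: is_derive_cst.
- move=> _; apply/is_derive_line; under eq_fun do rewrite coord_line.
  have := is_derive_poly2 ((x - x0) ord0 i) (i == j)%:R 0.
  by under eq_fun do rewrite mul0r addr0.
- move=> _; apply/is_derive_line; under eq_fun do rewrite quad_line.
  exact: is_derive_poly2.
- move=> [/IHa Da /IHb Db]; exact: (is_deriveD Da Db).
- move=> [/IHa Da /IHb Db]; exact: (is_deriveM Da Db).
- move=> [/IHa Da a0].
  exact: (@is_derive_comp1 _ _ (fun t => t `^ r) _ _ _ _ _ Da (is_derive1_powR _ (a0 x))).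
- move=> /IHa Da.
  apply: is_derive_eq (@is_derive_comp1 _ _ (flat k) _ _ _ _ _ Da (is_derive_flat k _)) _.
  by rewrite mulNr.
Qed.

Lemma partial_eval j e : wf e -> partial j (eval e) = eval (ediff j e).
Proof.
by move=> we; apply/funext => x; rewrite /partial; case: (is_derive_eval j x we).
Qed.

Lemma continuous_eval e : wf e -> continuous (eval e).
Proof.
have C1 i : continuous (fun x : 'rV[R]_n => (x - x0) ord0 i).
  have -> : (fun x : 'rV[R]_n => (x - x0) ord0 i) = (fun x => x ord0 i - x0 ord0 i).
    by apply/funext => x; rewrite !mxE.
  by move=> x; apply: continuousB; [exact: coord_continuous|exact: cst_continuous].
elim: e => [r|i|A B C|a IHa b IHb|a IHa b IHb|a IHa r|k a IHa] /=.
- by move=> _; exact: cst_continuous.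
- by move=> _; exact: C1.
- move=> _ x.
  have Cs (F : 'I_n -> 'rV[R]_n -> R) : (forall i, continuous (F i)) ->
      continuous (fun y => \sum_i F i y).
    move=> CF; elim: (index_enum _) => [|i r IH].
      by under eq_fun do rewrite big_nil; exact: cst_continuous.
    under eq_fun do rewrite big_cons.
    by move=> y; apply: continuousD; [exact: CF|exact: IH].
  have D1 : continuous (fun y : 'rV[R]_n => A * (\sum_i (y - x0) ord0 i ^+ 2)).
    move=> y; apply: continuousM; first exact: cst_continuous.
    by apply: Cs => i z; apply: (@continuousM _ _ _ _ _ (C1 i z) (C1 i z)).
  have D2 : continuous (fun y : 'rV[R]_n => 2 * (\sum_i B ord0 i * (y - x0) ord0 i)).
    move=> y; apply: (@continuousM _ _ (cst 2)); first exact: cst_continuous.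
    by apply: Cs => i z; apply: (@continuousM _ _ (cst (B ord0 i))); [exact: cst_continuous|exact: C1].
  have D := continuousD (continuousD (D1 x) (D2 x)) (@cst_continuous _ _ C x).
  exact: D.
- by move=> [/IHa Ca /IHb Cb] x; exact: (continuousD (Ca x) (Cb x)).
- by move=> [/IHa Ca /IHb Cb] x; exact: (continuousM (Ca x) (Cb x)).
- move=> [/IHa Ca a0] x.
  apply: (@continuous_comp _ _ _ (eval a) (fun t => t `^ r)); first exact: Ca.
  apply: differentiable_continuous; apply/derivable1_diffP.
  exact: (@ex_derive _ _ _ _ _ _ _ (is_derive1_powR r (a0 x))).
- move=> /IHa Ca x.
  apply: (@continuous_comp _ _ _ (eval a) (flat k)); first exact: Ca.
  exact: continuous_flat.
Qed.

Lemma measurable_eval e : measurable_fun setT (eval e).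
Proof.
have mc i : measurable_fun setT (fun x : 'rV[R]_n => (x - x0) ord0 i).
  have -> : (fun x : 'rV[R]_n => (x - x0) ord0 i) = (fun x => x ord0 i - x0 ord0 i).
    by apply/funext => x; rewrite !mxE.
  by apply: measurable_funD => //; exact: measurable_rV_coord.
elim: e => [r|i|A B C|a IHa b IHb|a IHa b IHb|a IHa r|k a IHa] //=.
- apply: measurable_funD => //; apply: measurable_funD; apply: measurable_funM => //.
    by apply: measurable_sum => i; exact: measurable_funX.
  by apply: measurable_sum => i; exact: measurable_funM.
- exact: measurable_funD.
- exact: measurable_funM.
- exact: (measurableT_comp (@measurable_powR R r)).
- exact: (measurableT_comp (measurable_flat k)).
Qed.

Lemma foldr_partial_eval (s : seq 'I_n) e : wf e ->
  foldr partial (eval e) s = eval (foldr ediff e s) /\ wf (foldr ediff e s).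
Proof.
move=> we; elim: s => [//|j s [IH1 IH2]] /=.
by rewrite IH1 partial_eval//; split=> //; exact: wf_ediff.
Qed.

Lemma smooth_eval e : wf e -> smooth (eval e).
Proof.
move=> we s; have [-> ws] := foldr_partial_eval s we.
split; first exact: continuous_eval.
by move=> j x; case: (is_derive_eval j x ws).
Qed.

Lemma laplacian_eval e x : wf e ->
  laplacian (eval e) x = \sum_j eval (ediff j (ediff j e)) x.
Proof.
move=> we; apply: eq_bigr => j _; rewrite partial_eval// partial_eval//.
exact: wf_ediff.
Qed.

End expressions.

(** * Stereographic coordinates *)

Section laplacians.
Context {R : realType} {n : nat}.
Variable x0 : 'rV[R]_n.
Implicit Types (x B : 'rV[R]_n) (A C a b d : R).

Local Notation S x := (\sum_i (x - x0) ord0 i ^+ 2).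
Local Notation T B x := (\sum_i B ord0 i * (x - x0) ord0 i).

Lemma powRB1 (q a : R) : 0 < q -> q `^ (a - 1) = q `^ a / q.
Proof. by move=> q0; rewrite powRB ?powRr1 ?(ltW q0)// (gt_eqF q0) implybT. Qed.

Lemma sum_quadratic (c0 c1 c2 c3 : R) B x :
  \sum_j (c0 * (x - x0) ord0 j ^+ 2 + c1 * (B ord0 j * (x - x0) ord0 j)
          + c2 * B ord0 j ^+ 2 + c3) =
  c0 * S x + c1 * T B x + c2 * (\sum_j B ord0 j ^+ 2) + c3 * n%:R.
Proof.
by rewrite !big_split/= -!big_distrr/= sumr_const card_ord mulr_natr.
Qed.

(** The second derivative in direction j is a combination of (x - x0)_j^2, B_j (x - x0)_j, B_j^2 and
    1 with coefficients independent of j, so [sum_quadratic] adds them up. *)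
Lemma laplacian_powM d A B C a b x :
  (forall x, 0 < quad x0 1 0 d x) -> (forall x, 0 < quad x0 A B C x) ->
  laplacian (eval x0 (eMul (ePow (eQuad 1 0 d) a) (ePow (eQuad A B C) b))) x =
  let q := quad x0 1 0 d x in let Q := quad x0 A B C x in
  q `^ a * Q `^ b *
  (4 * a * (a - 1) / q ^+ 2 * S x + 2 * a / q * n%:R
   + 8 * a * b / (q * Q) * (A * S x + T B x)
   + 4 * b * (b - 1) / Q ^+ 2 *
       (A ^+ 2 * S x + 2 * A * T B x + \sum_j B ord0 j ^+ 2)
   + 2 * A * b / Q * n%:R).
Proof.
move=> q0 Q0; rewrite laplacian_eval//.
have E j : eval x0 (ediff j (ediff j (eMul (ePow (eQuad 1 0 d) a) (ePow (eQuad A B C) b)))) x =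
   let q := quad x0 1 0 d x in let Q := quad x0 A B C x in
   let W := q `^ a * Q `^ b in
   (W * (4 * a * (a - 1) / q ^+ 2 + 8 * a * b / (q * Q) * A + 4 * b * (b - 1) / Q ^+ 2 * A ^+ 2))
     * (x - x0) ord0 j ^+ 2
   + (W * (8 * a * b / (q * Q) + 8 * b * (b - 1) / Q ^+ 2 * A)) * (B ord0 j * (x - x0) ord0 j)
   + (W * (4 * b * (b - 1) / Q ^+ 2)) * B ord0 j ^+ 2
   + W * (2 * a / q + 2 * A * b / Q).
  rewrite /= !powRB1// (_ : (0 : 'rV[R]_n) ord0 j = 0); last by rewrite mxE.
  rewrite eqxx mulr1n.
  have := q0 x; have := Q0 x.
  move: (quad x0 1 0 d x) (quad x0 A B C x) => q Q Qp qp.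
  by field; rewrite !gt_eqF.
under eq_bigr do rewrite E; rewrite /= sum_quadratic.
ring.
Qed.

Lemma laplacian_pow_quad d A B C a x :
  (forall x, 0 < quad x0 1 0 d x) ->
  laplacian (eval x0 (eMul (ePow (eQuad 1 0 d) a) (eQuad A B C))) x =
  let q := quad x0 1 0 d x in let Q := quad x0 A B C x in
  q `^ a *
  ((4 * a * (a - 1) / q ^+ 2 * S x + 2 * a / q * n%:R) * Q
   + 8 * a / q * (A * S x + T B x) + 2 * A * n%:R).
Proof.
move=> q0; rewrite laplacian_eval//.
have E j : eval x0 (ediff j (ediff j (eMul (ePow (eQuad 1 0 d) a) (eQuad A B C)))) x =
   let q := quad x0 1 0 d x in let Q := quad x0 A B C x in
   (q `^ a * (4 * a * (a - 1) / q ^+ 2 * Q + 8 * a / q * A)) * (x - x0) ord0 j ^+ 2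
   + (q `^ a * (8 * a / q)) * (B ord0 j * (x - x0) ord0 j)
   + 0 * B ord0 j ^+ 2
   + q `^ a * (2 * a / q * Q + 2 * A).
  rewrite /= !powRB1// (_ : (0 : 'rV[R]_n) ord0 j = 0); last by rewrite mxE.
  rewrite eqxx mulr1n.
  have := q0 x.
  move: (quad x0 1 0 d x) (quad x0 A B C x) => q Q qp.
  by field; rewrite !gt_eqF.
under eq_bigr do rewrite E; rewrite /= sum_quadratic.
ring.
Qed.

End laplacians.

Section geometry.
Context {R : realType} {n : nat}.
Variables (x0 : 'rV[R]_n) (delta : R).
Hypothesis delta0 : 0 < delta.
Implicit Types (x B : 'rV[R]_n) (b a s : R).

Definition qf := quad x0 1 0 (delta ^+ 2).
(** Inverse stereographic projection sends x to the point (2 delta (x - x0), |x - x0|^2 - delta^2) /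
    q of the unit sphere; [Pf B b] is the numerator of the linear form with coefficients (B, b) at
    that point, and [Qf B b] is the sum of [qf] and [Pf B b]. *)
Definition Pf B b := quad x0 b (delta *: B) (- b * delta ^+ 2).
Definition Qf B b := quad x0 (1 + b) (delta *: B) ((1 - b) * delta ^+ 2).

(* In stereographic coordinates hf B b is the restriction to the sphere of the
   linear form with coefficients (B, b). *)
Definition hf B b x := Pf B b x / qf x.
Definition zf B b x := 1 + hf B b x.
(** An l^1 norm, because the coordinates on the sphere are bounded by 1 one by one; the recurrent
    condition [nrm1 B b <= 2^-1] keeps [zf] between 1/2 and 3/2. By contrast [nrm2] is the square of
    the Euclidean norm, the quantity that enters the exact formulas. *)
Definition nrm1 B b : R := \sum_i `|B ord0 i| + `|b|.
Definition nrm2 B b : R := \sum_i B ord0 i ^+ 2 + b ^+ 2.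

Lemma qfE x : qf x = \sum_i (x - x0) ord0 i ^+ 2 + delta ^+ 2.
Proof.
rewrite /qf /quad mul1r (_ : \sum_i (0 : 'rV[R]_n) ord0 i * (x - x0) ord0 i = 0).
  by rewrite mulr0 addr0.
by rewrite big1// => i _; rewrite mxE mul0r.
Qed.

Lemma PfE B b x : Pf B b x = b * (\sum_i (x - x0) ord0 i ^+ 2 - delta ^+ 2)
  + 2 * delta * \sum_i B ord0 i * (x - x0) ord0 i.
Proof.
rewrite /Pf /quad (_ : \sum_i (delta *: B) ord0 i * (x - x0) ord0 i =
  delta * \sum_i B ord0 i * (x - x0) ord0 i); last first.
  by rewrite big_distrr/=; apply: eq_bigr => i _; rewrite mxE mulrA.
ring.
Qed.

Lemma sumsq_ge0 x : 0 <= \sum_i (x - x0) ord0 i ^+ 2.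
Proof. by apply: sumr_ge0 => i _; exact: sqr_ge0. Qed.

Lemma qf_ge x : delta ^+ 2 <= qf x.
Proof. by rewrite qfE lerDr sumsq_ge0. Qed.

Lemma qf_gt0 x : 0 < qf x.
Proof. by apply: lt_le_trans (qf_ge x); rewrite exprn_gt0. Qed.

Lemma coord_le_qf x i : (x - x0) ord0 i ^+ 2 <= qf x.
Proof.
rewrite qfE (bigD1 i)//= -addrA lerDl addr_ge0 ?sqr_ge0//.
by apply: sumr_ge0 => j _; exact: sqr_ge0.
Qed.

Lemma Qf_qfPf B b x : Qf B b x = qf x + Pf B b x.
Proof. by rewrite qfE /Pf /Qf /quad; ring. Qed.

Lemma Qf_zf B b x : Qf B b x = qf x * zf B b x.
Proof.
rewrite Qf_qfPf /zf /hf mulrDr mulr1 mulrCA divff ?mulr1//.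
by rewrite gt_eqF// qf_gt0.
Qed.

(** Each coordinate of a point of the sphere has absolute value at most 1: 2 delta |(x - x0)_i| <= q
    by completing squares, and ||x - x0|^2 - delta^2| <= q. *)
Lemma hf_le B b x : `|hf B b x| <= nrm1 B b.
Proof.
rewrite /hf normrM normfV (gtr0_norm (qf_gt0 x)) ler_pdivrMr ?qf_gt0//.
rewrite PfE [X in `|X|]addrC /nrm1 [leRHS]mulrDl; apply: le_trans (ler_normD _ _) _.
 apply: lerD.
  rewrite big_distrr/= big_distrl/=; apply: le_trans (ler_norm_sum _ _ _) _.
  apply: ler_sum => i _; rewrite mulrCA normrM ler_wpM2l//.
  have yq : (x - x0) ord0 i ^+ 2 + delta ^+ 2 <= qf x.
    rewrite qfE lerD2r (bigD1 i)//= lerDl.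
    by apply: sumr_ge0 => j _; exact: sqr_ge0.
  apply: le_trans yq; rewrite ler_norml.
  have h1 := sqr_ge0 ((x - x0) ord0 i - delta).
  have h2 := sqr_ge0 ((x - x0) ord0 i + delta).
  by apply/andP; split; nra.
rewrite normrM ler_wpM2l// ler_norml qfE.
have := sumsq_ge0 x; have := sqr_ge0 delta.
by move=> h1 h2; apply/andP; split; lra.
Qed.

Lemma hfZ t B b x : hf (t *: B) (t * b) x = t * hf B b x.
Proof.
rewrite /hf !PfE (_ : \sum_i (t *: B) ord0 i * (x - x0) ord0 i =
  t * \sum_i B ord0 i * (x - x0) ord0 i).
  by ring.
by rewrite big_distrr/=; apply: eq_bigr => i _; rewrite mxE mulrA.
Qed.

Lemma hfD B b B' b' x : hf (B + B') (b + b') x = hf B b x + hf B' b' x.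
Proof.
rewrite /hf !PfE (_ : \sum_i (B + B') ord0 i * (x - x0) ord0 i =
  \sum_i B ord0 i * (x - x0) ord0 i + \sum_i B' ord0 i * (x - x0) ord0 i).
  by ring.
by rewrite -big_split/=; apply: eq_bigr => i _; rewrite mxE mulrDl.
Qed.

Lemma hf0 x : hf 0 0 x = 0.
Proof. by have := hfZ 0 0 0 x; rewrite scaler0 !mul0r. Qed.

Lemma measurable_qf : measurable_fun setT qf.
Proof. exact: (measurable_eval x0 (eQuad 1 0 (delta ^+ 2))). Qed.

Lemma measurable_hf B b : measurable_fun setT (hf B b).
Proof.
have -> : hf B b = (fun x => Pf B b x * qf x `^ (- 1)).
  apply/funext => x; rewrite powR_inv1 ?ltW ?qf_gt0//.
apply: measurable_funM; first exact: (measurable_eval x0 (eQuad b (delta *: B) (- b * delta ^+ 2))).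
exact: (measurable_eval x0 (ePow (eQuad 1 0 (delta ^+ 2)) (-1))).
Qed.

Lemma zf_bounds B b x : nrm1 B b <= 2^-1 -> 2^-1 <= zf B b x <= 3 / 2.
Proof.
move=> u; have := le_trans (hf_le B b x) u; rewrite /zf ler_norml => /andP[? ?].
by apply/andP; split; lra.
Qed.

Lemma zf_gt0 B b x : nrm1 B b <= 2^-1 -> 0 < zf B b x.
Proof. by move=> /zf_bounds -/(_ x)/andP[h _]; apply: lt_le_trans h; rewrite invr_gt0. Qed.

Lemma Qf_gt0 B b : nrm1 B b <= 2^-1 -> forall x, 0 < Qf B b x.
Proof. by move=> u x; rewrite Qf_zf mulr_gt0 ?qf_gt0 ?zf_gt0. Qed.

Lemma nrm2_ge0 B b : 0 <= nrm2 B b.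
Proof. by rewrite addr_ge0 ?sqr_ge0// sumr_ge0// => i _; exact: sqr_ge0. Qed.

Lemma nrm2_le B b : nrm1 B b <= 2^-1 -> nrm2 B b <= 2^-1.
Proof.
move=> u.
have n0 : 0 <= nrm1 B b by rewrite addr_ge0// sumr_ge0.
have t0 (t : R) : `|t| <= nrm1 B b -> t ^+ 2 <= nrm1 B b * `|t|.
  by move=> tn; rewrite -real_normK ?num_real// expr2 ler_wpM2r.
apply: (@le_trans _ _ (nrm1 B b * nrm1 B b)); last by nra.
rewrite /nrm2 {2}/nrm1 mulrDr; apply: lerD.
  rewrite big_distrr/=; apply: ler_sum => i _; apply: t0.
  by rewrite /nrm1 (bigD1 i)//= -addrA lerDl addr_ge0// sumr_ge0.
by apply: t0; rewrite /nrm1 lerDr sumr_ge0.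
Qed.

Local Notation k := ((n%:R - 2) / 2).

(** Written as a product of powers of two quadratic polynomials, the form to which [laplacian_powM]
    and the growth estimates apply; [eval_psi] gives the form q^(-k) (1 + h_u)^(-s). *)
Definition psi_expr s B b : expr :=
  eMul (ePow (eQuad 1 0 (delta ^+ 2)) (s - k))
       (ePow (eQuad (1 + b) (delta *: B) ((1 - b) * delta ^+ 2)) (- s)).

Lemma wf_psi s B b : nrm1 B b <= 2^-1 -> wf x0 (psi_expr s B b).
Proof. by move=> u; split; split=> //; [exact: qf_gt0|exact: Qf_gt0]. Qed.

Lemma eval_psi s B b x : nrm1 B b <= 2^-1 ->
  eval x0 (psi_expr s B b) x = qf x `^ (- k) * zf B b x `^ (- s).
Proof.
move=> u; rewrite /= -/(qf x) -/(Qf B b x) Qf_zf.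
rewrite powRM ?(ltW (qf_gt0 x)) ?(ltW (zf_gt0 x u))// mulrA; congr (_ * _).
rewrite -powRD; first by congr (_ `^ _); ring.
by rewrite (gt_eqF (qf_gt0 x)) implybT.
Qed.

(** The bracket is the conformal Laplacian -Delta_S + n(n-2)/4 of the sphere applied to (1 +
    h)^(-s), expanded by means of Delta_S h = -n h and |grad h|^2 = |u|^2 - h^2. The proof stays in
    R^n: it eliminates |x - x0|^2 and B.(x - x0) in favour of [qf] and [zf]. *)
Lemma laplacian_psi s B b x : nrm1 B b <= 2^-1 ->
  laplacian (eval x0 (psi_expr s B b)) x =
  - (4 * delta ^+ 2 * qf x `^ (- ((n%:R + 2) / 2)) *
     ((s - k) * (s - k - 1) * zf B b x `^ (- s)
      + s * (s + 1) * (1 - nrm2 B b) * zf B b x `^ (- (s + 2))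
      - 2 * (s - k) * s * zf B b x `^ (- (s + 1)))).
Proof.
move=> u; rewrite laplacian_powM; [|exact: qf_gt0|exact: Qf_gt0].
rewrite /= -/(qf x) -/(Qf B b x).
have := eval_psi s x u; rewrite /= -/(qf x) -/(Qf B b x) => ->.
have z0 := zf_gt0 x u; have q0 := qf_gt0 x.
have -> : zf B b x `^ (- (s + 2)) = zf B b x `^ (- s) / zf B b x / zf B b x.
  by rewrite -!powRB1//; congr (_ `^ _); ring.
have -> : zf B b x `^ (- (s + 1)) = zf B b x `^ (- s) / zf B b x.
  by rewrite -!powRB1//; congr (_ `^ _); ring.
have -> : qf x `^ (- ((n%:R + 2) / 2)) = qf x `^ (- k) / qf x / qf x.
  by rewrite -!powRB1//; congr (_ `^ _); field.
have ES : \sum_i (x - x0) ord0 i ^+ 2 = qf x - delta ^+ 2 by rewrite qfE addrK.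
have EB : \sum_j (delta *: B) ord0 j ^+ 2 = delta ^+ 2 * (nrm2 B b - b ^+ 2).
  rewrite /nrm2 addrK big_distrr/=; apply: eq_bigr => i _.
  by rewrite mxE exprMn.
have ET : \sum_i (delta *: B) ord0 i * (x - x0) ord0 i =
  (qf x * zf B b x - (1 + b) * (qf x - delta ^+ 2) - (1 - b) * delta ^+ 2) / 2.
  by rewrite -Qf_zf /Qf /quad ES; field.
rewrite ES EB ET Qf_zf.
move: (qf x) (zf B b x) q0 z0 (qf x `^ _) (zf B b x `^ _) (nrm2 B b) => q z q0 z0 X Y M.
by field; rewrite !gt_eqF.
Qed.

Definition Z_expr B b : expr :=
  eMul (ePow (eQuad 1 0 (delta ^+ 2)) (- k - 1)) (eQuad b (delta *: B) (- b * delta ^+ 2)).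

Lemma wf_Z B b : wf x0 (Z_expr B b).
Proof. by split=> //; split=> //; exact: qf_gt0. Qed.

Lemma eval_Z B b x : eval x0 (Z_expr B b) x = qf x `^ (- k) * hf B b x.
Proof.
by rewrite /= -/(qf x) -/(Pf B b x) powRB1 ?qf_gt0// /hf mulrAC mulrA.
Qed.

(** The constant is 4 (n + n(n-2)/4): linear forms are eigenfunctions of -Delta_S with eigenvalue
    n. *)
Lemma laplacian_Z B b x :
  laplacian (eval x0 (Z_expr B b)) x =
  - (n%:R * (n%:R + 2) * delta ^+ 2 * qf x `^ (- ((n%:R + 2) / 2)) * hf B b x).
Proof.
rewrite laplacian_pow_quad; last exact: qf_gt0.
rewrite /= -/(qf x) -/(Pf B b x); have q0 := qf_gt0 x.
rewrite powRB1//.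
have -> : qf x `^ (- ((n%:R + 2) / 2)) = qf x `^ (- k) / qf x / qf x.
  by rewrite -!powRB1//; congr (_ `^ _); field.
have ES : \sum_i (x - x0) ord0 i ^+ 2 = qf x - delta ^+ 2 by rewrite qfE addrK.
have ET : \sum_i (delta *: B) ord0 i * (x - x0) ord0 i =
  (Pf B b x - b * (qf x - delta ^+ 2) + b * delta ^+ 2) / 2.
  by rewrite /Pf /quad ES; field.
rewrite ES ET /hf.
move: (qf x) (Pf B b x) q0 (qf x `^ _) => q P q0 X.
by field; rewrite !gt_eqF.
Qed.

Lemma bubbleE c x : bubble c delta x0 x = c * qf x `^ (- k).
Proof.
rewrite /bubble /enorm sqr_sqrtr; last first.
  by rewrite sumr_ge0// => i _; exact: sqr_ge0.
by rewrite qfE addrC.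
Qed.

Definition bubble_expr c : @expr R n := eMul (eCst c) (ePow (eQuad 1 0 (delta ^+ 2)) (- k)).

Lemma wf_bubble c : wf x0 (bubble_expr c).
Proof. by split=> //; split=> //; exact: qf_gt0. Qed.

Lemma eval_bubble c : bubble c delta x0 = eval x0 (bubble_expr c).
Proof. by apply/funext => x; rewrite bubbleE. Qed.

Lemma nrm1_0 : nrm1 (0 : 'rV[R]_n) 0 = 0.
Proof. by rewrite /nrm1 normr0 addr0 big1// => i _; rewrite mxE normr0. Qed.

Lemma nrm2_0 : nrm2 (0 : 'rV[R]_n) 0 = 0.
Proof. by rewrite /nrm2 expr0n/= addr0 big1// => i _; rewrite mxE expr0n. Qed.

(** The bubble is c times the test function with s = 0 and u = 0, for which only the term k (k + 1)
    = n(n-2)/4 of [laplacian_psi] survives. *)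
Lemma laplacian_bubble c x :
  laplacian (bubble c delta x0) x =
  - (c * (n%:R * (n%:R - 2)) * delta ^+ 2 * qf x `^ (- ((n%:R + 2) / 2))).
Proof.
have u0 : nrm1 (0 : 'rV[R]_n) 0 <= 2^-1 by rewrite nrm1_0 invr_ge0.
have E : laplacian (bubble c delta x0) x = c * laplacian (eval x0 (psi_expr 0 0 0)) x.
  rewrite eval_bubble !laplacian_eval//; [|exact: wf_psi|exact: wf_bubble].
  rewrite mulr_sumr; apply: eq_bigr => j _.
  have P1 : eval x0 (bubble_expr c) = (fun x => c * eval x0 (psi_expr 0 0 0) x).
    apply/funext => y; rewrite eval_psi//= -/(qf y); congr (_ * _).
    by rewrite oppr0 powRr0 mulr1.
  have wp := wf_psi 0 u0.
  have P2 : eval x0 (bubble_expr c) = eval x0 (eMul (eCst c) (psi_expr 0 0 0)) by [].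
  have wb := wf_bubble c.
  rewrite -(partial_eval j (wf_ediff j wb)) -(partial_eval j wb).
  have wm : wf x0 (eMul (eCst c) (psi_expr 0 0 0)) by split.
  by rewrite P2 (partial_eval j wm) (partial_eval j (wf_ediff j wm)) /=; ring.
rewrite E laplacian_psi// nrm2_0 /zf hf0 addr0 !powR1.
by rewrite !(mul0r, mulr0, addr0, subr0, add0r); field.
Qed.

Lemma partial_bubble c j x :
  partial j (bubble c delta x0) x =
  c * (2 - n%:R) * qf x `^ (- k) * ((x - x0) ord0 j / qf x).
Proof.
rewrite eval_bubble partial_eval; last exact: wf_bubble.
rewrite /= -/(qf x) powRB1 ?qf_gt0// (_ : (0 : 'rV[R]_n) ord0 j = 0); last by rewrite mxE.
by field; rewrite gt_eqF// qf_gt0.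
Qed.

(** The dilation corresponds to the last coordinate of the sphere, as the translations in
    [partial_bubble] correspond to the others. *)
Lemma dilation_bubble c x :
  dilation_generator x0 (bubble c delta x0) x =
  - (c * k * qf x `^ (- k) * hf 0 1 x).
Proof.
rewrite /dilation_generator bubbleE.
under eq_bigr do rewrite partial_bubble.
have -> : \sum_(j < n) (x - x0) ord0 j *
    (c * (2 - n%:R) * qf x `^ (- k) * ((x - x0) ord0 j / qf x)) =
  c * (2 - n%:R) * qf x `^ (- k) / qf x * \sum_(j < n) (x - x0) ord0 j ^+ 2.
  by rewrite big_distrr/=; apply: eq_bigr => j _; ring.
rewrite /hf PfE (_ : \sum_i (0 : 'rV[R]_n) ord0 i * (x - x0) ord0 i = 0); last first.
  by rewrite big1// => i _; rewrite mxE mul0r.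
have -> : \sum_i (x - x0) ord0 i ^+ 2 = qf x - delta ^+ 2 by rewrite qfE addrK.
by field; rewrite gt_eqF// qf_gt0.
Qed.

End geometry.

(** * Binomial expansions *)

Section binomial_series.
Context {R : realType}.
Implicit Types (s t : R) (l : nat).

(** The generalized binomial coefficient of -s over l, that is, the coefficient of t^l in (1 +
    t)^(-s). *)
Definition bcoef s l : R := \prod_(i < l) (- (s + i%:R) / i.+1%:R).

Lemma bcoef0 s : bcoef s 0 = 1.
Proof. by rewrite /bcoef big_ord0. Qed.

Lemma bcoefS s l : bcoef s l.+1 = - (s + l%:R) / l.+1%:R * bcoef s l.
Proof. by rewrite /bcoef big_ord_recr/= mulrC. Qed.

(** The coefficient form of the rule that (1 + t)^(-s) has derivative -s (1 + t)^(-(s+1)). *)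
Lemma bcoefS_shift s l : l.+1%:R * bcoef s l.+1 = - s * bcoef (s + 1) l.
Proof.
elim: l => [|l IH]; first by rewrite bcoefS !bcoef0 addr0; field.
have IH' : bcoef s l.+1 = - s * bcoef (s + 1) l / l.+1%:R.
  by rewrite -IH mulrAC divff ?mul1r ?pnatr_eq0.
rewrite bcoefS IH' bcoefS (_ : s + l.+1%:R = s + 1 + l%:R); last first.
  by rewrite -natr1; ring.
have u0 : l.+1%:R != 0 :> R by rewrite pnatr_eq0.
have v0 : l.+2%:R != 0 :> R by rewrite pnatr_eq0.
move: l.+1%:R l.+2%:R u0 v0 (bcoef _ _) => u v u0 v0 w.
by field; rewrite u0 v0.
Qed.

Lemma is_derive_powR1D s t : -1 < t ->
  is_derive t 1 (fun t : R => (1 + t) `^ (- s)) (- s * (1 + t) `^ (- (s + 1))).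
Proof.
move=> t1; have p : 0 < 1 + t by lra.
have D1 : is_derive t 1 (fun t : R => 1 + t) 1.
  by apply: (is_derive_eq (is_deriveD (is_derive_cst (1 : R) t 1) (is_derive_id t 1))); rewrite add0r.
apply: (is_derive_eq (is_derive1_comp (f := fun u => u `^ (- s)) (g := fun t : R => 1 + t)
   (is_derive1_powR (- s) p) D1)).
by rewrite mulr1 opprD.
Qed.

Lemma is_derive_bsum s l t :
  is_derive t 1 (fun t : R => \sum_(j < l.+1) bcoef s j * t ^+ j)
    (- s * \sum_(j < l) bcoef (s + 1) j * t ^+ j).
Proof.
elim: l => [|l IH].
  rewrite big_ord0 mulr0; under eq_fun do rewrite big_ord1 expr0.
  exact: is_derive_cst.
under eq_fun do rewrite big_ord_recr/=.
have D1 : is_derive t 1 (fun t : R => t ^+ l.+1) (l.+1%:R * t ^+ l).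
  have -> : (fun t : R => t ^+ l.+1) = (@idfun R) ^+ l.+1.
    by apply/funext => u; rewrite exprfctE.
  apply: (is_derive_eq (is_deriveX l.+1 (is_derive_id t 1))).
  exact: mulr1.
apply: (is_derive_eq (is_deriveD IH (is_deriveM (is_derive_cst (bcoef s l.+1) t 1) D1))).
rewrite scaler0 addr0 big_ord_recr/= mulrDr; congr (_ + _).
by rewrite /GRing.scale/= mulrA [_ * l.+1%:R]mulrC bcoefS_shift mulrA.
Qed.

(** Induction on the order for all s at once: the remainder of order l + 1 for s has as derivative
    -s times the remainder of order l for s + 1 and vanishes at 0, so the mean value theorem gains
    one factor |t|. The case l = 0 is a plain bound. *)
Lemma taylor_powR1D l : forall s, exists2 C : R, 0 <= C & forall t, `|t| <= 2^-1 ->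
  `|(1 + t) `^ (- s) - \sum_(j < l) bcoef s j * t ^+ j| <= C * `|t| ^+ l.
Proof.
elim: l => [|l IH] s.
  (* The power is monotone on [1/2, 3/2], so it is bounded by its value at one of the endpoints; the
     sum covers both signs of s. *)
  exists (2^-1 `^ (- s) + (3 / 2) `^ (- s)); first by rewrite addr_ge0 ?powR_ge0.
  move=> t; rewrite ler_norml => /andP[t1 t2].
  rewrite big_ord0 subr0 expr0 mulr1 ger0_norm ?powR_ge0//.
  have [s0|s0] := leP 0 s.
    apply: (@le_trans _ _ (2^-1 `^ (- s))); last by rewrite lerDl powR_ge0.
    rewrite !powRN lef_pV2 ?posrE ?powR_gt0//; last by lra.
    by apply: ge0_ler_powR => //; rewrite ?nnegrE; lra.
  apply: (@le_trans _ _ ((3 / 2) `^ (- s))); last by rewrite lerDr powR_ge0.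
  by apply: ge0_ler_powR => //; rewrite ?nnegrE; lra.
have [C C0 HC] := IH (s + 1).
exists (`|s| * C); first by rewrite mulr_ge0.
move=> t t2.
pose D (t : R) := (1 + t) `^ (- s) - \sum_(j < l.+1) bcoef s j * t ^+ j.
pose D' (t : R) : R := - s * ((1 + t) `^ (- (s + 1)) - \sum_(j < l) bcoef (s + 1) j * t ^+ j).
have HD (u : R) : `|u| <= 2^-1 -> is_derive u 1 D (D' u).
  rewrite ler_norml => /andP[u1 u2].
  have h : -1 < u by lra.
  by apply: (is_derive_eq (is_deriveB (is_derive_powR1D s h) (is_derive_bsum s l u))); rewrite /D' mulrBr.
have D0 : D 0 = 0.
  rewrite /D addr0 powR1 big_ord_recl/= bcoef0 expr0 mulr1 big1 ?addr0 ?subrr// => i _.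
  by rewrite exprS mul0r mulr0.
have D'le (u : R) : `|u| <= `|t| -> `|D' u| <= `|s| * C * `|t| ^+ l.
  move=> ut; rewrite /D' normrM normrN -mulrA ler_wpM2l//.
  apply: le_trans (HC u (le_trans ut t2)) _.
  by rewrite ler_wpM2l// lerXn2r// nnegrE.
have cD (a b : R) : `|a| <= 2^-1 -> `|b| <= 2^-1 -> {within `[a, b], continuous D}.
  move=> ha hb; apply: derivable_within_continuous => u; rewrite in_itv/= => /andP[au ub].
  apply: ex_derive; apply: HD.
  by move: ha hb; rewrite !ler_norml => /andP[? ?] /andP[? ?]; apply/andP; split; lra.
rewrite -/(D t) exprSr mulrA.
have [t0|t0|t0] := ltgtP t 0.
- have [||c cI E] := @MVT _ D D' t 0 t0.
  + move=> u; rewrite in_itv/= => /andP[u1 u2]; apply: HD.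
    by move: t2; rewrite !ler_norml => /andP[? ?]; apply/andP; split; lra.
  + by apply: cD => //; rewrite normr0 invr_ge0.
  move: E; rewrite D0 sub0r sub0r => /eqP; rewrite eqr_oppLR => /eqP ->.
  rewrite normrN normrM [`|- t|]normrN ler_wpM2r//; apply: D'le.
  by move: cI; rewrite in_itv/= => /andP[? ?]; rewrite !ltr0_norm//; lra.
- have [||c cI E] := @MVT _ D D' 0 t t0.
  + move=> u; rewrite in_itv/= => /andP[u1 u2]; apply: HD.
    by move: t2; rewrite !ler_norml => /andP[? ?]; apply/andP; split; lra.
  + by apply: cD => //; rewrite normr0 invr_ge0.
  move: E; rewrite D0 !subr0 => ->.
  rewrite normrM ler_wpM2r//; apply: D'le.
  by move: cI; rewrite in_itv/= => /andP[? ?]; rewrite !gtr0_norm//; lra.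
- by rewrite t0 D0 normr0 mulr0.
Qed.

End binomial_series.

Section integral_expansion.
Context d (T : measurableType d) {R : realType} (mu : {measure set T -> \bar R}).
Implicit Types (F h g : T -> R).

Lemma integrableZ_EFin (a : R) F : mu.-integrable setT (EFin \o F) ->
  mu.-integrable setT (EFin \o (fun x => a * F x)).
Proof.
move=> iF; rewrite (_ : EFin \o _ = (fun x => a%:E * (EFin \o F) x)%E).
  exact: integrableZl.
by apply/funext => x; rewrite /= EFinM.
Qed.

Lemma integrable_bounded_mul F g (M : R) :
  mu.-integrable setT (EFin \o F) -> measurable_fun setT g ->
  (forall x, `|g x| <= M) -> mu.-integrable setT (EFin \o (fun x => F x * g x)).
Proof.
move=> iF mg gM; apply: (@le_integrable _ _ _ _ _ measurableT _ (fun x => (M * F x)%:E)).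
- apply/measurable_EFinP; apply: measurable_funM => //.
  exact/measurable_EFinP/(measurable_int mu).
- move=> x _; rewrite /= lee_fin !normrM mulrC ler_wpM2r//.
  by apply: le_trans (gM x) _; exact: ler_norm.
- exact: integrableZ_EFin.
Qed.

Lemma Rintegral_bsum F h l (a : nat -> R) :
  mu.-integrable setT (EFin \o F) -> measurable_fun setT h ->
  (forall x, `|h x| <= 1) ->
  mu.-integrable setT (EFin \o (fun x => F x * \sum_(j < l) a j * h x ^+ j)) /\
  \int[mu]_x (F x * \sum_(j < l) a j * h x ^+ j) =
  \sum_(j < l) a j * \int[mu]_x (F x * h x ^+ j).
Proof.
move=> iF mh h1.
have ij j : mu.-integrable setT (EFin \o (fun x => F x * h x ^+ j)).
  apply: (integrable_bounded_mul (M := 1)) => //; first exact: measurable_funX.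
  by move=> x; rewrite normrX exprn_ile1.
elim: l => [|l [IH1 IH2]].
  split; last first.
    by rewrite big_ord0; under eq_Rintegral do rewrite big_ord0 mulr0; rewrite Rintegral_cst ?mul0r.
  under [X in integrable _ _ (_ \o X)]eq_fun do rewrite big_ord0 mulr0.
  exact: integrable0.
have E : (fun x => F x * \sum_(j < l.+1) a j * h x ^+ j) =
  (fun x => F x * (\sum_(j < l) a j * h x ^+ j) + a l * (F x * h x ^+ l)).
  by apply/funext => x; rewrite big_ord_recr/= mulrDr; congr (_ + _); rewrite mulrCA.
have il : mu.-integrable setT (EFin \o (fun x => a l * (F x * h x ^+ l))).
  exact: integrableZ_EFin.
rewrite E; split.
  exact: (integrableD measurableT IH1 il).
by rewrite RintegralD// IH2 big_ord_recr/= RintegralZl.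
Qed.

(** The Taylor remainder is uniform in x because |h| <= 1, so it can be integrated against F.
    Moments of F against powers of h become coefficients in e, to be compared by
    [leading_coef_eq0]. *)
Lemma integral_powR_expansion F h (s : R) l :
  mu.-integrable setT (EFin \o F) -> measurable_fun setT h ->
  (forall x, `|h x| <= 1) ->
  exists2 C : R, 0 <= C & forall e : R, 0 <= e <= 2^-1 ->
  `|\int[mu]_x (F x * (1 + e * h x) `^ (- s)) -
    \sum_(j < l) bcoef s j * e ^+ j * \int[mu]_x (F x * h x ^+ j)| <= C * e ^+ l.
Proof.
move=> iF mh h1; have [C C0 HC] := taylor_powR1D l s.
exists (C * \int[mu]_x `|F x|).
  by rewrite mulr_ge0// Rintegral_ge0.
move=> e /andP[e0 e1].
have eh x : `|e * h x| <= 2^-1.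
  by rewrite normrM ger0_norm// (le_trans _ e1)// ler_piMr.
have [i1 E1] := Rintegral_bsum l (fun j => bcoef s j * e ^+ j) iF mh h1.
rewrite -E1.
have mz : measurable_fun setT (fun x => (1 + e * h x) `^ (- s)).
  apply: (measurableT_comp (@measurable_powR R (- s))).
  by apply: measurable_funD => //; exact: measurable_funM.
have [C1 C10 HC1] := taylor_powR1D 0 s.
have i2 : mu.-integrable setT (EFin \o (fun x => F x * (1 + e * h x) `^ (- s))).
  apply: (integrable_bounded_mul (M := C1)) => // x.
  by have := HC1 _ (eh x); rewrite big_ord0 subr0 expr0 mulr1.
rewrite -RintegralB//.
apply: le_trans (le_normr_Rintegral measurableT (integrableB measurableT i2 i1)) _.
rewrite -[C * _ * _]mulrA [_ * e ^+ l]mulrC mulrA -RintegralZl//; last exact: integrable_norm.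
apply: le_Rintegral => //.
- exact: (integrable_norm (integrableB measurableT i2 i1)).
- exact: (integrableZ_EFin _ (integrable_norm iF)).
move=> x _; rewrite -mulrBr normrM mulrC ler_wpM2r//.
under eq_bigr do rewrite -mulrA -exprMn.
apply: le_trans (HC _ (eh x)) _; rewrite ler_wpM2l// normrM ger0_norm//.
by rewrite lerXn2r ?nnegrE ?mulr_ge0// ler_piMr.
Qed.

End integral_expansion.

(** * Completeness of exponentials *)

Section density.
Context d (T : measurableType d) {R : realType} (mu : {measure set T -> \bar R}).
Context {J : Type}.
Variables (F : T -> R) (h : J -> T -> R).
Hypothesis iF : mu.-integrable setT (EFin \o F).
Hypothesis mh : forall i, measurable_fun setT (h i).
Hypothesis bh : forall i, exists M : R, forall x, `|h i x| <= M.
Hypothesis h0 : exists i, forall x, h i x = 0.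
Hypothesis hD : forall i j, exists k, forall x, h k x = h i x + h j x.
Hypothesis Fh : forall i, \int[mu]_x (F x * expR (h i x)) = 0.

Let bm (g : T -> R) := measurable_fun setT g /\ exists M : R, forall x, `|g x| <= M.

(* The functions orthogonal to the exponentials, and the multipliers of these:
   the latter form an algebra closed under bounded pointwise limits. *)
Let orth (g : T -> R) := bm g /\ forall i, \int[mu]_x (F x * (g x * expR (h i x))) = 0.
Let mult (g : T -> R) := bm g /\ forall f, orth f -> orth (fun x => g x * f x).

Let bmM g f : bm g -> bm f -> bm (fun x => g x * f x).
Proof.
move=> [mg [M gM]] [mf [N fN]]; split; first exact: measurable_funM.
by exists (M * N) => x; rewrite normrM ler_pM.
Qed.

Let bm_exp i : bm (fun x => expR (h i x)).
Proof.
split; first exact: (measurableT_comp (@measurable_expR R)).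
have [M hM] := bh i; exists (expR M) => x.
by rewrite ger0_norm ?expR_ge0// ler_expR (le_trans (ler_norm _)).
Qed.

Let integrable_bm g : bm g -> mu.-integrable setT (EFin \o (fun x => F x * g x)).
Proof. by move=> [mg [M gM]]; exact: integrable_bounded_mul gM. Qed.

Let orth1 : orth (fun=> 1).
Proof.
split; first by split=> //; exists 1 => x; rewrite normr1.
by move=> i; under eq_Rintegral do rewrite mul1r; exact: Fh.
Qed.

Let mult_orth g : mult g -> orth g.
Proof.
move=> [_ /(_ _ orth1)]; by under eq_fun do rewrite mulr1.
Qed.

Let multM g f : mult g -> mult f -> mult (fun x => g x * f x).
Proof.
move=> [bg Hg] [bf Hf]; split; first exact: bmM.
move=> k ok; under eq_fun do rewrite -mulrA; apply: Hg; exact: Hf.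
Qed.

Let bm_lin (a : R) g f : bm g -> bm f -> bm (fun x => g x + a * f x).
Proof.
move=> [mg [M gM]] [mf [N fN]]; split.
  by apply: measurable_funD => //; exact: measurable_funM.
exists (M + `|a| * N) => x; apply: le_trans (ler_normD _ _) _.
by rewrite lerD// normrM ler_wpM2l.
Qed.

Let orth_lin (a : R) g f : orth g -> orth f -> orth (fun x => g x + a * f x).
Proof.
move=> [bg Og] [bf Of]; split; first exact: bm_lin.
move=> i.
have E x : F x * ((g x + a * f x) * expR (h i x)) =
   F x * (g x * expR (h i x)) + a * (F x * (f x * expR (h i x))) by ring.
under eq_Rintegral do rewrite E.
have ig := integrable_bm (bmM bg (bm_exp i)).
have jf := integrable_bm (bmM bf (bm_exp i)).
have ijf : mu.-integrable setT (EFin \o (fun x => a * (F x * (f x * expR (h i x))))).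
  exact: integrableZ_EFin.
by rewrite RintegralD// RintegralZl// Og Of mulr0 addr0.
Qed.

Let mult_lin (a : R) g f : mult g -> mult f -> mult (fun x => g x + a * f x).
Proof.
move=> [bg Hg] [bf Hf]; split; first exact: bm_lin.
move=> k ok; have E x : (g x + a * f x) * k x = g x * k x + a * (f x * k x) by ring.
under eq_fun do rewrite E; apply: orth_lin; [exact: Hg|exact: Hf].
Qed.

Let mult_cst (c : R) : mult (fun=> c).
Proof.
split; first by split=> //; exists `|c|.
move=> f of_; have := orth_lin c (orth_lin (-1) of_ of_) of_.
under eq_fun do rewrite mulN1r subrr add0r; exact.
Qed.

Let mult_exp i : mult (fun x => expR (h i x)).
Proof.
split=> // f [bf Of]; split; first exact: bmM.
move=> j; have [k hk] := hD i j; rewrite -[RHS](Of k).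
by apply: eq_Rintegral => x _; rewrite hk expRD; ring.
Qed.

Let mult_lim (g_ : nat -> T -> R) (g : T -> R) (M : R) :
  (forall n, mult (g_ n)) -> (forall n x, `|g_ n x| <= M) ->
  (forall x, g_ ^~ x @ \oo --> g x) -> mult g.
Proof.
move=> Hg gM gg.
have mg : measurable_fun setT g.
  apply: (measurable_fun_cvg (h := g_)) => // n; by case: (Hg n) => -[].
have gb x : `|g x| <= M.
  apply: (@closed_cvg _ _ \oo _ (fun t => `|g_ t x|) [set y | y <= M]).
  - exact: closed_le.
  - by apply: nearW => n /=; exact: gM.
  - by apply: cvg_norm; exact: gg.
have bg : bm g by split=> //; exists M.
split=> // f of_; have bf := of_.1.
split; first exact: bmM.
move=> i.
pose G n x := (F x * (g_ n x * f x * expR (h i x)))%:E.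
have bGn n : bm (fun x => g_ n x * f x * expR (h i x)).
  by apply: bmM => //; apply: bmM => //; case: (Hg n).
have bG : bm (fun x => g x * f x * expR (h i x)) by apply: bmM => //; apply: bmM.
have iGn n := integrable_bm (bGn n).
have iG := integrable_bm bG.
have bfe := bmM bf (bm_exp i).
have C1 : {ae mu, forall x, setT x -> G n x @[n --> \oo] -->
    (F x * (g x * f x * expR (h i x)))%:E}.
  apply: aeW => x _; apply/cvg_EFin; first exact: nearW.
  apply: cvgM; first exact: cvg_cst.
  apply: cvgM; last exact: cvg_cst.
  by apply: cvgM; [exact: gg|exact: cvg_cst].
have C2 : {ae mu, forall x n, setT x ->
    (`|G n x| <= (`|M| * `|F x * (f x * expR (h i x))|)%:E)%E}.
  apply: aeW => x n _; rewrite /G /= lee_fin.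
  rewrite (_ : F x * _ = g_ n x * (F x * (f x * expR (h i x)))); last by ring.
  by rewrite normrM ler_wpM2r// (le_trans (gM n x))// ler_norm.
have [_ _ L] := dominated_convergence measurableT
   (fun n => measurable_int mu (iGn n)) (measurable_int mu iG) C1
   (integrableZ_EFin _ (integrable_norm (integrable_bm bfe))) C2.
have L0 : [sequence (\int[mu]_x G n x)%E]_n = fun=> 0%E.
  apply/funext => n /=; have [_ On] := (Hg n).2 _ of_.
  have := On i; rewrite /Rintegral => E0.
  rewrite -[LHS]fineK; last exact: (integrable_fin_num measurableT (iGn n)).
  by rewrite /G E0.
rewrite /Rintegral (_ : (\int[mu]_x _)%E = 0%E)//.
by rewrite L0 in L; rewrite -(cvg_lim (@ereal_hausdorff _) L) lim_cst.
Qed.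

Let mult_expn g n : mult g -> mult (fun x => g x ^+ n).
Proof.
move=> mg; elim: n => [|n IH]; first by under eq_fun do rewrite expr0; exact: mult_cst.
by under eq_fun do rewrite exprS; exact: multM.
Qed.

Let mult_scale (a : R) g : mult g -> mult (fun x => a * g x).
Proof.
by move=> mg; have := mult_lin a (mult_cst 0) mg; under eq_fun do rewrite add0r.
Qed.

Let mult_expR g : mult g -> mult (fun x => expR (g x)).
Proof.
move=> mg; have [[mg' [M gM]] _] := mg.
apply: (@mult_lim (fun n x => series (exp_coeff (g x)) n) _ (expR M)).
- move=> n; rewrite /series/=; elim: n => [|n IH].
    by under eq_fun do rewrite big_geq//; exact: mult_cst.
  under eq_fun do rewrite big_nat_recr//=.
  have -> : (fun x => \sum_(0 <= k < n) exp_coeff (g x) k + exp_coeff (g x) n) =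
      (fun x => \sum_(0 <= k < n) exp_coeff (g x) k + n`!%:R^-1 * (g x ^+ n)).
    by apply/funext => x; rewrite exp_coeffE.
  by apply: mult_lin => //; exact: mult_expn.
- move=> n x; rewrite /series/=.
  have M0 : 0 <= M by apply: le_trans (gM x).
  apply: (@le_trans _ _ (series (exp_coeff M) n)).
    apply: le_trans (ler_norm_sum _ _ _) _; apply: ler_sum => k _.
    rewrite !exp_coeffE normrM ger0_norm ?invr_ge0// ler_wpM2l ?invr_ge0//.
    by rewrite normrX lerXn2r ?nnegrE.
  apply: nondecreasing_cvgn_le; last exact: is_cvg_series_exp_coeff.
  apply/nondecreasing_seqP => k; rewrite /series/= big_nat_recr//= lerDl.
  exact: exp_coeff_ge0.
- by move=> x; exact: is_cvg_series_exp_coeff.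
Qed.

Let half (i : J) (c : R) : set T := [set x | h i x < c].

(** Put m = n + 1: the function exp(-m exp(m t)) tends to the indicator of t < 0 everywhere. The
    outer factor m makes the limit 0 at t = 0 too, where exp(-exp(m t)) would stay at 1/e; there the
    division [2 / 0] is 0 and the bound reads 1/m. For t < 0 it comes from exp(y) >= y^2/2 with y =
    -m t. *)
Let indic_half_bound (t : R) (n : nat) :
  `|expR (- (n.+1%:R * expR (n.+1%:R * t))) - (t < 0)%R%:R| <=
  (1 + 2 / t ^+ 2) / n.+1%:R.
Proof.
set N : R := n.+1%:R.
have N0 : 0 < N by rewrite ltr0n.
have N1 : 1 <= N by rewrite ler1n.
case: (leP 0 t) => t0; last first.
  set y := N * expR (N * t).
  have y0 : 0 <= y by rewrite mulr_ge0 ?expR_ge0// ltW.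
  rewrite distrC ger0_norm; last by rewrite subr_ge0 -[leRHS](expR0 R) ler_expR oppr_le0.
  apply: (@le_trans _ _ y).
    by have := expR_ge1Dx (- y); rewrite mulr1n; lra.
  rewrite ler_pdivlMr//.
  apply: (@le_trans _ _ (2 / t ^+ 2)); last by rewrite lerDr.
  have tt : 0 < t ^+ 2 by rewrite exprn_even_gt0//= lt_eqF.
  rewrite ler_pdivlMr// /y.
  have Nt : 0 <= - (N * t) by rewrite -mulrN mulr_ge0// ?oppr_ge0 ltW.
  have := expR_ge1Dxn 1 Nt; rewrite expRN => h1.
  have e0 : 0 < expR (N * t) by exact: expR_gt0.
  have h2 : (N * t) ^+ 2 / 2 <= (expR (N * t))^-1.
    by apply: le_trans h1; rewrite sqrrN lerDr.
  rewrite -(ler_pM2r e0) mulVf ?gt_eqF// in h2.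
  by rewrite (_ : _ * t ^+ 2 = 2 * ((N * t) ^+ 2 / 2 * expR (N * t))) ?ler_piMr//; field.
rewrite mulr0n subr0 ger0_norm ?expR_ge0//.
have e1 : 1 <= expR (N * t) by rewrite -[leLHS](expR0 R) ler_expR mulr_ge0// ltW.
apply: (@le_trans _ _ (N^-1)); last first.
  by rewrite ler_peMl ?invr_ge0 ?(ltW N0)// lerDl mulr_ge0// invr_ge0 sqr_ge0.
rewrite expRN lef_pV2 ?posrE ?expR_gt0//.
apply: (@le_trans _ _ (N * expR (N * t))); first by rewrite ler_peMr// ltW.
by apply: le_trans (expR_ge1Dx _); rewrite lerDr.
Qed.

Let cvg_bound (u : nat -> R) (l C : R) :
  (forall n, `|u n - l| <= C / n.+1%:R) -> u @ \oo --> l.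
Proof.
move=> H; have C0 : 0 <= C.
  by have := le_trans (normr_ge0 _) (H 0); rewrite divr1.
apply/cvgrPdist_le => e e0; near=> n.
rewrite distrC; apply: le_trans (H n) _.
rewrite ler_pdivrMr ?ltr0n// mulrC -ler_pdivrMr//.
apply: (le_trans (ltW (truncnS_gt _))); rewrite ler_nat ltnS.
by near: n; exact: nbhs_infty_ge.
Unshelve. all: by end_near. Qed.

(** The double exponential uses the function only through [expR (h i x)], whose powers are
    multipliers; [h i] itself is not known to be one. *)
Let indic_half i c : mult (\1_(half i c)).
Proof.
apply: (@mult_lim (fun n x => expR (- (n.+1%:R * expR (n.+1%:R * (h i x - c))))) _ 1).
- move=> n; apply: mult_expR.
  have -> : (fun x => - (n.+1%:R * expR (n.+1%:R * (h i x - c)))) =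
    (fun x => (- n.+1%:R * expR (- (n.+1%:R * c))) * expR (h i x) ^+ n.+1).
    apply/funext => x; rewrite -expRM_natl -[in RHS]mulrA -expRD mulNr.
    by congr (- (_ * expR _)); ring.
  by apply: mult_scale; apply: mult_expn.
- move=> n x; rewrite ger0_norm ?expR_ge0// -[leRHS](expR0 R) ler_expR oppr_le0 mulr_ge0// expR_ge0.
- move=> x; apply: (@cvg_bound _ _ (1 + 2 / (h i x - c) ^+ 2)) => n.
  apply: le_trans (indic_half_bound _ _); rewrite indicE subr_lt0.
  by rewrite (_ : (x \in half i c) = (h i x < c))//; apply/idP/idP; rewrite inE.
Qed.

Let msets : set (set T) := [set A | mult (\1_A)].

Let msetsC A : msets A -> msets (~` A).
Proof.
move=> mA; rewrite /msets/=.
have -> : \1_(~` A) = (fun x => 1 + (-1) * \1_A x) :> (T -> R).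
  apply/funext => x; rewrite !indicE in_setC mulN1r; case: (x \in A) => /=;
    by rewrite ?mulr1n ?mulr0n ?subrr ?subr0.
by apply: mult_lin.
Qed.

(** Since multipliers are stable under products, finite intersections come for free: a countable
    union is the complement of a bounded limit of finite products of indicators. *)
Let sigma_algebra_msets : sigma_algebra setT msets.
Proof.
split.
- rewrite /msets/= (_ : \1_set0 = fun=> 0); first exact: mult_cst.
  by apply/funext => x; rewrite indic0.
- by move=> A; rewrite setTD; exact: msetsC.
- move=> A mA; rewrite -[\bigcup_k A k]setCK; apply: msetsC.
  rewrite setC_bigcup /msets/=.
  apply: (@mult_lim (fun n x => \prod_(i < n) \1_(~` A i) x) _ 1).
  + elim=> [|n IH]; first by under eq_fun do rewrite big_ord0; exact: mult_cst.
    by under eq_fun do rewrite big_ord_recr/=; apply: multM => //; exact: msetsC.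
  + move=> n x; rewrite normr_prod; apply: prodr_ile1 => i _.
    by rewrite normr_ge0/= ger0_norm// indicE lern1 leq_b1.
  + move=> x.
    have [[k _ Akx]|nA] := pselect ((\bigcup_k A k) x).
      rewrite indicE memNset; last by move=> /(_ k I); exact.
      apply: cvg_near_cst; near=> n.
      have kn : (k < n)%N by near: n; exact: nbhs_infty_gt.
      by rewrite (bigD1 (Ordinal kn))//= indicE memNset ?mul0r//; apply.
    rewrite indicE mem_set; last by move=> k _ Akx; apply: nA; exists k.
    apply: cvg_near_cst; near=> n.
    rewrite big1// => i _; rewrite indicE mem_set// => Aix.
    by apply: nA; exists i.
Unshelve. all: by end_near. Qed.

(** Once every measurable indicator is a multiplier, so is the sign of F, the difference of the
    indicators of F > 0 and F < 0; testing it with the function h that vanishes identically gives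
    that |F| has integral 0. *)
Lemma orthogonal_exponentials_eq0 :
  measurable `<=` <<s [set A : set T | exists i c, A = [set x | h i x < c]] >> ->
  {ae mu, forall x, F x = 0}.
Proof.
move=> gen.
have mF : measurable_fun setT F by exact/measurable_EFinP/(measurable_int mu).
have all_mult A : measurable A -> mult (\1_A).
  move=> /gen; apply: (@smallest_sub _ _ _ msets sigma_algebra_msets).
  by move=> _ [i [c ->]]; exact: indic_half.
have mlt (f g : T -> R) : measurable_fun setT f -> measurable_fun setT g ->
    measurable [set x | f x < g x].
  move=> mf mg; rewrite -[X in measurable X]setTI.
  exact: (measurable_fun_ltr mf mg measurableT).
have mP := all_mult _ (mlt (cst 0) F (measurable_cst _) mF).
have mN := all_mult _ (mlt F (cst 0) mF (measurable_cst _)).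
have [_ Og] := mult_orth (mult_lin (-1) mP mN).
have [i0 hi0] := h0.
have := Og i0.
have E x : F x * ((\1_[set x | cst 0 x < F x] x + -1 * \1_[set x | F x < cst 0 x] x) *
    expR (h i0 x)) = `|F x|.
  rewrite hi0 expR0 mulr1 !indicE.
  have inlt (a b : R) (P : set T) : (P x <-> a < b) -> (x \in P) = (a < b).
    by move=> H; apply/idP/idP; rewrite inE => /H.
  rewrite (inlt 0 (F x))// (inlt (F x) 0)//.
  by case: (ltgtP (F x) 0) => F0 /=; rewrite ?mulr1n ?mulr0n;
    [rewrite ltr0_norm//|rewrite gtr0_norm//|rewrite F0 normr0]; ring.
under eq_Rintegral do rewrite E.
move=> F0.
have : ae_eq mu setT (EFin \o F) (cst 0%E).
  apply/(ae_eq_integral_abs mu measurableT (measurable_int mu iF)).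
  rewrite -[LHS]fineK; last first.
    by have := integrable_fin_num measurableT (integrable_norm iF).
  by have -> : fine (\int[mu]_x `|(EFin \o F) x|)%E = 0.
by apply: filterS => x /(_ I) [].
Qed.

End density.

(** * Riesz potentials of powers of quadratic polynomials *)

Section decay_qf.
Context {R : realType} {n : nat}.
Variables (x0 : 'rV[R]_n) (delta : R).
Hypothesis delta0 : 0 < delta.
Implicit Types (x y B : 'rV[R]_n) (m : R).
Local Notation leb := (@lebesgue_rV R n).
Local Notation qf := (qf x0 delta).

Lemma measurable_qf_powR m : measurable_fun setT (fun x => qf x `^ m).
Proof. exact: (measurableT_comp (@measurable_powR R m) (measurable_qf x0 delta)). Qed.

Lemma integrable_qf m : n%:R / 2 < m ->
  leb.-integrable setT (EFin \o (fun x => qf x `^ (- m))).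
Proof.
move=> nm; apply/integrableP; split.
  apply/measurable_EFinP; exact: measurable_qf_powR.
rewrite -(ge0_integral_rV_affine x0 delta0)//; last first.
  apply: measurableT_comp => //; apply/measurable_EFinP; exact: measurable_qf_powR.
have E (x : 'rV[R]_n) : (`|(EFin \o (fun x => (qf x `^ (- m))%R)) (delta *: x + x0)%R| =
   ((delta ^+ 2) `^ (- m))%:E * ((1 + \sum_(i < n) x ord0 i ^+ 2) `^ (- m))%:E)%E.
  rewrite /= ger0_norm ?powR_ge0// -EFinM -powRM ?sqr_ge0//; last first.
    by rewrite addr_ge0// sumr_ge0// => i _; exact: sqr_ge0.
  congr ((_ `^ _)%:E); rewrite qfE mulrDr mulr1 addrC; congr (_ + _).
  by rewrite big_distrr/=; apply: eq_bigr => i _; rewrite !mxE addrK exprMn.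
under eq_integral do rewrite E.
have /integrableP[mi li] := integrable_decay nm.
rewrite ge0_integralZl ?lee_fin ?powR_ge0//.
rewrite muleA -EFinM lte_mul_pinfty//.
  by rewrite lee_fin mulr_ge0 ?exprn_ge0 ?powR_ge0// ltW.
move: li; congr (_ < _)%E; apply: eq_integral => x _.
by rewrite gee0_abs// lee_fin powR_ge0.
by move=> x _; rewrite lee_fin powR_ge0.
Qed.

Lemma integrable_le_qf (f : 'rV[R]_n -> R) (C m : R) : n%:R / 2 < m ->
  measurable_fun setT f -> (forall x, `|f x| <= C * qf x `^ (- m)) ->
  leb.-integrable setT (EFin \o f).
Proof.
move=> nm mf fC.
apply: (@le_integrable _ _ _ _ _ measurableT _ (EFin \o (fun x => C * qf x `^ (- m)))).
- exact/measurable_EFinP.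
- by move=> x _; rewrite /= lee_fin (le_trans (fC x))// ler_norm.
- exact/integrableZ_EFin/integrable_qf.
Qed.

(** From |a|^2 <= 2 |a + t|^2 + 2 t^2, the constants being absorbed by q >= delta^2. It provides one
    majorant for all difference quotients with step at most 1. *)
Lemma qf_shift j x (t : R) : `|t| <= 1 ->
  qf x <= (2 + 2 / delta ^+ 2) * qf (x + t *: delta_mx ord0 j).
Proof.
move=> t1; set y := x + _.
have d2 : 0 < delta ^+ 2 by rewrite exprn_gt0.
have yd : 1 <= qf y / delta ^+ 2 by rewrite ler_pdivlMr// mul1r qf_ge.
have tt : t ^+ 2 <= 1 by rewrite -real_normK ?num_real// exprn_ile1.
suff H : qf x <= 2 * qf y + 2.
  apply: (le_trans H); rewrite [leRHS]mulrDl lerD2l -mulrA [_^-1 * _]mulrC; lra.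
rewrite !qfE.
have H : \sum_i (x - x0) ord0 i ^+ 2 <=
    2 * \sum_i (y - x0) ord0 i ^+ 2 + 2 * t ^+ 2.
  rewrite (bigD1 j)//= [in leRHS](bigD1 j)//= /y coord_line eqxx mulr1.
  under [in leRHS]eq_bigr => i ij do rewrite coord_line (negPf ij) mulr0 addr0.
  set Y := (x - x0) ord0 j; set Z := \sum_(i | _) _.
  have Z0 : 0 <= Z by rewrite /Z sumr_ge0// => i _; exact: sqr_ge0.
  have := sqr_ge0 (Y + 2 * t); nra.
have := sqr_ge0 delta; lra.
Qed.

(** The substitute for the divergence theorem. Difference quotients integrate to 0 by translation
    invariance; the mean value theorem and [qf_shift] dominate them by a power of q, and they
    converge to the derivative. *)
Lemma integral_partial_eq0 (e : expr) (j : 'I_n) (C m : R) :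
  n%:R / 2 < m -> wf x0 e ->
  (forall x, `|eval x0 e x| <= C * qf x `^ (- m)) ->
  (forall x, `|eval x0 (ediff j e) x| <= C * qf x `^ (- m)) ->
  \int[leb]_x eval x0 (ediff j e) x = 0.
Proof.
move=> nm we eC dC; set f := eval x0 e; set f' := eval x0 (ediff j e).
have m0 : 0 <= m by apply: ltW (le_lt_trans _ nm); rewrite divr_ge0.
have d2 : 0 < delta ^+ 2 by rewrite exprn_gt0.
have mf : measurable_fun setT f by exact: measurable_eval.
have mf' : measurable_fun setT f' by exact: measurable_eval.
have If := integrable_le_qf nm mf eC.
pose K : R := 2 + 2 / delta ^+ 2.
have K0 : 0 < K by rewrite addr_gt0// divr_gt0.
have C0 : 0 <= C.
  have := le_trans (normr_ge0 _) (eC x0); rewrite pmulr_lge0// powR_gt0//.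
  exact: qf_gt0.
pose t (k : nat) : R := k.+1%:R^-1.
have t0 k : 0 < t k by rewrite invr_gt0.
have t1 k : t k <= 1 by rewrite invf_le1// ler1n.
pose D k x := (t k)^-1 * (f (x + t k *: delta_mx ord0 j) - f x).
have mfs k : measurable_fun setT (fun x => f (x + t k *: delta_mx ord0 j)).
  apply: measurableT_comp => //.
  have := measurable_affine_rV 1 (t k *: delta_mx ord0 j : 'rV[R]_n).
  by under eq_fun do rewrite scale1r.
have D0 k : \int[leb]_x D k x = 0.
  have Es : \int[leb]_x f (x + t k *: delta_mx ord0 j) = \int[leb]_x f x.
    rewrite -(integral_rV_affine (t k *: delta_mx ord0 j) ltr01 mf) expr1n mul1r.
    by apply: eq_Rintegral => x _; rewrite scale1r.
  have Is : leb.-integrable setT (EFin \o (fun x => f (x + t k *: delta_mx ord0 j))).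
    apply: (@integrable_le_qf _ (C * K `^ m) m nm) => // x.
    apply: le_trans (eC _) _; rewrite -mulrA ler_wpM2l//.
    rewrite !powRN ler_pdivlMr ?powR_gt0 ?qf_gt0// mulrC ler_pdivrMr ?powR_gt0 ?qf_gt0//.
    rewrite -powRM ?(ltW K0) ?(ltW (qf_gt0 _ _ _))//.
    apply: ge0_ler_powR => //; rewrite ?nnegrE ?(ltW (qf_gt0 _ _ _))//.
      by rewrite mulr_ge0 ?(ltW K0) ?(ltW (qf_gt0 _ _ _)).
    by apply: qf_shift; rewrite ger0_norm// ltW.
  have IB : leb.-integrable setT (EFin \o (fun x => f (x + t k *: delta_mx ord0 j) - f x)).
    exact: (integrableB measurableT Is If).
  by rewrite RintegralZl// RintegralB// Es subrr mulr0.
have Dd k x : `|D k x| <= C * K `^ m * qf x `^ (- m).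
  pose g (u : R) := f (x + u *: delta_mx ord0 j).
  have Dg (u : R) : is_derive u 1 g (f' (x + u *: delta_mx ord0 j)).
    have /is_derive_line := is_derive_eval j (x + u *: delta_mx ord0 j) we.
    move=> H.
    have Hs : is_derive (u - u) 1 (fun v : R => f (x + u *: delta_mx ord0 j + v *: delta_mx ord0 j))
        (f' (x + u *: delta_mx ord0 j)) by rewrite subrr.
    have Ds : is_derive u 1 (fun v : R => v - u) 1.
      apply: (is_derive_eq (is_deriveB (is_derive_id u 1) (is_derive_cst u u 1))).
      by rewrite subr0.
    have := is_derive1_comp (f := fun v : R => f (x + u *: delta_mx ord0 j + v *: delta_mx ord0 j)) (g := fun v : R => v - u) Hs Ds.
    rewrite mulr1; congr (is_derive _ _ _ _); apply/funext => v /=.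
    by rewrite /g -addrA -scalerDl (_ : u + (v - u) = v)//; ring.
  have [|c cI E] := @MVT _ g (fun u => f' (x + u *: delta_mx ord0 j)) 0 (t k) (t0 k).
  - by apply: derivable_within_continuous => u _; apply: ex_derive; exact: Dg.
  have -> : D k x = f' (x + c *: delta_mx ord0 j).
    rewrite /D -/(g (t k)) (_ : f x = g 0); last by rewrite /g scale0r addr0.
    by rewrite E subr0 mulrC mulfK// gt_eqF.
  move: cI; rewrite in_itv/= => /andP[c0 c1].
  apply: le_trans (dC _) _; rewrite -mulrA ler_wpM2l//.
  rewrite !powRN ler_pdivlMr ?powR_gt0 ?qf_gt0// mulrC ler_pdivrMr ?powR_gt0 ?qf_gt0//.
  rewrite -powRM ?(ltW K0) ?(ltW (qf_gt0 _ _ _))//.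
  apply: ge0_ler_powR => //; rewrite ?nnegrE ?(ltW (qf_gt0 _ _ _))//.
    by rewrite mulr_ge0 ?(ltW K0) ?(ltW (qf_gt0 _ _ _)).
  by apply: qf_shift; rewrite gtr0_norm//; exact: le_trans (ltW c1) (t1 k).
have mD k : measurable_fun setT (D k).
  by apply: measurable_funM => //; apply: measurable_funB.
have C1 : {ae leb, forall x, setT x -> (D k x)%:E @[k --> \oo] --> (f' x)%:E}.
  apply: aeW => x _; apply/cvg_EFin; first exact: nearW.
  have [ex de] := is_derive_eval j x we.
  have L : (fun h : R => h^-1 *: ((f \o shift x) (h *: delta_mx ord0 j) - f x)) h
     @[h --> 0^'] --> f' x.
    by rewrite /f' -de; exact: ex.
  have := (cvgr_dnbhsP (fun h : R => h^-1 *: ((f \o shift x) (h *: delta_mx ord0 j) - f x)) 0 (f' x)).1 L t.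
  have H : (forall k, t k != 0) /\ t @ \oo --> (0 : R).
    by split=> [k|]; [rewrite gt_eqF|exact: cvg_harmonic].
  move=> /(_ H); apply: cvg_trans; apply: near_eq_cvg; apply: nearW => k /=.
  by rewrite /D [x + _]addrC.
have C2 : {ae leb, forall x k, setT x -> (`|(D k x)%:E| <= (C * K `^ m * qf x `^ (- m))%:E)%E}.
  by apply: aeW => x k _; rewrite /= lee_fin Dd.
have Ig := integrableZ_EFin (C * K `^ m) (integrable_qf nm).
have [_ _ L] := dominated_convergence measurableT
  (fun k => (measurable_EFinP _ _).2 (mD k)) ((measurable_EFinP _ _).2 mf') C1 Ig C2.
have L0 : [sequence (\int[leb]_x (D k x)%:E)%E]_k = fun=> 0%E.
  apply/funext => k /=; have := D0 k; rewrite /Rintegral => E0.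
  rewrite -[LHS]fineK ?E0//.
  apply: (integrable_fin_num measurableT).
  exact: (integrable_le_qf nm (mD k) (Dd k)).
rewrite /Rintegral (_ : (\int[leb]_x _)%E = 0%E)//.
by rewrite L0 in L; rewrite -(cvg_lim (@ereal_hausdorff _) L) lim_cst.
Qed.

End decay_qf.

Section leading_coefficient.
Context {R : realType}.

Lemma bcoef1 (s : R) : bcoef s 1 = - s.
Proof. by rewrite bcoefS bcoef0 addr0 divr1 mulr1. Qed.

Lemma bcoef2 (s : R) : bcoef s 2 = s * (s + 1) / 2.
Proof. by rewrite bcoefS bcoef1; field. Qed.

(** Comparison of coefficients in finite expansions, so that no power series has to be summed. If X
    were nonzero, e <= |X| / (2 C) would give |X| <= |X| / 2. *)
Lemma leading_coef_eq0 (l : nat) (X C : R) :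
  (forall e : R, 0 < e <= 2^-1 -> `|e ^+ l * X| <= C * e ^+ l.+1) -> X = 0.
Proof.
move=> H.
have H' (e : R) : 0 < e <= 2^-1 -> `|X| <= C * e.
  move=> he; have /andP[e0 _] := he.
  have := H e he; rewrite normrM ger0_norm ?exprn_ge0 ?(ltW e0)//.
  by rewrite exprSr [C * _]mulrCA ler_pM2l ?exprn_gt0.
apply/eqP; rewrite -normr_eq0 eq_le normr_ge0 andbT leNgt; apply/negP => X0.
have C0 : 0 < C.
  have := H' 2^-1; rewrite invr_gt0 ltr0n lexx => /(_ isT) h.
  have := lt_le_trans X0 h; by rewrite pmulr_lgt0// invr_gt0.
pose e : R := Num.min 2^-1 (`|X| / (2 * C)).
have e0 : 0 < e by rewrite lt_min invr_gt0 ltr0n/= divr_gt0// mulr_gt0.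
have := H' e; rewrite e0 ge_min lexx => /(_ isT).
have : e <= `|X| / (2 * C) by rewrite ge_min lexx orbT.
rewrite ler_pdivlMr ?mulr_gt0//; nra.
Qed.

End leading_coefficient.

Section riesz.
Context {R : realType} {n : nat}.
Variables (x0 : 'rV[R]_n) (delta : R).
Hypothesis delta0 : 0 < delta.
Implicit Types (x y B : 'rV[R]_n) (b : R).
Local Notation leb := (@lebesgue_rV R n).
Local Notation qf := (qf x0 delta).
Local Notation hf := (hf x0 delta).
Local Notation zf := (zf x0 delta).
Local Notation Qf := (Qf x0 delta).

Lemma measurable_riesz lam : measurable_fun setT (@riesz_kernel R n lam).
Proof.
apply: (measurableT_comp (@measurable_powR R (- lam))).
have -> : @enorm R n = (fun x => (\sum_(i < n) x ord0 i ^+ 2) `^ (2^-1)).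
  apply/funext => x; rewrite powR12_sqrt// sumr_ge0// => i _; exact: sqr_ge0.
by apply: (measurableT_comp (@measurable_powR R 2^-1)); exact: measurable_sumsq.
Qed.

Lemma measurable_riesz_sub lam x :
  measurable_fun setT (fun y => riesz_kernel lam (x - y)).
Proof.
apply: (measurableT_comp (measurable_riesz lam)).
apply: measurable_rVP => i; under eq_fun do rewrite !mxE.
by apply: measurable_funB => //; exact: measurable_rV_coord.
Qed.

Lemma enormZ (t : R) x : 0 <= t -> enorm (t *: x) = t * enorm x.
Proof.
move=> t0; rewrite /enorm (_ : \sum_i _ = t ^+ 2 * \sum_(i < n) x ord0 i ^+ 2).
  by rewrite sqrtrM ?sqr_ge0// sqrtr_sqr ger0_norm.
by rewrite big_distrr/=; apply: eq_bigr => i _; rewrite mxE exprMn.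
Qed.

Lemma rieszZ (t lam : R) x : 0 <= t ->
  riesz_kernel lam (t *: x) = t `^ (- lam) * riesz_kernel lam x.
Proof. by move=> t0; rewrite /riesz_kernel enormZ// powRM ?sqrtr_ge0. Qed.

Lemma riesz_sym (lam : R) x y : riesz_kernel lam (x - y) = riesz_kernel lam (y - x).
Proof.
rewrite /riesz_kernel /enorm; congr (Num.sqrt _ `^ _); apply: eq_bigr => i _.
by rewrite !mxE -sqrrN opprB.
Qed.

Lemma riesz_ge0 (lam : R) x : 0 <= riesz_kernel lam x.
Proof. exact: powR_ge0. Qed.

(** Completing the square, [Qf B b] is (1 + b) times |x - a|^2 + delta'^2 with a = x0 - delta B / (1
    + b) and delta' = delta [scal B b]. The map x |-> [scal B b] x + [shft B b] sends x0 to a and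
    rescales delta to delta'. *)
Let rho B b : R := 1 - nrm2 B b.
Let scal B b : R := rho B b `^ 2^-1 / (1 + b).
Let shft B b : 'rV[R]_n := x0 - (delta / (1 + b)) *: B - scal B b *: x0.

Lemma nrm1_lt1 B b : nrm1 B b <= 2^-1 -> 0 < 1 + b.
Proof.
move=> u; have h : `|b| <= nrm1 B b by rewrite /nrm1 lerDr sumr_ge0.
have := le_trans h u; rewrite ler_norml => /andP[? _]; lra.
Qed.

Lemma rho_gt0 B b : nrm1 B b <= 2^-1 -> 0 < 1 - nrm2 B b.
Proof. by move=> /nrm2_le; lra. Qed.

Lemma scal_gt0 B b : nrm1 B b <= 2^-1 -> 0 < scal B b.
Proof. by move=> u; rewrite divr_gt0 ?powR_gt0 ?rho_gt0 ?(nrm1_lt1 u). Qed.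

Lemma Qf_affine B b x : nrm1 B b <= 2^-1 ->
  Qf B b (scal B b *: x + shft B b) = (1 + b) * scal B b ^+ 2 * qf x.
Proof.
move=> u; have b0 := nrm1_lt1 u; have r0 := rho_gt0 u.
have s2 : (1 + b) * scal B b ^+ 2 = rho B b / (1 + b).
  rewrite /scal expr_div_n -powR_mulrn ?powR_ge0// -powRrM mulVf// powRr1 ?(ltW r0)//.
  by field; rewrite gt_eqF.
rewrite qfE /Qf /quad.
set t := scal B b in s2 *.
have E i : (t *: x + shft B b - x0) ord0 i = t * (x - x0) ord0 i - delta / (1 + b) * B ord0 i.
  by rewrite !mxE -/t; ring.
have -> : \sum_i (t *: x + shft B b - x0) ord0 i ^+ 2 =
   t ^+ 2 * \sum_i (x - x0) ord0 i ^+ 2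
   - 2 * t * (delta / (1 + b)) * \sum_i (B ord0 i * (x - x0) ord0 i)
   + (delta / (1 + b)) ^+ 2 * \sum_i B ord0 i ^+ 2.
  rewrite !mulr_sumr -sumrB -big_split/=; apply: eq_bigr => i _.
  by rewrite E; ring.
have -> : \sum_i (delta *: B) ord0 i * (t *: x + shft B b - x0) ord0 i =
   delta * t * \sum_i (B ord0 i * (x - x0) ord0 i)
   - delta ^+ 2 / (1 + b) * \sum_i B ord0 i ^+ 2.
  rewrite !mulr_sumr -sumrB; apply: eq_bigr => i _.
  by rewrite E mxE; ring.
have EB : \sum_i B ord0 i ^+ 2 = 1 - rho B b - b ^+ 2 by rewrite /rho /nrm2; ring.
rewrite EB; set V := \sum_i _ ^+ 2; set W := \sum_i _ * _.
transitivity ((1 + b) * t ^+ 2 * V + rho B b / (1 + b) * delta ^+ 2).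
  by field; rewrite gt_eqF.
by rewrite -s2; ring.
Qed.

Lemma measurable_Qf_powR B b m : measurable_fun setT (fun y => Qf B b y `^ m).
Proof.
apply: (measurableT_comp (@measurable_powR R m)).
exact: (measurable_eval x0 (eQuad (1 + b) (delta *: B) ((1 - b) * delta ^+ 2))).
Qed.

(** With r = [scal B b], the Jacobian r^n and the factor ((1 + b) r^2)^(-n) combine to ((1 + b)
    r)^(-n), and (1 + b) r is the square root of 1 - |u|^2. Expanded in u, this is a generating
    function for the moments of h on the sphere. *)
Lemma integral_Qf B b : (0 < n)%N -> nrm1 B b <= 2^-1 ->
  \int[leb]_x Qf B b x `^ (- n%:R) =
  (1 - nrm2 B b) `^ (- (n%:R / 2)) * \int[leb]_x qf x `^ (- n%:R).
Proof.
move=> n0 u; have b0 := nrm1_lt1 u; have r0 := rho_gt0 u; have t0 := scal_gt0 u.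
have m0 : 0 < (1 + b) * scal B b ^+ 2 by rewrite mulr_gt0// exprn_gt0.
rewrite -(integral_rV_affine (shft B b) t0); last exact: measurable_Qf_powR.
have E x : Qf B b (scal B b *: x + shft B b) `^ (- n%:R) =
   ((1 + b) * scal B b ^+ 2) `^ (- n%:R) * qf x `^ (- n%:R).
  by rewrite Qf_affine// powRM ?(ltW m0) ?(ltW (qf_gt0 _ _ _)).
under eq_Rintegral do rewrite E.
rewrite RintegralZl//; last first.
  apply: integrable_qf => //.
  by rewrite ltr_pdivrMr// ltr_pMr ?ltr0n// ltr1n.
rewrite mulrA; congr (_ * _).
have -> : (1 - nrm2 B b) `^ (- (n%:R / 2)) = ((1 + b) * scal B b) `^ (- n%:R).
  rewrite /scal [(1 + b) * _]mulrC divfK ?gt_eqF// -/(rho B b) -powRrM; congr (_ `^ _).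
  by rewrite mulrN mulrC.
rewrite -powR_mulrn ?(ltW t0)// expr2 mulrA [in LHS]powRM ?(ltW t0) ?mulr_ge0 ?(ltW t0) ?(ltW b0)//.
rewrite mulrCA -powRD; last by rewrite (gt_eqF t0) implybT.
by rewrite subrr powRr0 mulr1.
- exact: powR_ge0.
- by rewrite invr_ge0 ltW.
Qed.

Variables (lam kappa : R).
Let s : R := n%:R - lam / 2.
Hypothesis lam0 : 0 < lam.
Hypothesis lamn : lam < n%:R.

(* The Hartree equation for the bubble provides this identity. *)
Hypothesis riesz_qf : forall x,
  (\int[leb]_y (riesz_kernel lam (x - y) * qf y `^ (- s))%:E =
   (kappa * qf x `^ (- (lam / 2)))%:E)%E.

(** The affine map carries [riesz_qf] over to [Qf B b], the kernel being homogeneous of degree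
    -lambda. The identity is between extended reals, so it contains the finiteness of the
    potential. *)
Lemma riesz_Qf B b x : nrm1 B b <= 2^-1 ->
  (\int[leb]_y (riesz_kernel lam (x - y) * Qf B b y `^ (- s))%:E =
   (kappa * (1 - nrm2 B b) `^ (- ((n%:R - lam) / 2)) * Qf B b x `^ (- (lam / 2)))%:E)%E.
Proof.
move=> u; have b0 := nrm1_lt1 u; have r0 := rho_gt0 u; have t0 := scal_gt0 u.
set t := scal B b in t0 *; set a := shft B b.
set x' := t^-1 *: (x - a).
have xE : x = t *: x' + a by rewrite /x' scalerA divff ?gt_eqF// scale1r subrK.
have mQ : measurable_fun setT (fun y => Qf B b y `^ (- s)).
  apply: (measurableT_comp (@measurable_powR R (- s))).
  exact: (measurable_eval x0 (eQuad (1 + b) (delta *: B) ((1 - b) * delta ^+ 2))).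
have mK := measurable_riesz_sub lam x.
rewrite -(ge0_integral_rV_affine a t0)//; last 2 first.
- by apply/measurable_EFinP; exact: measurable_funM.
- by move=> y; rewrite lee_fin mulr_ge0 ?riesz_ge0 ?powR_ge0.
pose c := t `^ (- lam) * ((1 + b) * t ^+ 2) `^ (- s).
have c0 : 0 <= c by rewrite mulr_ge0 ?powR_ge0.
have m0 : 0 < (1 + b) * t ^+ 2 by rewrite mulr_gt0// exprn_gt0.
have E y : (riesz_kernel lam (x - (t *: y + a)) * Qf B b (t *: y + a) `^ (- s))%:E =
   (c%:E * (riesz_kernel lam (x' - y) * qf y `^ (- s))%:E)%E.
  rewrite -EFinM; congr EFin.
  have -> : x - (t *: y + a) = t *: (x' - y).
    by rewrite xE scalerBr opprD addrACA subrr addr0.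
  rewrite rieszZ ?(ltW t0)// Qf_affine// powRM ?(ltW m0) ?(ltW (qf_gt0 _ _ _))//.
  by rewrite /c; ring.
under eq_integral do rewrite E.
rewrite ge0_integralZl ?lee_fin//; last 2 first.
- apply/measurable_EFinP; apply: measurable_funM; last exact: measurable_qf_powR.
  exact: measurable_riesz_sub.
- by move=> y _; rewrite lee_fin mulr_ge0 ?riesz_ge0 ?powR_ge0.
rewrite riesz_qf -!EFinM; congr EFin.
rewrite [in RHS]xE Qf_affine// [in RHS]powRM ?(ltW m0) ?(ltW (qf_gt0 _ _ _))//.
rewrite /c -powR_mulrn ?(ltW t0)//.
have -> : (1 - nrm2 B b) `^ (- ((n%:R - lam) / 2)) = ((1 + b) * t) `^ (- (n%:R - lam)).
  rewrite /t /scal [(1 + b) * _]mulrC divfK ?gt_eqF// -/(rho B b) -powRrM; congr (_ `^ _).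
  by rewrite mulrN mulrC.
have P1 e : ((1 + b) * t ^+ 2) `^ e = (1 + b) `^ e * t `^ (2 * e).
  by rewrite powRM ?exprn_ge0 ?(ltW b0) ?(ltW t0)// -powR_mulrn ?(ltW t0)// powRrM.
rewrite !P1 [((1 + b) * t) `^ _]powRM ?(ltW b0) ?(ltW t0)//.
have bn0 : (1 + b == 0) = false by rewrite gt_eqF.
have tn0 : (t == 0) = false by rewrite gt_eqF.
set X := qf x' `^ _.
transitivity (kappa * X * (t `^ n%:R * t `^ (- lam) * t `^ (2 * - s)) * (1 + b) `^ (- s)).
  by ring.
transitivity (kappa * X * (t `^ (- (n%:R - lam)) * t `^ (2 * - (lam / 2))) * ((1 + b) `^ (- (n%:R - lam)) * (1 + b) `^ (- (lam / 2)))); last by ring.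
rewrite -!powRD ?bn0 ?tn0 ?implybT//.
by congr (_ * _ `^ _ * _ `^ _); rewrite /s; field.
Qed.

Lemma integrable_riesz_qf x :
  leb.-integrable setT (EFin \o (fun y => riesz_kernel lam (x - y) * qf y `^ (- s))).
Proof.
have mK := measurable_riesz_sub lam x.
apply/integrableP; split.
  by apply/measurable_EFinP; apply: measurable_funM => //; exact: measurable_qf_powR.
under eq_integral => y _ do rewrite gee0_abs ?lee_fin ?mulr_ge0 ?riesz_ge0 ?powR_ge0//.
by rewrite riesz_qf ltry.
Qed.

Lemma nrm1Z (t : R) B b : 0 <= t -> nrm1 (t *: B) (t * b) = t * nrm1 B b.
Proof.
move=> t0; rewrite /nrm1 mulrDr normrM ger0_norm// mulr_sumr; congr (_ + _).
by apply: eq_bigr => i _; rewrite mxE normrM ger0_norm.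
Qed.

Lemma nrm2Z (t : R) B b : nrm2 (t *: B) (t * b) = t ^+ 2 * nrm2 B b.
Proof.
rewrite /nrm2 mulrDr exprMn mulr_sumr; congr (_ + _).
by apply: eq_bigr => i _; rewrite mxE exprMn.
Qed.

Lemma zfZ (t : R) B b x : zf (t *: B) (t * b) x = 1 + t * hf B b x.
Proof. by rewrite /zf hfZ. Qed.

Let hf1 B b : nrm1 B b <= 2^-1 -> forall x, `|hf B b x| <= 1.
Proof.
move=> u x; apply: le_trans (hf_le _ delta0 _ _ _) _; apply: le_trans u _.
by rewrite invf_le1// ler1n.
Qed.

Let eps_nrm B b (e : R) : nrm1 B b <= 2^-1 -> 0 <= e <= 2^-1 -> nrm1 (e *: B) (e * b) <= 2^-1.
Proof.
move=> u /andP[e0 e1]; rewrite nrm1Z//.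
have n0 : 0 <= nrm1 B b by rewrite addr_ge0// sumr_ge0.
nra.
Qed.

Let s0 : 0 < s. Proof. by have := lam0; have := lamn; rewrite /s; lra. Qed.

(** The Funk-Hecke formula in degree 1. In [riesz_Qf] at e u, the coefficient of e is -s times the
    wanted integral on the left and -(lambda/2) kappa q^(-lambda/2) h on the right, since 1 - e^2
    |u|^2 contributes only at order e^2. *)
Lemma riesz_hf B b x : nrm1 B b <= 2^-1 ->
  \int[leb]_y (riesz_kernel lam (x - y) * qf y `^ (- s) * hf B b y) =
  kappa * (lam / 2 / s) * qf x `^ (- (lam / 2)) * hf B b x.
Proof.
move=> u; have iF := integrable_riesz_qf x.
have mh := measurable_hf x0 delta0 B b.
have [C C0 HC] := integral_powR_expansion s 2 iF mh (hf1 u).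
have [C1 C10 HC1] := taylor_powR1D 2 (lam / 2).
have [C2 C20 HC2] := taylor_powR1D 1 ((n%:R - lam) / 2).
set m1 := \int[leb]_y _.
set X := kappa * qf x `^ (- (lam / 2)).
have E0 : \int[leb]_y (riesz_kernel lam (x - y) * qf y `^ (- s) * hf B b y ^+ 0) = X.
  under eq_Rintegral do rewrite expr0 mulr1.
  by rewrite /Rintegral riesz_qf.
have E1 : \int[leb]_y (riesz_kernel lam (x - y) * qf y `^ (- s) * hf B b y ^+ 1) = m1.
  by apply: eq_Rintegral => y _; rewrite expr1.
have EM (e : R) : 0 <= e <= 2^-1 ->
   \int[leb]_y (riesz_kernel lam (x - y) * qf y `^ (- s) * (1 + e * hf B b y) `^ (- s)) =
   X * (1 - e ^+ 2 * nrm2 B b) `^ (- ((n%:R - lam) / 2)) * (1 + e * hf B b x) `^ (- (lam / 2)).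
  move=> he; have ue := eps_nrm u he.
  have Q y r : Qf (e *: B) (e * b) y `^ r = qf y `^ r * (1 + e * hf B b y) `^ r.
    rewrite Qf_zf// zfZ powRM ?(ltW (qf_gt0 _ _ _))//.
    by rewrite -zfZ ltW// zf_gt0.
  have := riesz_Qf x ue; rewrite nrm2Z Q => H.
  transitivity (fine (\int[leb]_y (riesz_kernel lam (x - y) * Qf (e *: B) (e * b) y `^ (- s))%:E)%E).
    by congr fine; apply: eq_integral => y _; rewrite Q mulrA.
  by rewrite H /X /=; ring.
suff H : - s * m1 + lam / 2 * X * hf B b x = 0.
  apply: (mulfI (lt0r_neq0 s0)).
  have -> : s * m1 = lam / 2 * X * hf B b x by lra.
  by rewrite /X; field; rewrite gt_eqF.
have N0 := nrm2_ge0 B b.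
pose K2 := C2 * nrm2 B b.
apply: (@leading_coef_eq0 _ 1 _ (C + `|X| * (K2 * (C1 + 1 + lam / 2) + C1))) => e /andP[e0 e1].
have he : 0 <= e <= 2^-1 by rewrite ltW.
have G1 := HC e he; rewrite EM// !big_ord_recr big_ord0 /= in G1.
rewrite !expr0 E0 E1 bcoef0 bcoef1 expr1 !mul1r add0r in G1.
have hx := hf1 u x.
have ehe : `|e * hf B b x| <= e.
  by rewrite normrM gtr0_norm// ler_piMr// ltW.
have ehx : `|e * hf B b x| <= 2^-1 by exact: le_trans ehe e1.
have G2 := HC1 _ ehx; rewrite !big_ord_recr big_ord0 /= in G2.
rewrite !expr0 bcoef0 bcoef1 expr1 mul1r add0r in G2.
have e2n : `|- (e ^+ 2 * nrm2 B b)| <= 2^-1.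
  rewrite normrN ger0_norm; last by rewrite mulr_ge0// sqr_ge0.
  have := nrm2_le u; nra.
have G3 := HC2 _ e2n; rewrite big_ord1 /= bcoef0 mul1r expr0 expr1 in G3.
rewrite normrN [`|e ^+ 2 * _|]ger0_norm in G3; last by rewrite mulr_ge0// sqr_ge0.
move: G1 G2 G3; set a := _ `^ _; set c := _ `^ _ => G1 G2 G3.
have G2' : `|c - (1 + - (lam / 2) * (e * hf B b x))| <= C1 * e ^+ 2.
  apply: le_trans G2 _; rewrite ler_wpM2l// lerXn2r// nnegrE// ltW//.
have c0 : 0 <= c by exact: powR_ge0.
have cle : c <= C1 + 1 + lam / 2.
  move: G2' ehx; rewrite !ler_norml => /andP[_ h1] /andP[h2 h3].
  have : C1 * e ^+ 2 <= C1 by rewrite ler_piMr// exprn_ile1 ?(ltW e0)//; lra.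
  have := lam0; nra.
have -> : e ^+ 1 * (- s * m1 + lam / 2 * X * hf B b x) =
  - (X * a * c - (X + - s * e * m1)) +
  X * ((a - 1) * c + (c - (1 + - (lam / 2) * (e * hf B b x)))) by ring.
apply: le_trans (ler_normD _ _) _; rewrite normrN [leRHS]mulrDl; apply: lerD => //.
rewrite normrM -mulrA ler_wpM2l//; apply: le_trans (ler_normD _ _) _.
rewrite [leRHS]mulrDl; apply: lerD => //.
rewrite normrM (ger0_norm c0).
have -> : K2 * (C1 + 1 + lam / 2) * e ^+ 2 = (C2 * (e ^+ 2 * nrm2 B b)) * (C1 + 1 + lam / 2).
  by rewrite /K2; ring.
by rewrite ler_pM.
Qed.

(** Coefficients of [integral_Qf] at e u: order e gives [m1 = 0], and then order e^2 gives n(n+1)/2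
    m2 = (n/2) |u|^2 m0. *)
Lemma integral_hf B b : (0 < n)%N -> nrm1 B b <= 2^-1 ->
  \int[leb]_y (qf y `^ (- n%:R) * hf B b y ^+ 2) =
  nrm2 B b / (n%:R + 1) * \int[leb]_y qf y `^ (- n%:R).
Proof.
move=> n0 u.
have iF : leb.-integrable setT (EFin \o (fun y => qf y `^ (- n%:R))).
  by apply: integrable_qf => //; rewrite ltr_pdivrMr// ltr_pMr ?ltr0n// ltr1n.
have mh := measurable_hf x0 delta0 B b.
have [C C0 HC] := integral_powR_expansion n%:R 2 iF mh (hf1 u).
have [C1 C10 HC1] := integral_powR_expansion n%:R 3 iF mh (hf1 u).
have [C2 C20 HC2] := taylor_powR1D 2 (n%:R / 2 : R).
have [C3 C30 HC3] := taylor_powR1D 1 (n%:R / 2 : R).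
set m2 := \int[leb]_y _; set m0 := \int[leb]_y _.
set m1 := \int[leb]_y (qf y `^ (- n%:R) * hf B b y).
have E0 : \int[leb]_y (qf y `^ (- n%:R) * hf B b y ^+ 0) = m0.
  by apply: eq_Rintegral => y _; rewrite expr0 mulr1.
have E1 : \int[leb]_y (qf y `^ (- n%:R) * hf B b y ^+ 1) = m1.
  by apply: eq_Rintegral => y _; rewrite expr1.
have N0 := nrm2_ge0 B b.
have EM (e : R) : 0 <= e <= 2^-1 ->
   \int[leb]_y (qf y `^ (- n%:R) * (1 + e * hf B b y) `^ (- n%:R)) =
   (1 - e ^+ 2 * nrm2 B b) `^ (- (n%:R / 2)) * m0.
  move=> he; have ue := eps_nrm u he.
  rewrite -nrm2Z -integral_Qf//; apply: eq_Rintegral => y _.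
  rewrite Qf_zf// zfZ powRM ?(ltW (qf_gt0 _ _ _))//.
  by rewrite -zfZ ltW// zf_gt0.
have e2n (e : R) : 0 < e <= 2^-1 -> `|- (e ^+ 2 * nrm2 B b)| <= 2^-1.
  move=> /andP[e0 e1]; rewrite normrN ger0_norm; last by rewrite mulr_ge0// sqr_ge0.
  have := nrm2_le u; nra.
have m10 : m1 = 0.
  apply: (@leading_coef_eq0 _ 1 _ ((C + C3 * nrm2 B b * `|m0|) / n%:R)) => e he.
  have /andP[e0 e1] := he; have he' : 0 <= e <= 2^-1 by rewrite ltW.
  have G1 := HC e he'; rewrite EM// !big_ord_recr big_ord0 /= in G1.
  rewrite !expr0 E0 E1 bcoef0 bcoef1 expr1 !mul1r add0r in G1.
  have G3 := HC3 _ (e2n e he); rewrite big_ord1 /= bcoef0 mul1r expr0 expr1 in G3.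
  rewrite normrN [`|e ^+ 2 * _|]ger0_norm in G3; last by rewrite mulr_ge0// sqr_ge0.
  move: G1 G3; set a := _ `^ _ => G1 G3.
  have nn0 : 0 < n%:R :> R by rewrite ltr0n.
  rewrite -[leRHS]mulrA [_^-1 * _]mulrC mulrA ler_pdivlMr//.
  rewrite -[n%:R in leLHS]gtr0_norm// -normrM.
  rewrite -normrN; have -> : - (e ^+ 1 * m1 * n%:R) = - (a * m0 - (m0 + - n%:R * e * m1)) + (a - 1) * m0 by ring.
  apply: le_trans (ler_normD _ _) _; rewrite normrN [leRHS]mulrDl; apply: lerD => //.
  rewrite normrM (_ : _ * e ^+ 2 = C3 * (e ^+ 2 * nrm2 B b) * `|m0|); last by ring.
  by rewrite ler_wpM2r.
suff H : n%:R * (n%:R + 1) / 2 * m2 - n%:R / 2 * nrm2 B b * m0 = 0.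
  have nn0 : 0 < n%:R :> R by rewrite ltr0n.
  have nk : n%:R * (n%:R + 1) / 2 != 0 :> R.
    by rewrite gt_eqF// divr_gt0// mulr_gt0// addr_gt0.
  apply: (mulfI nk).
  have -> : n%:R * (n%:R + 1) / 2 * m2 = n%:R / 2 * nrm2 B b * m0 by lra.
  by field; rewrite gt_eqF// addr_gt0.
apply: (@leading_coef_eq0 _ 2 _ (C1 + C2 * nrm2 B b ^+ 2 * `|m0|)) => e he.
have /andP[e0 e1] := he; have he' : 0 <= e <= 2^-1 by rewrite ltW.
have G1 := HC1 e he'; rewrite EM// !big_ord_recr big_ord0 /= in G1.
rewrite !expr0 E0 E1 bcoef0 bcoef1 bcoef2 expr1 !mul1r add0r in G1.
rewrite -/m2 m10 mulr0 addr0 in G1.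
have G2 := HC2 _ (e2n e he); rewrite !big_ord_recr big_ord0 /= in G2.
rewrite !expr0 bcoef0 bcoef1 expr1 mul1r add0r in G2.
rewrite normrN [`|e ^+ 2 * _|]ger0_norm in G2; last by rewrite mulr_ge0// sqr_ge0.
move: G1 G2; set a := _ `^ _ => G1 G2.
have -> : e ^+ 2 * (n%:R * (n%:R + 1) / 2 * m2 - n%:R / 2 * nrm2 B b * m0) =
  - (a * m0 - (m0 + n%:R * (n%:R + 1) / 2 * e ^+ 2 * m2)) +
  (a - (1 + - (n%:R / 2) * - (e ^+ 2 * nrm2 B b))) * m0 by ring.
apply: le_trans (ler_normD _ _) _; rewrite normrN [leRHS]mulrDl; apply: lerD => //.
rewrite normrM.
apply: (@le_trans _ _ (C2 * (e ^+ 2 * nrm2 B b) ^+ 2 * `|m0|)).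
  by rewrite ler_wpM2r.
rewrite exprMn.
have -> : C2 * (e ^+ 2 ^+ 2 * nrm2 B b ^+ 2) * `|m0| = C2 * nrm2 B b ^+ 2 * `|m0| * (e * e ^+ 3).
  by ring.
rewrite ler_wpM2l ?mulr_ge0 ?sqr_ge0// ler_piMl ?exprn_ge0 ?(ltW e0)//.
by apply: le_trans e1 _; rewrite invf_le1// ler1n.
Qed.

End riesz.

(** * Symmetry of the Riesz pairing *)

Section riesz_fubini.
Context {R : realType} {n : nat}.
Variables (x0 : 'rV[R]_n) (delta : R).
Hypothesis delta0 : 0 < delta.
Implicit Types (x y B : 'rV[R]_n) (b : R).
Local Notation leb := (@lebesgue_rV R n).
Local Notation qf := (qf x0 delta).
Variables (lam kappa s : R).
Hypothesis riesz_qf : forall x,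
  (\int[leb]_y (riesz_kernel lam (x - y) * qf y `^ (- s))%:E =
   (kappa * qf x `^ (- (lam / 2)))%:E)%E.

Let mK : measurable_fun setT (fun z : 'rV[R]_n * 'rV[R]_n => riesz_kernel lam (z.1 - z.2)).
Proof.
apply: (measurableT_comp (measurable_riesz lam)).
apply: measurable_rVP => i; under eq_fun do rewrite !mxE.
by apply: measurable_funB; apply: (measurableT_comp (measurable_rV_coord i)).
Qed.

Lemma measurable_convolution_riesz (g : 'rV[R]_n -> R) : measurable_fun setT g ->
  measurable_fun setT (convolution (riesz_kernel lam) g).
Proof.
move=> mg.
pose h (z : 'rV[R]_n * 'rV[R]_n) := (riesz_kernel lam (z.1 - z.2) * g z.2)%:E.
have mh : measurable_fun setT h.
  apply/measurable_EFinP; apply: measurable_funM => //.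
  exact: (measurableT_comp mg).
have -> : convolution (riesz_kernel lam) g = fine \o
   (fun x => (\int[leb]_y h^\+ (x, y) - \int[leb]_y h^\- (x, y)))%E.
  apply/funext => x; rewrite /= /convolution /Rintegral integralE.
  by congr (fine (_ - _)); apply: eq_integral => y _; rewrite /h ?funeposE ?funenegE.
apply: measurableT_comp => //.
apply: emeasurable_funB.
- apply: (@measurable_fun_fubini_tonelli_F _ _ _ _ _ leb h^\+%E).
    exact: measurable_funepos.
  by move=> z; exact: funepos_ge0.
- apply: (@measurable_fun_fubini_tonelli_F _ _ _ _ _ leb h^\-%E).
    exact: measurable_funeneg.
  by move=> z; exact: funeneg_ge0.
Qed.

Variables (f g : 'rV[R]_n -> R) (C1 C2 e : R).
Hypothesis mf : measurable_fun setT f.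
Hypothesis mg : measurable_fun setT g.
Hypothesis fC : forall x, `|f x| <= C1 * qf x `^ (- s).
Hypothesis gC : forall x, `|g x| <= C2 * qf x `^ (- e).
Hypothesis en : n%:R / 2 < e + lam / 2.

Let G (z : 'rV[R]_n * 'rV[R]_n) := (f z.1 * (riesz_kernel lam (z.1 - z.2) * g z.2))%:E.

Let C0 (u : 'rV[R]_n -> R) C m : (forall x, `|u x| <= C * qf x `^ m) -> 0 <= C.
Proof.
move=> /(_ x0) h; have := le_trans (normr_ge0 _) h.
by rewrite pmulr_lge0// powR_gt0// qf_gt0.
Qed.

Let mG : measurable_fun setT G.
Proof.
apply/measurable_EFinP; apply: measurable_funM; first exact: (measurableT_comp mf).
by apply: measurable_funM => //; exact: (measurableT_comp mg).
Qed.

(** Integrating in x first, the bound of f by q^(-s) lets [riesz_qf] evaluate the inner integral as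
    a multiple of q^(-lambda/2); what is left is q^(-(e + lambda/2)), integrable by [en]. *)
Let iG : (leb \x leb)%E.-integrable setT G.
Proof.
apply/(integrable21ltyP _ _ mG).
have C10 := C0 fC; have C20 := C0 gC.
have H y : (\int[leb]_x `|G (x, y)| <= (C1 * C2 * kappa * qf y `^ (- (e + lam / 2)))%:E)%E.
  apply: (@le_trans _ _ (\int[leb]_x
     ((C1 * (C2 * qf y `^ (- e)))%:E * (riesz_kernel lam (y - x) * qf x `^ (- s))%:E))%E).
    apply: ge0_le_integral => //.
    - apply: measurableT_comp => //.
      by apply: (measurableT_comp mG); exact: measurable_fun_pair.
    - apply: emeasurable_funM => //; apply/measurable_EFinP; apply: measurable_funM.
        apply: (measurableT_comp mK (g := fun x => (y, x))); exact: measurable_fun_pair.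
      exact: measurable_qf_powR.
    move=> x _; rewrite /G /= -EFinM lee_fin !normrM (ger0_norm (riesz_ge0 _ _)).
    rewrite riesz_sym.
    have := fC x; have := gC y.
    have K0 := riesz_ge0 lam (y - x).
    move: (riesz_kernel _ _) K0 (qf x `^ _) (qf y `^ _) => K K0 a b gb fa.
    rewrite (_ : _ * (K * a) = (C1 * a) * (K * (C2 * b))); last by ring.
    by apply: ler_pM => //; rewrite ?mulr_ge0// ler_wpM2l.
  rewrite ge0_integralZl//; last 3 first.
  - apply/measurable_EFinP; apply: measurable_funM; last exact: measurable_qf_powR.
    apply: (measurableT_comp mK (g := fun x => (y, x))); exact: measurable_fun_pair.
  - by move=> x _; rewrite lee_fin mulr_ge0 ?riesz_ge0 ?powR_ge0.
  - by rewrite lee_fin !mulr_ge0 ?powR_ge0.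
  rewrite riesz_qf -EFinM lee_fin le_eqVlt; apply/orP; left; apply/eqP.
  rewrite opprD powRD; last by rewrite (gt_eqF (qf_gt0 _ delta0 _)) implybT.
  by ring.
have mq : measurable_fun setT (EFin \o (fun y => C1 * C2 * kappa * qf y `^ (- (e + lam / 2)))).
  by apply/measurable_EFinP; apply: measurable_funM => //; exact: measurable_qf_powR.
apply: (@le_lt_trans _ _ (\int[leb]_y `|(C1 * C2 * kappa * qf y `^ (- (e + lam / 2)))%:E|)%E).
  apply: ge0_le_integral => //.
  - by move=> y _; exact: integral_ge0.
  - pose A (z : 'rV[R]_n * 'rV[R]_n) := `|G (z.2, z.1)|%E.
    apply: (@measurable_fun_fubini_tonelli_F _ _ _ _ _ leb A);
      last by move=> z; exact: abse_ge0.
    apply: measurableT_comp => //; apply: (measurableT_comp mG).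
    exact: measurable_fun_pair.
  - exact: measurableT_comp.
  - by move=> y _; apply: le_trans (H y) _; exact: lee_abs.
have /integrableP[_ h] := integrableZ_EFin (C1 * C2 * kappa) (integrable_qf x0 delta0 en).
exact: h.
Qed.

(** Integrability of a section of G says something about the kernel times g only where f x is
    nonzero, by division; where f x = 0 both sides vanish whatever value the convolution has. *)
Let ae_F : {ae leb, forall x, (\int[leb]_y G (x, y))%E =
   (f x * convolution (riesz_kernel lam) g x)%:E}.
Proof.
have := ae_integrable1 iG; apply: filterS => x iGx.
have [fx0|fx0] := eqVneq (f x) 0.
  rewrite fx0 mul0r; apply: integral0_eq => y _.
  by rewrite /G /= fx0 mul0r.
have iK : leb.-integrable setT (EFin \o (fun y => riesz_kernel lam (x - y) * g y)).
  have := integrableZl measurableT (f x)^-1 iGx; apply: eq_integrable => // y _.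
  by rewrite /G /= -EFinM; congr EFin; field.
transitivity ((f x)%:E * \int[leb]_y (riesz_kernel lam (x - y) * g y)%:E)%E.
  rewrite -integralZl//; apply: eq_integral => y _; by rewrite -EFinM.
rewrite EFinM /convolution /Rintegral fineK//.
exact: (integrable_fin_num measurableT iK).
Qed.

Let ae_G : {ae leb, forall y, (\int[leb]_x G (x, y))%E =
   (g y * convolution (riesz_kernel lam) f y)%:E}.
Proof.
have := ae_integrable2 iG; apply: filterS => y iGy.
have [gy0|gy0] := eqVneq (g y) 0.
  rewrite gy0 mul0r; apply: integral0_eq => x _.
  by rewrite /G /= gy0 !mulr0.
have iK : leb.-integrable setT (EFin \o (fun x => riesz_kernel lam (y - x) * f x)).
  have := integrableZl measurableT (g y)^-1 iGy; apply: eq_integrable => // x _.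
  by rewrite /G /= -EFinM riesz_sym; congr EFin; field.
transitivity ((g y)%:E * \int[leb]_x (riesz_kernel lam (y - x) * f x)%:E)%E.
  rewrite -integralZl//; apply: eq_integral => x _; rewrite -EFinM /G /= riesz_sym.
  by congr EFin; ring.
rewrite EFinM /convolution /Rintegral fineK//.
exact: (integrable_fin_num measurableT iK).
Qed.

Lemma integrable_mul_convolution :
  leb.-integrable setT (EFin \o (fun x => f x * convolution (riesz_kernel lam) g x)).
Proof.
have mc : measurable_fun setT (EFin \o (fun x => f x * convolution (riesz_kernel lam) g x)).
  by apply/measurable_EFinP; apply: measurable_funM => //; exact: measurable_convolution_riesz.
have /integrableP[mF lF] := integrable_fubini_F iG.
apply/integrableP; split => //.
apply: le_lt_trans lF; rewrite le_eqVlt; apply/orP; left; apply/eqP.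
apply: ae_eq_integral => //.
- exact: measurableT_comp.
- exact: measurableT_comp.
- by move: ae_F; apply: filterS => x Fx _; rewrite /fubini_F Fx.
Qed.

Lemma mul_convolution_symm :
  \int[leb]_x (f x * convolution (riesz_kernel lam) g x) =
  \int[leb]_y (g y * convolution (riesz_kernel lam) f y).
Proof.
have mc (u v : 'rV[R]_n -> R) : measurable_fun setT u -> measurable_fun setT v ->
    measurable_fun setT (EFin \o (fun x => u x * convolution (riesz_kernel lam) v x)).
  by move=> mu mv; apply/measurable_EFinP; apply: measurable_funM => //; exact: measurable_convolution_riesz.
rewrite /Rintegral; congr fine.
transitivity (\int[leb]_x fubini_F leb G x)%E.
  apply: ae_eq_integral => //; first exact: mc.
  - exact: (measurable_fubini_F iG).
  - by move: ae_F; apply: filterS => x Fx _; rewrite /fubini_F Fx.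
transitivity (\int[leb]_y fubini_G leb G y)%E.
  by have := Fubini iG.
apply: ae_eq_integral => //; last first.
- by move: ae_G; apply: filterS => x Fx _; rewrite /fubini_G Fx.
- exact: mc.
- exact: (measurable_fubini_G iG).
Qed.

End riesz_fubini.

(** * Test functions without compact support *)

Section cutoff.
Context {R : realType} {n : nat}.
Variables (x0 : 'rV[R]_n).
Implicit Types (x : 'rV[R]_n) (r t : R).
Local Notation S x := (\sum_i (x - x0) ord0 i ^+ 2).

Let g1 : R := flat 0 1.

Lemma flat0_homo (u v : R) : u <= v -> flat 0 u <= flat 0 v.
Proof.
move=> uv; rewrite {1}/flat; case: ifPn => u0; last exact: flat_ge0.
have v0 : 0 < v by exact: lt_le_trans uv.
by rewrite /flat v0 !expr0 !mul1r ler_expR lerN2 lef_pV2.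
Qed.

Lemma flat_le0 k t : t <= 0 -> flat k t = 0.
Proof. by rewrite /flat ltNge => ->. Qed.

Lemma flat0_gt0 t : 0 < t -> 0 < flat 0 t.
Proof. by move=> t0; rewrite /flat t0 expr0 mul1r expR_gt0. Qed.

Lemma flat_bounded k t : t <= 1 -> `|flat k t| <= k.+2`!%:R.
Proof.
move=> t1; rewrite ger0_norm ?flat_ge0//.
have [t0|t0] := leP t 0; first by rewrite flat_le0.
by apply: le_trans (flat_le _ _) _; rewrite ler_piMr// exprn_ile1// ltW.
Qed.

Let g1_le1 : g1 <= 1.
Proof. by rewrite /g1 /flat ltr01 expr0 mul1r invr1 -[leRHS](expR0 R) ler_expR oppr_le0. Qed.

Let g1_gt0 : 0 < g1. Proof. exact: flat0_gt0. Qed.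

Let w t := g1 - flat 0 t.
(** [th1] and [th2] are the first and second derivatives of the cutoff profile t |-> flat 0 (g1 -
    flat 0 t) / flat 0 g1. *)
Let th1 t := (flat 0 g1)^-1 * (flat 2 (w t) * - flat 2 t).
Let th2 t := (flat 0 g1)^-1 * ((flat 4 (w t) - 2 * flat 3 (w t)) * flat 2 t ^+ 2
   - flat 2 (w t) * (flat 4 t - 2 * flat 3 t)).

Let w_le1 t : w t <= 1.
Proof. by rewrite /w lerBlDr (le_trans g1_le1)// lerDl flat_ge0. Qed.

Let w_le0 t : 1 <= t -> w t <= 0.
Proof. by move=> t1; rewrite /w subr_le0; exact: flat0_homo. Qed.

Let th_out t : t <= 0 \/ 1 <= t -> th1 t = 0 /\ th2 t = 0.
Proof.
rewrite /th1 /th2 => -[t0|/w_le0 w0].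
  by rewrite !(flat_le0 _ t0); split; ring.
by rewrite !(flat_le0 _ w0); split; ring.
Qed.

(** The functions [flat k] are bounded for t <= 1; for t >= 1 the profile is constant and its
    derivatives vanish. *)
Let th_bounded : exists2 C, 0 <= C & forall t, `|th1 t| <= C /\ `|th2 t| <= C.
Proof.
pose F k : R := k.+2`!%:R.
pose C : R := (flat 0 g1)^-1 * (F 2 * F 2 + ((F 4 + 2 * F 3) * F 2 ^+ 2 + F 2 * (F 4 + 2 * F 3))).
have F0 k : 0 <= F k by [].
have i0 : 0 <= (flat 0 g1)^-1 by rewrite invr_ge0 flat_ge0.
have C0 : 0 <= C by rewrite mulr_ge0// !addr_ge0// !mulr_ge0 ?exprn_ge0 ?addr_ge0 ?mulr_ge0.
exists C => // t.
have [t1|t1] := leP 1 t.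
  by have [-> ->] := th_out (or_intror t1); rewrite normr0.
have ft k : `|flat k t| <= F k by apply: flat_bounded; exact: ltW.
have fw k : `|flat k (w t)| <= F k by apply: flat_bounded; exact: w_le1.
have f43 (u : R) : `|flat 4 u| <= F 4 -> `|flat 3 u| <= F 3 -> `|flat 4 u - 2 * flat 3 u| <= F 4 + 2 * F 3.
  move=> h4 h3; apply: le_trans (ler_normB _ _) _.
  by rewrite lerD// normrM ger0_norm// ler_wpM2l.
split; rewrite /th1 /th2 normrM (ger0_norm i0) ler_wpM2l//.
  rewrite normrM normrN; apply: (@le_trans _ _ (F 2 * F 2)); first exact: ler_pM.
  by rewrite lerDl !addr_ge0// !mulr_ge0 ?exprn_ge0 ?addr_ge0 ?mulr_ge0.
apply: le_trans (ler_normB _ _) _; rewrite -[leLHS]add0r; apply: lerD; first by rewrite mulr_ge0.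
apply: lerD; rewrite normrM; apply: ler_pM => //; try exact: f43.
by rewrite normrX lerXn2r ?nnegrE.
Qed.

(** With t = r |x - x0|^2 - 1, the profile is 1 for t <= 0, where the inner [flat 0 t] is 0, and 0
    for t >= 1, where it is at least g1 = flat 0 1. Nesting [flat] in itself gives a smooth cutoff
    inside the language of [expr], which has no piecewise constructor. *)
Definition cut_expr r : @expr R n :=
  eMul (eCst (flat 0 g1)^-1)
   (eFlat 0 (eAdd (eCst g1) (eMul (eCst (-1)) (eFlat 0 (eQuad r 0 (-1)))))).

Let tq r x := quad x0 r 0 (-1) x.

Let tqE r x : tq r x = r * S x - 1.
Proof.
rewrite /tq /quad (_ : \sum_i (0 : 'rV[R]_n) ord0 i * (x - x0) ord0 i = 0).
  by rewrite mulr0 addr0.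
by rewrite big1// => i _; rewrite mxE mul0r.
Qed.

Let eval_cut r x : eval x0 (cut_expr r) x = (flat 0 g1)^-1 * flat 0 (w (tq r x)).
Proof. by rewrite /= mulN1r. Qed.

Lemma cut_ge0_le1 r x : 0 <= eval x0 (cut_expr r) x <= 1.
Proof.
rewrite eval_cut; have h := flat0_gt0 g1_gt0.
rewrite mulr_ge0 ?invr_ge0 ?flat_ge0//= mulrC ler_pdivrMr// mul1r.
by apply: flat0_homo; rewrite /w lerBlDr lerDl flat_ge0.
Qed.

Lemma cut_eq1 r x : r * S x <= 1 -> eval x0 (cut_expr r) x = 1.
Proof.
move=> h; have t0 : tq r x <= 0 by rewrite tqE subr_le0.
rewrite eval_cut /w (flat_le0 _ t0) subr0 mulVf//.
by rewrite gt_eqF// flat0_gt0.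
Qed.

Lemma cut_eq0 r x : 2 <= r * S x -> eval x0 (cut_expr r) x = 0.
Proof.
move=> h; rewrite eval_cut (flat_le0 _ (w_le0 _)) ?mulr0//.
by rewrite tqE; lra.
Qed.

Lemma cut_diff1 r j x : eval x0 (ediff j (cut_expr r)) x = th1 (tq r x) * (2 * r * (x - x0) ord0 j).
Proof.
rewrite /= (_ : (0 : 'rV[R]_n) ord0 j = 0); last by rewrite mxE.
by rewrite /th1 /w -/(tq r x) mulN1r; ring.
Qed.

Lemma cut_diff2 r j x : eval x0 (ediff j (ediff j (cut_expr r))) x =
  th2 (tq r x) * (2 * r * (x - x0) ord0 j) ^+ 2 + th1 (tq r x) * (2 * r).
Proof.
rewrite /= (_ : (0 : 'rV[R]_n) ord0 j = 0); last by rewrite mxE.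
rewrite eqxx mulr1n /th1 /th2 /w -/(tq r x) mulN1r; ring.
Qed.

Lemma cut_bounds : exists2 C, 0 <= C & forall r j x, 0 < r ->
  `|eval x0 (ediff j (cut_expr r)) x| <= C * (r * `|(x - x0) ord0 j|) /\
  `|eval x0 (ediff j (ediff j (cut_expr r))) x| <= C * r.
Proof.
have [C C0 HC] := th_bounded.
(* 10 = 8 + 2: on the support r (x - x0)_j^2 <= 2, so the square (2 r (x - x0)_j)^2 is at most 8 r,
   and the other term of the second derivative contributes 2 r. *)
exists (10 * C) => [|r j x r0]; first by rewrite mulr_ge0.
rewrite cut_diff1 cut_diff2; have [h1 h2] := HC (tq r x).
have Cr : 0 <= C * r by rewrite mulr_ge0// ltW.
split.
  rewrite normrM (_ : `|2 * r * _| = 2 * (r * `|(x - x0) ord0 j|)); last first.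
    by rewrite !normrM (ger0_norm (ler0n _ 2)) (gtr0_norm r0) mulrA.
  have y0 : 0 <= r * `|(x - x0) ord0 j| by rewrite mulr_ge0// ltW.
  apply: (@le_trans _ _ (C * (2 * (r * `|(x - x0) ord0 j|)))).
    by rewrite ler_wpM2r// mulr_ge0.
  have := mulr_ge0 C0 y0; lra.
have [t1|t1] := leP 1 (tq r x).
  by have [-> ->] := th_out (or_intror t1); rewrite !mul0r addr0 normr0; lra.
have ySr : r * (x - x0) ord0 j ^+ 2 <= 2.
  apply: (@le_trans _ _ (r * S x)); last by move: t1; rewrite tqE; lra.
  rewrite ler_wpM2l ?(ltW r0)// (bigD1 j)//= lerDl sumr_ge0// => i _; exact: sqr_ge0.
apply: le_trans (ler_normD _ _) _.
have -> : 10 * C * r = C * (8 * r) + C * (2 * r) by ring.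
apply: lerD; rewrite normrM; apply: ler_pM => //.
  rewrite ger0_norm ?sqr_ge0// exprMn exprMn.
  have -> : 2 ^+ 2 * r ^+ 2 * (x - x0) ord0 j ^+ 2 = 4 * r * (r * (x - x0) ord0 j ^+ 2) by ring.
  have -> : 8 * r = 4 * r * 2 by ring.
  by rewrite ler_wpM2l// mulr_ge0// ltW.
by rewrite ger0_norm// mulr_ge0// ltW.
Qed.

Lemma cut_diff_out r j x : r * S x <= 1 \/ 2 <= r * S x ->
  eval x0 (ediff j (cut_expr r)) x = 0 /\ eval x0 (ediff j (ediff j (cut_expr r))) x = 0.
Proof.
move=> h; rewrite cut_diff1 cut_diff2.
have [|-> ->] := @th_out (tq r x).
  by rewrite tqE; case: h => h; [left|right]; lra.
by rewrite !mul0r addr0.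
Qed.

Lemma compact_closure_bounded (A : set 'rV[R]_n) (M : R) :
  (forall x, A x -> forall i, `|x ord0 i| <= M) -> compact (closure A).
Proof.
move=> AM.
pose B := [set v : 'rV[R]_n | forall i, `[- M, M]%classic (v ord0 i)].
have cB : compact B.
  by apply: (@rV_compact _ _ (fun=> `[- M, M]%classic)) => i; exact: segment_compact.
have clB : closed B by apply: compact_closed => //; exact: norm_hausdorff.
apply: subclosed_compact cB _; first exact: closed_closure.
have AB : A `<=` B by move=> x Ax i /=; rewrite in_itv/= -ler_norml; exact: AM.
by have := closure_subset AB; rewrite -((closure_id B).1 clB).
Qed.

Lemma test_function_cut (e : expr) r : 0 < r -> wf x0 e ->
  test_function (eval x0 (eMul e (cut_expr r))).
Proof.
move=> r0 we; split; first exact: smooth_eval.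
pose M := (2 / r + 1) + \sum_i `|x0 ord0 i|.
apply: (@compact_closure_bounded _ M) => x /= xn0 i.
have Sr : r * S x < 2.
  rewrite ltNge; apply: contra xn0 => h.
  by have := cut_eq0 h => /= ->; rewrite mulr0.
have yi : (x - x0) ord0 i ^+ 2 <= 2 / r.
  rewrite ler_pdivlMr// mulrC; apply: le_trans (ltW Sr).
  rewrite ler_wpM2l ?(ltW r0)// (bigD1 i)//= lerDl sumr_ge0// => j _; exact: sqr_ge0.
have -> : x ord0 i = (x - x0) ord0 i + x0 ord0 i by rewrite !mxE subrK.
apply: le_trans (ler_normD _ _) _; apply: lerD.
  move: yi; rewrite -real_normK ?num_real//.
  have := normr_ge0 ((x - x0) ord0 i); nra.
by rewrite (bigD1 i)//= lerDl sumr_ge0.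
Qed.

End cutoff.

(** * Growth orders of expressions *)

Section symbols.
Context {R : realType} {n : nat}.
Variables (x0 : 'rV[R]_n) (delta : R).
Hypothesis delta0 : 0 < delta.
Implicit Types (x B : 'rV[R]_n) (A C m r : R).
Local Notation qf := (qf x0 delta).
Local Notation leb := (@lebesgue_rV R n).

(* symbol e m: e grows at most like qf^m, and each derivative gains qf^(-1/2). *)
Inductive symbol : @expr R n -> R -> Prop :=
| symbol_zero m : symbol (eCst 0) m
| symbol_cst c : symbol (eCst c) 0
| symbol_coord j : symbol (eCoord j) 2^-1
| symbol_quad A B C : symbol (eQuad A B C) 1
| symbol_add a b m : symbol a m -> symbol b m -> symbol (eAdd a b) m
| symbol_mul a b m m' : symbol a m -> symbol b m' -> symbol (eMul a b) (m + m')
| symbol_pow A B C r c : 0 < c -> (forall x, c * qf x <= quad x0 A B C x) ->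
    symbol (ePow (eQuad A B C) r) r
| symbol_weak a m m' : m <= m' -> symbol a m -> symbol a m'.

Lemma symbol_ediff j e m : symbol e m -> symbol (ediff j e) (m - 2^-1).
Proof.
elim=> {e m} /=.
- by move=> m; exact: symbol_zero.
- by move=> c; exact: symbol_zero.
- by move=> i; rewrite subrr; exact: symbol_cst.
- move=> A B C; apply: symbol_add.
    have -> : 1 - 2^-1 = 0 + 2^-1 :> R by field.
    by apply: symbol_mul; [exact: symbol_cst|exact: symbol_coord].
  by apply: symbol_weak (symbol_cst _); lra.
- by move=> a b m _ Ha _ Hb; exact: symbol_add.
- move=> a b m m' sa Ha sb Hb; apply: symbol_add.
    by rewrite -addrA; exact: symbol_mul.
  have -> : m + m' - 2^-1 = m' + (m - 2^-1) by ring.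
  exact: symbol_mul.
- move=> A B C r c c0 H.
  have -> : r - 2^-1 = (0 + (r - 1)) + (1 - 2^-1) by lra.
  apply: symbol_mul.
    by apply: symbol_mul; [exact: symbol_cst|exact: symbol_pow c0 H].
  apply: symbol_add.
    have -> : 1 - 2^-1 = 0 + 2^-1 :> R by field.
    by apply: symbol_mul; [exact: symbol_cst|exact: symbol_coord].
  by apply: symbol_weak (symbol_cst _); lra.
- by move=> a m m' mm' _; apply: symbol_weak; rewrite lerD2r.
Qed.

Lemma coord_le_sqrt x j : `|(x - x0) ord0 j| <= qf x `^ 2^-1.
Proof.
rewrite powR12_sqrt ?(ltW (qf_gt0 _ delta0 _))// -sqrtr_sqr ler_wsqrtr//.
exact: coord_le_qf.
Qed.

Lemma delta_le_sqrt x : delta <= qf x `^ 2^-1.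
Proof.
rewrite powR12_sqrt ?(ltW (qf_gt0 _ delta0 _))// -[leLHS]gtr0_norm// -sqrtr_sqr.
by rewrite ler_wsqrtr// qf_ge.
Qed.

Lemma qf_powR_le m m' : m <= m' ->
  exists2 K, 0 <= K & forall x, qf x `^ m <= K * qf x `^ m'.
Proof.
move=> mm'; exists ((delta ^+ 2) `^ (m - m')); first exact: powR_ge0.
move=> x; have q0 := qf_gt0 x0 delta0 x.
have -> : qf x `^ m = qf x `^ (m - m') * qf x `^ m'.
  by rewrite -powRD ?subrK// (gt_eqF q0) implybT.
rewrite ler_wpM2r ?powR_ge0//.
have -> : m - m' = - (m' - m) by rewrite opprB.
rewrite !powRN lef_pV2 ?posrE ?powR_gt0 ?exprn_gt0//.
apply: ge0_ler_powR; rewrite ?nnegrE ?subr_ge0 ?sqr_ge0 ?(ltW q0)//.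
exact: qf_ge.
Qed.

Lemma quad_bound A B C :
  exists2 D, 0 <= D & forall x, `|quad x0 A B C x| <= D * qf x.
Proof.
pose d2 := (delta ^+ 2)^-1.
have d20 : 0 <= d2 by rewrite invr_ge0 sqr_ge0.
have SB : 0 <= \sum_i `|B ord0 i| by rewrite sumr_ge0.
exists (`|A| + 2 * (\sum_i `|B ord0 i|) / delta + `|C| * d2).
  by rewrite !addr_ge0// !mulr_ge0// ?invr_ge0 ltW.
move=> x; have q0 := qf_gt0 x0 delta0 x.
rewrite /quad; apply: le_trans (ler_normD _ _) _; rewrite [leRHS]mulrDl; apply: lerD; last first.
  rewrite -mulrA ler_peMr// /d2 mulrC ler_pdivlMr ?exprn_gt0// mul1r; exact: qf_ge.
apply: le_trans (ler_normD _ _) _; rewrite [leRHS]mulrDl; apply: lerD.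
  rewrite normrM ler_wpM2l// ger0_norm ?sumsq_ge0// qfE lerDl sqr_ge0//.
rewrite normrM ger0_norm// -!mulrA ler_wpM2l// mulr_suml.
apply: le_trans (ler_norm_sum _ _ _) _; apply: ler_sum => i _.
rewrite normrM ler_wpM2l//.
have h1 := coord_le_sqrt x i; have h2 := delta_le_sqrt x.
have h3 : qf x `^ 2^-1 * qf x `^ 2^-1 = qf x.
  by rewrite -powRD ?(gt_eqF q0) ?implybT// -[RHS]powRr1 ?(ltW q0)//; congr (_ `^ _); field.
by rewrite mulrC ler_pdivlMr// -[leRHS]h3 ler_pM// ltW.
Qed.

Lemma symbol_bound e m : symbol e m ->
  exists2 C, 0 <= C & forall x, `|eval x0 e x| <= C * qf x `^ m.
Proof.
elim=> {e m} /=.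
- by move=> m; exists 0 => // x; rewrite normr0 mul0r.
- by move=> c; exists `|c| => // x; rewrite powRr0 mulr1.
- by move=> j; exists 1 => // x; rewrite mul1r; exact: coord_le_sqrt.
- move=> A B C; have [D D0 HD] := quad_bound A B C; exists D => // x.
  by rewrite powRr1 ?HD// ltW// qf_gt0.
- move=> a b m _ [C1 C10 H1] _ [C2 C20 H2]; exists (C1 + C2) => [|x]; first exact: addr_ge0.
  by rewrite mulrDl (le_trans (ler_normD _ _))// lerD.
- move=> a b m m' _ [C1 C10 H1] _ [C2 C20 H2]; exists (C1 * C2) => [|x]; first exact: mulr_ge0.
  rewrite powRD ?(gt_eqF (qf_gt0 x0 delta0 x)) ?implybT// mulrACA normrM.
  exact: ler_pM.
- move=> A B C r c c0 H.
  have [D D0 HD] := quad_bound A B C.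
  (* The upper bound D q serves for r >= 0 and the lower bound c q for r < 0; the sum covers
     both. *)
  exists (c `^ r + D `^ r) => [|x]; first by rewrite addr_ge0 ?powR_ge0.
  have q0 := qf_gt0 x0 delta0 x.
  have Q1 := H x; have Q2 := le_trans (ler_norm _) (HD x).
  have Q0 : 0 < quad x0 A B C x by apply: lt_le_trans Q1; rewrite mulr_gt0.
  rewrite ger0_norm ?powR_ge0// mulrDl -!powRM ?(ltW c0) ?(ltW q0)//.
  have D0' : 0 < D by have := lt_le_trans Q0 Q2; rewrite pmulr_lgt0.
  have [r0|r0] := leP 0 r.
    apply: (@le_trans _ _ ((D * qf x) `^ r)); last by rewrite lerDr powR_ge0.
    by apply: ge0_ler_powR => //; rewrite nnegrE ltW// mulr_gt0.
  apply: (@le_trans _ _ ((c * qf x) `^ r)); last by rewrite lerDl powR_ge0.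
  rewrite -[r]opprK !(powRN _ (- r)) lef_pV2 ?posrE ?powR_gt0 ?mulr_gt0//.
  by apply: ge0_ler_powR; rewrite ?nnegrE ?oppr_ge0 ?(ltW r0) ?(ltW Q0) ?mulr_ge0 ?(ltW c0) ?(ltW q0).
- move=> a m m' mm' _ [C C0 H]; have [K K0 HK] := qf_powR_le mm'.
  exists (C * K) => [|x]; first exact: mulr_ge0.
  by apply: le_trans (H x) _; rewrite -mulrA ler_wpM2l.
Qed.

End symbols.

Lemma laplacian_eMul {R : realType} {n : nat} (x0 : 'rV[R]_n) (a c : expr) x :
  wf x0 a -> wf x0 c ->
  laplacian (eval x0 (eMul a c)) x =
  eval x0 c x * laplacian (eval x0 a) x +
  \sum_i (2 * (eval x0 (ediff i a) x * eval x0 (ediff i c) x) +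
          eval x0 a x * eval x0 (ediff i (ediff i c)) x).
Proof.
move=> wa wc; have wm : wf x0 (eMul a c) by split.
rewrite !laplacian_eval// mulr_sumr -big_split/=; apply: eq_bigr => i _; ring.
Qed.

(** * Removal of the cutoff *)

Section cutoff_limit.
Context {R : realType} {n : nat}.
Variables (x0 : 'rV[R]_n) (delta : R).
Hypothesis delta0 : 0 < delta.
Hypothesis n3 : (3 <= n)%N.
Implicit Types (x B : 'rV[R]_n) (b s r : R).
Local Notation qf := (qf x0 delta).
Local Notation leb := (@lebesgue_rV R n).
Local Notation k := ((n%:R - 2) / 2).
Local Notation S x := (\sum_i (x - x0) ord0 i ^+ 2).

Lemma symbol_qf_pow (a : R) : symbol x0 delta (ePow (eQuad 1 0 (delta ^+ 2)) a) a.
Proof. by apply: (@symbol_pow _ _ _ _ _ _ _ _ 1) => // x; rewrite mul1r. Qed.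

Lemma symbol_psi s B b : nrm1 B b <= 2^-1 ->
  symbol x0 delta (psi_expr delta s B b) (- k).
Proof.
move=> u; have -> : - k = (s - k) + - s by lra.
apply: symbol_mul; first exact: symbol_qf_pow.
apply: (@symbol_pow _ _ _ _ _ _ _ _ 2^-1); first by rewrite invr_gt0.
move=> x; rewrite -/(Qf x0 delta B b x) Qf_zf// mulrC ler_wpM2l ?(ltW (qf_gt0 _ delta0 _))//.
by have /andP[] := zf_bounds x0 delta0 x u.
Qed.

Lemma symbol_Z B b : symbol x0 delta (Z_expr delta B b) (- k).
Proof.
have -> : - k = (- k - 1) + 1 :> R by lra.
by apply: symbol_mul; [exact: symbol_qf_pow|exact: symbol_quad].
Qed.

Let n0 : 0 < n%:R :> R. Proof. by rewrite ltr0n (leq_trans _ n3). Qed.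
Let n3R : 3 <= n%:R :> R. Proof. by rewrite ler_nat. Qed.

Variables (phi rhs : 'rV[R]_n -> R) (M : R).
Hypothesis mphi : measurable_fun setT phi.
Hypothesis phiM : forall x, `|phi x| <= M.
Hypothesis phi0 : vanishes_at_infinity phi.
Hypothesis weak : forall a, wf x0 a -> test_function (eval x0 a) ->
  \int[leb]_x (phi x * - laplacian (eval x0 a) x) = \int[leb]_x (rhs x * eval x0 a x).

Let M0 : 0 <= M. Proof. by apply: le_trans (phiM 0). Qed.

Lemma phi_small (eta : R) : 0 < eta -> exists K : nat, forall k x, (K <= k)%N ->
  k.+1%:R ^+ 2 <= S x -> `|phi x| <= eta.
Proof.
move=> eta0; have [r Hr] := phi0 eta0.
(* Since |x - x0|^2 <= 2 (|x|^2 + |x0|^2), the condition |x - x0|^2 > T forces |x| > r. *)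
pose T := 2 * (r ^+ 2 + \sum_i x0 ord0 i ^+ 2).
exists (Num.truncn T) => j x Kj jS; apply: ltW; apply: Hr.
have Tj : T < S x.
  apply: lt_le_trans (truncnS_gt T) _; apply: le_trans jS.
  apply: (@le_trans _ _ (j.+1%:R)); first by rewrite ler_nat.
  by rewrite expr2 ler_peMr// ler1n.
have Sx : S x <= 2 * (\sum_i x ord0 i ^+ 2 + \sum_i x0 ord0 i ^+ 2).
  rewrite -big_split/= mulr_sumr; apply: ler_sum => i _; rewrite !mxE.
  have := sqr_ge0 (x ord0 i + x0 ord0 i); nra.
have h : r ^+ 2 < \sum_i x ord0 i ^+ 2 by rewrite /T in Tj; lra.
apply: le_lt_trans (ler_norm r) _; rewrite -sqrtr_sqr ltr_sqrt//.
exact: le_lt_trans (sqr_ge0 r) h.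
Qed.

Lemma integral_box_shift r : 0 <= r ->
  (\int[leb]_x (\1_(@box R n r) (x - x0))%:E = ((2 * r) ^+ n)%:E)%E.
Proof.
move=> r0; have mb := @measurable_box R n r.
transitivity (\int[leb]_x (\1_(@box R n r) x)%:E)%E; last first.
  by rewrite integral_indic// setIT/= lebesgue_rV_box.
rewrite -[RHS](ge0_integral_rV_affine (- x0) ltr01)//; last first.
  by apply/measurable_EFinP/measurable_indicP; exact: mb.
by rewrite expr1n mul1e; apply: eq_integral => x _; rewrite scale1r.
Qed.

Variables (s b : R) (B : 'rV[R]_n).
Hypothesis u : nrm1 B b <= 2^-1.
Let pe := psi_expr delta s B b.
Let psi := eval x0 pe.
Let wpe : wf x0 pe := wf_psi x0 delta0 s u.
Hypothesis irhs : leb.-integrable setT (EFin \o (fun x => rhs x * psi x)).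

(** At this scale [chi j] is 1 for |x - x0| <= j + 1 and 0 for |x - x0|^2 >= 2 (j + 1)^2. The
    function [err j] collects the Leibniz terms 2 grad psi . grad chi + psi Delta chi. *)
Let rr (j : nat) : R := (j.+1%:R ^+ 2)^-1.
Let chi (j : nat) := eval x0 (cut_expr (rr j)).
Let err (j : nat) x := \sum_i (2 * (eval x0 (ediff i pe) x * eval x0 (ediff i (cut_expr (rr j))) x)
   + psi x * eval x0 (ediff i (ediff i (cut_expr (rr j)))) x).

Let rr0 j : 0 < rr j. Proof. by rewrite invr_gt0 exprn_gt0. Qed.

Let lapE j x : laplacian (eval x0 (eMul pe (cut_expr (rr j)))) x =
  chi j x * laplacian psi x + err j x.
Proof.
exact: laplacian_eMul.
Qed.

(** At distance about r = j + 1 from x0, psi is of size r^(2-n), each derivative costs a factor 1/r,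
    and two of them fall on the product: in all r^(-n) on a region of volume of order r^n. The L^1
    norm of [err j] is therefore only bounded; the second clause, vanishing inside the ball, is what
    allows the smallness of phi to be used. *)
Let err_bound : exists2 C, 0 <= C & forall j x,
  `|err j x| <= C * (j.+1%:R ^+ n)^-1 * \1_(@box R n (2 * j.+1%:R)) (x - x0) /\
  (S x < j.+1%:R ^+ 2 -> err j x = 0).
Proof.
have [C C0 HC] := cut_bounds x0.
have [C1 C10 H1] := symbol_bound delta0 (symbol_psi s u).
have [C2 C20 H2] : exists2 C2, 0 <= C2 & forall i x, `|eval x0 (ediff i pe) x| <= C2 * qf x `^ (- k - 2^-1).
  have H i := symbol_bound delta0 (symbol_ediff i (symbol_psi s u)).
  pose F i := sval (cid2 (H i)).
  have F0 i : 0 <= F i by rewrite /F; case: cid2.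
  exists (\sum_i F i); first by rewrite sumr_ge0.
  move=> i x; apply: (@le_trans _ _ (F i * qf x `^ (- k - 2^-1))).
    by rewrite /F; case: cid2 => Ci /= _; exact.
  by rewrite ler_wpM2r ?powR_ge0// (bigD1 i)//= lerDl sumr_ge0.
pose D := (2 * (C2 * C) + C1 * C) * n%:R.
have D0 : 0 <= D by rewrite mulr_ge0 ?addr_ge0 ?mulr_ge0.
exists D => // j x.
have q0 := qf_gt0 x0 delta0 x.
have out : rr j * S x <= 1 \/ 2 <= rr j * S x -> err j x = 0.
  move=> h; rewrite /err big1// => i _.
  by have [-> ->] := cut_diff_out i h; rewrite !mulr0 addr0.
split; last first.
  move=> h; apply: out; left; rewrite /rr mulrC ler_pdivrMr ?exprn_gt0// mul1r.
  exact: ltW.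
have [h|h] := leP (rr j * S x) 1.
  rewrite out ?normr0; last by left.
  by rewrite mulr_ge0 ?indicE ?ler0n// mulr_ge0// invr_ge0 exprn_ge0.
have [h'|h'] := leP 2 (rr j * S x).
  rewrite out ?normr0; last by right.
  by rewrite mulr_ge0 ?indicE ?ler0n// mulr_ge0// invr_ge0 exprn_ge0.
have inb : (x - x0) \in @box R n (2 * j.+1%:R).
  rewrite inE => i; rewrite -ler_sqr ?nnegrE// real_normK ?num_real//.
  apply: (@le_trans _ _ (S x)).
    by rewrite (bigD1 i)//= lerDl sumr_ge0// => l _; exact: sqr_ge0.
  move: h'; rewrite /rr mulrC ltr_pdivrMr ?exprn_gt0// => h'.
  rewrite exprMn; have := sqr_ge0 (j.+1%:R : R); lra.
rewrite indicE inb mulr1.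
have term i : `|2 * (eval x0 (ediff i pe) x * eval x0 (ediff i (cut_expr (rr j))) x)
   + psi x * eval x0 (ediff i (ediff i (cut_expr (rr j)))) x| <=
   (2 * (C2 * C) + C1 * C) * (rr j * qf x `^ (- k)).
  have [c1 c2] := HC (rr j) i x (rr0 j).
  apply: le_trans (ler_normD _ _) _; rewrite [leRHS]mulrDl; apply: lerD.
    rewrite normrM ger0_norm// -!mulrA ler_wpM2l// normrM.
    apply: (@le_trans _ _ ((C2 * qf x `^ (- k - 2^-1)) * (C * (rr j * qf x `^ 2^-1)))).
      apply: ler_pM => //; apply: le_trans c1 _; rewrite ler_wpM2l//.
      by rewrite ler_wpM2l ?(ltW (rr0 j))// coord_le_sqrt.
    have -> : qf x `^ (- k) = qf x `^ (- k - 2^-1) * qf x `^ 2^-1.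
      by rewrite -powRD ?(gt_eqF q0) ?implybT// subrK.
    by rewrite le_eqVlt; apply/orP; left; apply/eqP; ring.
  rewrite normrM; apply: (@le_trans _ _ ((C1 * qf x `^ (- k)) * (C * rr j))).
    by apply: ler_pM => //; exact: H1.
  by rewrite le_eqVlt; apply/orP; left; apply/eqP; ring.
apply: le_trans (ler_norm_sum _ _ _) _.
apply: (@le_trans _ _ (\sum_(i < n) (2 * (C2 * C) + C1 * C) * (rr j * qf x `^ (- k)))).
  by apply: ler_sum => i _; exact: term.
rewrite sumr_const card_ord -[_ *+ n]mulr_natr.
rewrite (_ : _ * n%:R = D * (rr j * qf x `^ (- k))); last by rewrite /D; ring.
rewrite ler_wpM2l//.
have Sq : j.+1%:R ^+ 2 <= qf x.
  rewrite /rr mulrC ltr_pdivlMr ?exprn_gt0// mul1r in h.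
  by rewrite qfE; have := sqr_ge0 delta; lra.
have J0 : 0 < j.+1%:R :> R by [].
have J20 : 0 < j.+1%:R ^+ 2 :> R by rewrite exprn_gt0.
(* Both factors are powers of (j + 1)^2, with exponents -1 and -k, and 1 + k = n/2. *)
apply: (@le_trans _ _ (rr j * (j.+1%:R ^+ 2) `^ (- k))).
  rewrite ler_wpM2l ?(ltW (rr0 j))// !powRN lef_pV2 ?posrE ?powR_gt0//.
  apply: ge0_ler_powR => //; rewrite ?nnegrE ?(ltW J20) ?(ltW q0)//.
  by have := n3R; lra.
have -> : rr j = (j.+1%:R ^+ 2) `^ (- 1) by rewrite powR_inv1 ?(ltW J20).
rewrite -powRD ?(gt_eqF J20) ?implybT//.
rewrite -[X in X `^ _]powR_mulrn ?(ltW J0)// -powRrM -powR_mulrn ?(ltW J0)// -powRN.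
by rewrite le_eqVlt; apply/orP; left; apply/eqP; congr (_ `^ _); field.
Qed.

Let mchi j : measurable_fun setT (chi j). Proof. exact: measurable_eval. Qed.

Let chi1 j x : `|chi j x| <= 1.
Proof. by have /andP[? ?] := cut_ge0_le1 x0 (rr j) x; rewrite ger0_norm. Qed.

Let chi_cvg x : chi j x @[j --> \oo] --> (1 : R).
Proof.
apply: cvg_near_cst; near=> j; apply: cut_eq1.
rewrite /rr mulrC ler_pdivrMr ?exprn_gt0// mul1r.
apply: (@le_trans _ _ (j.+1%:R)); last by rewrite expr2 ler_peMr// ler1n.
apply: (le_trans (ltW (truncnS_gt _))); rewrite ler_nat ltnS.
by near: j; exact: nbhs_infty_ge.
Unshelve. all: by end_near. Qed.

Let cut_cvg (f : 'rV[R]_n -> R) : leb.-integrable setT (EFin \o f) ->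
  \int[leb]_x (f x * chi j x) @[j --> \oo] --> \int[leb]_x f x.
Proof.
move=> If; have mf : measurable_fun setT f by apply/measurable_EFinP; exact: (measurable_int leb If).
have mfc j : measurable_fun setT (EFin \o (fun x => f x * chi j x)).
  by apply/measurable_EFinP; exact: measurable_funM.
have C1 : {ae leb, forall x, setT x -> (f x * chi j x)%:E @[j --> \oo] --> (f x)%:E}.
  apply: aeW => x _; apply/cvg_EFin; first exact: nearW.
  rewrite -[X in _ --> X]mulr1; apply: cvgM; first exact: cvg_cst.
  exact: chi_cvg.
have C2 : {ae leb, forall x j, setT x -> (`|(f x * chi j x)%:E| <= `|f x|%:E)%E}.
  by apply: aeW => x j _; rewrite /= lee_fin normrM ler_piMr.
have [_ _ L] := dominated_convergence measurableT mfc (measurable_int leb If) C1 (integrable_norm If) C2.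
apply: (@fine_cvg _ _ _ _ (fun j => (\int[leb]_x (f x * chi j x)%:E)%E)).
by rewrite fineK//; exact: (integrable_fin_num measurableT If).
Qed.

Let lap_bound : exists C, forall x, `|laplacian psi x| <= C * qf x `^ (- ((n%:R + 2) / 2)).
Proof.
have z1 x := zf_bounds x0 delta0 x u.
have H sg : exists2 C, 0 <= C & forall x, `|zf x0 delta B b x `^ (- sg)| <= C.
  have [C C0 HC] := taylor_powR1D 0 sg; exists C => // x.
  have := HC (hf x0 delta B b x) (le_trans (hf_le x0 delta0 B b x) u).
  by rewrite big_ord0 subr0 expr0 mulr1.
have [C1 C10 H1] := H s; have [C2 C20 H2] := H (s + 2); have [C3 C30 H3] := H (s + 1).
set c1 := (s - k) * (s - k - 1); set c2 := s * (s + 1) * (1 - nrm2 B b); set c3 := 2 * (s - k) * s.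
exists (4 * delta ^+ 2 * (`|c1| * C1 + `|c2| * C2 + `|c3| * C3)) => x.
rewrite laplacian_psi// normrN -/c1 -/c2 -/c3 normrM.
have d2 : 0 <= 4 * delta ^+ 2 by rewrite mulr_ge0 ?sqr_ge0.
set q := qf x `^ _.
have q0 : 0 <= 4 * delta ^+ 2 * q by apply: mulr_ge0 => //; exact: powR_ge0.
rewrite (ger0_norm q0); set T := (X in _ <= 4 * _ * X * _).
rewrite (_ : 4 * delta ^+ 2 * T * q = 4 * delta ^+ 2 * q * T); last by ring.
rewrite ler_wpM2l// /T.
apply: le_trans (ler_normB _ _) _; apply: lerD; last by rewrite normrM ler_wpM2l.
by apply: le_trans (ler_normD _ _) _; apply: lerD; rewrite normrM ler_wpM2l.
Qed.

Let mlap : measurable_fun setT (laplacian psi).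
Proof.
have -> : laplacian psi = (fun x => \sum_j eval x0 (ediff j (ediff j pe)) x).
  by apply/funext => x; rewrite laplacian_eval.
by apply: measurable_sum => j; exact: measurable_eval.
Qed.

Let i_lap : leb.-integrable setT (EFin \o (fun x => phi x * - laplacian psi x)).
Proof.
have [C HC] := lap_bound.
apply: (@integrable_le_qf _ _ x0 delta delta0 _ (M * C) ((n%:R + 2) / 2)).
- lra.
- by apply: measurable_funM => //; exact: measurable_funN.
- by move=> x; rewrite normrM normrN -mulrA; apply: ler_pM.
Qed.

Let merr j : measurable_fun setT (err j).
Proof.
apply: measurable_sum => i; apply: measurable_funD.
  by apply: measurable_funM => //; apply: measurable_funM; exact: measurable_eval.
by apply: measurable_funM; exact: measurable_eval.
Qed.

(** The cube has side 4 (j + 1), so its volume cancels (j + 1)^(-n) up to 4^n. The parameter [eta]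
    bounds |phi| where [err j] lives: it is M for integrability and arbitrarily small for the
    limit. *)
Let phi_err (eta C : R) j : 0 <= eta -> 0 <= C ->
  (forall x, `|phi x * err j x| <= eta * (C * (j.+1%:R ^+ n)^-1 * \1_(@box R n (2 * j.+1%:R)) (x - x0))) ->
  leb.-integrable setT (EFin \o (fun x => phi x * err j x)) /\
  `|\int[leb]_x (phi x * err j x)| <= eta * C * 4 ^+ n.
Proof.
move=> eta0 C0 H.
have mpe : measurable_fun setT (fun x => phi x * err j x) by exact: measurable_funM.
have J0 : 0 < j.+1%:R :> R by [].
have mb : measurable_fun setT (fun x : 'rV[R]_n => \1_(@box R n (2 * j.+1%:R)) (x - x0) : R).
  have ms : measurable_fun setT (fun x : 'rV[R]_n => x - x0).
    have := measurable_affine_rV 1 (- x0 : 'rV[R]_n).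
    by under eq_fun do rewrite scale1r.
  have mi : measurable_fun setT (\1_(@box R n (2 * j.+1%:R)) : 'rV[R]_n -> R).
    by apply/measurable_indicP; exact: measurable_box.
  exact: (measurableT_comp mi ms).
have Ib := integral_box_shift (ltW (mulr_gt0 (ltr0n _ 2) J0)).
have ib : leb.-integrable setT (EFin \o (fun x : 'rV[R]_n => \1_(@box R n (2 * j.+1%:R)) (x - x0) : R)).
  apply/integrableP; split; first exact/measurable_EFinP.
  under eq_integral do rewrite /= ger0_norm ?indicE ?ler0n// -indicE.
  by rewrite Ib ltry.
have i1 := integrableZ_EFin (eta * (C * (j.+1%:R ^+ n)^-1)) ib.
have ipe : leb.-integrable setT (EFin \o (fun x => phi x * err j x)).
  apply: (@le_integrable _ _ _ _ _ measurableT _ _ _ _ i1); first exact/measurable_EFinP.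
  move=> x _; rewrite /= lee_fin; apply: le_trans (H x) _.
  by rewrite mulrA; exact: ler_norm.
split=> //; apply: le_trans (le_normr_Rintegral measurableT ipe) _.
apply: (@le_trans _ _ (\int[leb]_x ((eta * (C * (j.+1%:R ^+ n)^-1)) * (\1_(@box R n (2 * j.+1%:R)) (x - x0) : R)))).
  apply: le_Rintegral => //; first exact: integrable_norm.
  by move=> x _; rewrite -mulrA; exact: H.
rewrite RintegralZl// {1}/Rintegral Ib /=.
rewrite (_ : 2 * (2 * _) = 4 * j.+1%:R); last by ring.
rewrite exprMn le_eqVlt; apply/orP; left; apply/eqP.
by field; rewrite expf_neq0// pnatr_eq0.
Qed.

(** The equation is tested with psi [chi j], which has compact support. The main terms converge by
    dominated convergence; the pairing of phi with [err j] tends to 0 because phi is uniformly small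
    where [err j] is not 0. *)
Lemma weak_equation_psi :
  \int[leb]_x (phi x * - laplacian psi x) = \int[leb]_x (rhs x * psi x).
Proof.
have [C C0 HC] := err_bound.
have R0 : \int[leb]_x (phi x * err j x) @[j --> \oo] --> (0 : R).
  apply/cvgrPdist_le => e e0.
  pose eta := e / (C * 4 ^+ n + 1).
  have D0 : 0 < C * 4 ^+ n + 1 by rewrite ltr_wpDl// mulr_ge0// exprn_ge0.
  have eta0 : 0 < eta by rewrite divr_gt0.
  have [K HK] := phi_small eta0.
  near=> j; rewrite sub0r normrN.
  have Kj : (K <= j)%N by near: j; exact: nbhs_infty_ge.
  have [_ h] : leb.-integrable setT (EFin \o (fun x => phi x * err j x)) /\
    `|\int[leb]_x (phi x * err j x)| <= eta * C * 4 ^+ n.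
    apply: phi_err => //; first exact: ltW.
    move=> x; have [h1 h2] := HC j x.
    have [h|h] := leP (j.+1%:R ^+ 2) (S x); last first.
      rewrite h2// mulr0 normr0 mulr_ge0 ?(ltW eta0)// mulr_ge0 ?indicE ?ler0n//.
      by rewrite mulr_ge0// invr_ge0 exprn_ge0.
    rewrite normrM; apply: ler_pM => //; exact: HK h.
  apply: le_trans h _; rewrite -mulrA /eta mulrAC ler_pdivrMr//.
  by rewrite ler_wpM2l ?(ltW e0)// lerDl.
have ierr j : leb.-integrable setT (EFin \o (fun x => phi x * err j x)).
  apply: (phi_err (eta := M) (C := C) _ _ _).1 => // x.
  by rewrite normrM; apply: ler_pM => //; have [] := HC j x.
have E j : \int[leb]_x ((phi x * - laplacian psi x) * chi j x) - \int[leb]_x (phi x * err j x) =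
   \int[leb]_x (rhs x * psi x * chi j x).
  have tf := test_function_cut (rr0 j) wpe.
  have wm : wf x0 (eMul pe (cut_expr (rr j))) by split.
  have := weak wm tf => W.
  rewrite -RintegralB//; last first.
    exact: (integrable_bounded_mul (M := 1)).
  transitivity (\int[leb]_x (phi x * - laplacian (eval x0 (eMul pe (cut_expr (rr j)))) x)).
    by apply: eq_Rintegral => x _; rewrite lapE; ring.
  by rewrite W; apply: eq_Rintegral => x _; rewrite /= mulrA.
have L1 := cvgB (cut_cvg i_lap) R0.
have L2 := cut_cvg irhs.
have EE : (fun j => \int[leb]_x ((phi x * - laplacian psi x) * chi j x)) - (fun j => \int[leb]_x (phi x * err j x)) =
   (fun j => \int[leb]_x (rhs x * psi x * chi j x)) by apply/funext => j; exact: E.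
rewrite EE subr0 in L1.
have L1F : \int[leb]_x (rhs x * psi x * chi j x) @[j --> \oo] -->
    \int[leb]_x (phi x * - laplacian psi x) by exact: L1.
by rewrite -(cvg_lim (@norm_hausdorff _ _) L1F) (cvg_lim (@norm_hausdorff _ _) L2).
Unshelve. all: by end_near. Qed.

End cutoff_limit.

(** * The moment relation *)

Section relation.
Context {R : realType} {n : nat}.
Variables (x0 : 'rV[R]_n) (delta lam kappa p : R).
Hypothesis delta0 : 0 < delta.
Hypothesis n3 : (3 <= n)%N.
Hypothesis lam0 : 0 < lam.
Hypothesis lamn : lam < n%:R.
Hypothesis kappa0 : 0 < kappa.
Implicit Types (x y B : 'rV[R]_n) (b : R).
Local Notation qf := (qf x0 delta).
Local Notation hf := (hf x0 delta).
Local Notation zf := (zf x0 delta).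
Local Notation Qf := (Qf x0 delta).
Local Notation leb := (@lebesgue_rV R n).
Local Notation k := ((n%:R - 2) / 2).
Local Notation s := (n%:R - lam / 2).
Local Notation e := (n%:R - lam / 2 - (n%:R - 2) / 2).
Hypothesis riesz_qf : forall x,
  (\int[leb]_y (riesz_kernel lam (x - y) * qf y `^ (- s))%:E =
   (kappa * qf x `^ (- (lam / 2)))%:E)%E.

Let n3R : 3 <= n%:R :> R. Proof. by rewrite ler_nat. Qed.

(** As -(n+2)/2 = k - n, the weight makes this the integral of q^k phi times (1 + h_u)^(-sg) against
    q^(-n) dx, which is the surface measure of the sphere up to a constant. *)
Definition zmoment (phi : 'rV[R]_n -> R) (sg : R) B b : R :=
  \int[leb]_x (phi x * qf x `^ (- ((n%:R + 2) / 2)) * zf B b x `^ (- sg)).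

(* The linearized equation tested against qf^-k zf^-s, written with the moments
   of phi: the left-hand side comes from the Laplacian, the right-hand side from
   the Riesz potential of the powers of a quadratic polynomial. *)
Definition moment_relation (phi : 'rV[R]_n -> R) : Prop :=
  forall B b, nrm1 B b <= 2^-1 ->
  4 * (e * (e - 1) * zmoment phi s B b
       + s * (s + 1) * (1 - nrm2 B b) * zmoment phi (s + 2) B b
       - 2 * e * s * zmoment phi (s + 1) B b) =
  n%:R * (n%:R - 2) *
    (p * (1 - nrm2 B b) `^ (- ((n%:R - lam) / 2)) * zmoment phi (lam / 2) B b
     + (p - 1) * zmoment phi s B b).

Lemma measurable_zf_powR B b m : measurable_fun setT (fun x => zf B b x `^ m).
Proof.
apply: (measurableT_comp (@measurable_powR R m)).
by apply: measurable_funD => //; exact: measurable_hf.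
Qed.

Lemma zf_powR_bounded (m : R) B b : nrm1 B b <= 2^-1 ->
  exists2 C, 0 <= C & forall x, `|zf B b x `^ m| <= C.
Proof.
move=> u; have [C C0 HC] := taylor_powR1D 0 (- m); exists C => // x.
have := HC (hf B b x) (le_trans (hf_le x0 delta0 B b x) u).
by rewrite big_ord0 subr0 expr0 mulr1 opprK.
Qed.

Section bounded_function.
Variables (phi : 'rV[R]_n -> R) (M : R).
Hypothesis mphi : measurable_fun setT phi.
Hypothesis phiM : forall x, `|phi x| <= M.

Lemma integrable_weighted :
  leb.-integrable setT (EFin \o (fun x => phi x * qf x `^ (- ((n%:R + 2) / 2)))).
Proof.
apply: (@integrable_le_qf _ _ x0 delta delta0 _ M ((n%:R + 2) / 2)).
- by have := n3R; lra.
- by apply: measurable_funM => //; exact: measurable_qf_powR.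
- by move=> x; rewrite normrM [`|qf x `^ _|]ger0_norm ?powR_ge0// ler_wpM2r ?powR_ge0.
Qed.

Lemma integrable_zmoment sg B b : nrm1 B b <= 2^-1 ->
  leb.-integrable setT (EFin \o
    (fun x => phi x * qf x `^ (- ((n%:R + 2) / 2)) * zf B b x `^ (- sg))).
Proof.
move=> u; have [C C0 HC] := zf_powR_bounded (- sg) u.
exact: (integrable_bounded_mul integrable_weighted (measurable_zf_powR _ _ _) HC).
Qed.

Variables (b : R) (B : 'rV[R]_n).
Hypothesis u : nrm1 B b <= 2^-1.
Let psi := eval x0 (psi_expr delta s B b).

Let f x := psi x * qf x `^ (- e).
Let g x := qf x `^ (- e) * phi x.

(** The two exponents of q add up, k + e = s; this is the identity that dictates the exponent of the
    test function. *)
Let fE x : f x = Qf B b x `^ (- s).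
Proof.
have q0 := qf_gt0 x0 delta0 x.
rewrite /f /psi eval_psi// Qf_zf// powRM ?(ltW q0) ?(ltW (zf_gt0 x0 delta0 x u))//.
rewrite mulrAC -powRD ?(gt_eqF q0) ?implybT//; congr (_ `^ _ * _); ring.
Qed.

Let mf : measurable_fun setT f.
Proof. by apply: measurable_funM; [exact: measurable_eval|exact: measurable_qf_powR]. Qed.

Let mg : measurable_fun setT g.
Proof. by apply: measurable_funM => //; exact: measurable_qf_powR. Qed.

Let f_le : exists C, forall x, `|f x| <= C * qf x `^ (- s).
Proof.
have [C C0 HC] := zf_powR_bounded (- s) u; exists C => x.
have q0 := qf_gt0 x0 delta0 x.
rewrite fE Qf_zf// powRM ?(ltW q0) ?(ltW (zf_gt0 x0 delta0 x u))//.
by rewrite normrM [`|qf x `^ _|]ger0_norm ?powR_ge0// mulrC ler_wpM2r ?powR_ge0.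
Qed.

Let g_le x : `|g x| <= M * qf x `^ (- e).
Proof. by rewrite /g normrM mulrC [`|qf x `^ _|]ger0_norm ?powR_ge0// ler_wpM2r ?powR_ge0. Qed.

Let elam : n%:R / 2 < e + lam / 2.
Proof. lra. Qed.

Lemma integrable_riesz_pairing :
  leb.-integrable setT (EFin \o (fun x => psi x * qf x `^ (- e) *
    convolution (riesz_kernel lam) (fun y => qf y `^ (- e) * phi y) x)).
Proof.
have [C HC] := f_le.
exact: (@integrable_mul_convolution _ _ x0 delta delta0 lam kappa s riesz_qf f g C M e mf mg HC g_le elam).
Qed.

(** By symmetry the potential is moved from phi, about which nothing is known, to a power of
    [Qf B b], for which [riesz_Qf] evaluates it. *)
Lemma riesz_pairing :
  \int[leb]_x (psi x * qf x `^ (- e) *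
    convolution (riesz_kernel lam) (fun y => qf y `^ (- e) * phi y) x) =
  kappa * (1 - nrm2 B b) `^ (- ((n%:R - lam) / 2)) * zmoment phi (lam / 2) B b.
Proof.
have [C HC] := f_le.
have := @mul_convolution_symm _ _ x0 delta delta0 lam kappa s riesz_qf f g C M e mf mg HC g_le elam.
rewrite /f /g => ->.
rewrite -RintegralZl//; last exact: integrable_zmoment.
apply: eq_Rintegral => y _.
have -> : convolution (riesz_kernel lam) (fun x => psi x * qf x `^ (- e)) y =
   kappa * (1 - nrm2 B b) `^ (- ((n%:R - lam) / 2)) * Qf B b y `^ (- (lam / 2)).
  have H := riesz_Qf delta0 riesz_qf y u.
  transitivity (fine (\int[leb]_z (riesz_kernel lam (y - z) * Qf B b z `^ (- s))%:E)%E).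
    by congr fine; apply: eq_integral => z _; rewrite -/(f z) fE.
  by rewrite H.
have q0 := qf_gt0 x0 delta0 y.
rewrite Qf_zf// powRM ?(ltW q0) ?(ltW (zf_gt0 x0 delta0 y u))//.
have -> : qf y `^ (- ((n%:R + 2) / 2)) = qf y `^ (- e) * qf y `^ (- (lam / 2)).
  by rewrite -powRD ?(gt_eqF q0) ?implybT//; congr (_ `^ _); field.
by ring.
Qed.

Lemma integral_laplacian_psi :
  \int[leb]_x (phi x * - laplacian psi x) =
  4 * delta ^+ 2 * (e * (e - 1) * zmoment phi s B b
       + s * (s + 1) * (1 - nrm2 B b) * zmoment phi (s + 2) B b
       - 2 * e * s * zmoment phi (s + 1) B b).
Proof.
have i1 := integrable_zmoment s u; have i2 := integrable_zmoment (s + 2) u.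
have i3 := integrable_zmoment (s + 1) u.
have j1 := integrableZ_EFin (e * (e - 1)) i1.
have j2 := integrableZ_EFin (s * (s + 1) * (1 - nrm2 B b)) i2.
have j3 := integrableZ_EFin (2 * e * s) i3.
have j12 := integrableD measurableT j1 j2.
have j123 := integrableB measurableT j12 j3.
rewrite /zmoment -!RintegralZl// -RintegralD// -RintegralB// -RintegralZl//.
apply: eq_Rintegral => x _; rewrite laplacian_psi// opprK; ring.
Qed.

End bounded_function.

(** The linearized right-hand side at a bubble after elimination of c and of the Hartree constant
    (see [linearized_rhs_bubble]). In the local term kappa cancels, and the powers of q combine to
    q^(-2). *)
Definition reduced_rhs (phi : 'rV[R]_n -> R) x : R :=
  n%:R * (n%:R - 2) * delta ^+ 2 *
  (p / kappa * (qf x `^ (- e) *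
     convolution (riesz_kernel lam) (fun y => qf y `^ (- e) * phi y) x)
   + (p - 1) * qf x `^ (- 2) * phi x).

Lemma moment_relation_solution (phi : 'rV[R]_n -> R) (M : R) :
  measurable_fun setT phi -> (forall x, `|phi x| <= M) ->
  vanishes_at_infinity phi ->
  (forall a, wf x0 a -> test_function (eval x0 a) ->
    \int[leb]_x (phi x * - laplacian (eval x0 a) x) =
    \int[leb]_x (reduced_rhs phi x * eval x0 a x)) ->
  moment_relation phi.
Proof.
move=> mphi phiM phi0 weak B b u.
pose psi := eval x0 (psi_expr delta s B b).
have j1 := integrableZ_EFin (n%:R * (n%:R - 2) * delta ^+ 2 * (p / kappa)) (integrable_riesz_pairing mphi phiM u).
have j2 := integrableZ_EFin (n%:R * (n%:R - 2) * delta ^+ 2 * (p - 1)) (integrable_zmoment mphi phiM s u).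
have E : (fun x => reduced_rhs phi x * psi x) =
  (fun x => n%:R * (n%:R - 2) * delta ^+ 2 * (p / kappa) * (psi x * qf x `^ (- e) *
    convolution (riesz_kernel lam) (fun y => qf y `^ (- e) * phi y) x) +
   n%:R * (n%:R - 2) * delta ^+ 2 * (p - 1) *
    (phi x * qf x `^ (- ((n%:R + 2) / 2)) * zf B b x `^ (- s))).
  apply/funext => x; rewrite /reduced_rhs /psi.
  have q0 := qf_gt0 x0 delta0 x.
  rewrite [in X in _ = _ + X](_ : qf x `^ (- ((n%:R + 2) / 2)) = qf x `^ (- 2) * qf x `^ (- k)).
    by rewrite (eval_psi x0 delta0 s x u); ring.
  by rewrite -powRD ?(gt_eqF q0) ?implybT//; congr (_ `^ _); field.
have irhs : leb.-integrable setT (EFin \o (fun x => reduced_rhs phi x * psi x)).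
  by rewrite E; exact: (integrableD measurableT j1 j2).
have := weak_equation_psi delta0 n3 mphi phiM phi0 weak u irhs.
rewrite (integral_laplacian_psi mphi phiM u) E RintegralD//.
rewrite RintegralZl//; last exact: (integrable_riesz_pairing mphi phiM u).
rewrite RintegralZl//; last exact: (integrable_zmoment mphi phiM s u).
rewrite (riesz_pairing mphi phiM u) -/(zmoment phi s B b) => H.
have d2 : delta ^+ 2 != 0 by rewrite expf_neq0// gt_eqF.
apply: (mulfI d2).
transitivity (4 * delta ^+ 2 *
      (e * (e - 1) * zmoment phi s B b +
       s * (s + 1) * (1 - nrm2 B b) * zmoment phi (s + 2) B b -
       2 * e * s * zmoment phi (s + 1) B b)); first by ring.
by rewrite H; field; rewrite gt_eqF.
Qed.

End relation.

Section finite_sums.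
Context d (T : measurableType d) {R : realType} (mu : {measure set T -> \bar R}).

Lemma Rintegral_finite_sum (I : Type) (r : seq I) (f : I -> T -> R) :
  (forall i, mu.-integrable setT (EFin \o f i)) ->
  mu.-integrable setT (EFin \o (fun x => \sum_(i <- r) f i x)) /\
  \int[mu]_x (\sum_(i <- r) f i x) = \sum_(i <- r) \int[mu]_x f i x.
Proof.
move=> fi; elim: r => [|i r [IH1 IH2]].
  split; last first.
    by rewrite big_nil; under eq_Rintegral do rewrite big_nil; rewrite Rintegral_cst ?mul0r.
  under [X in integrable _ _ (_ \o X)]eq_fun do rewrite big_nil.
  exact: integrable0.
have E : (fun x => \sum_(j <- i :: r) f j x) = (fun x => f i x + \sum_(j <- r) f j x).
  by apply/funext => x; rewrite big_cons.
rewrite E; split; first exact: (integrableD measurableT (fi i) IH1).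
by rewrite RintegralD// IH2 big_cons.
Qed.

End finite_sums.

(** * The zero modes satisfy the moment relation *)

Section zero_modes.
Context {R : realType} {n : nat}.
Variables (x0 : 'rV[R]_n) (delta lam kappa p : R).
Hypothesis delta0 : 0 < delta.
Hypothesis n3 : (3 <= n)%N.
Hypothesis lam0 : 0 < lam.
Hypothesis lamn : lam < n%:R.
Hypothesis kappa0 : 0 < kappa.
Hypothesis pE : p = (2 * n%:R - lam) / (n%:R - 2).
Implicit Types (x y B : 'rV[R]_n) (b : R).
Local Notation qf := (qf x0 delta).
Local Notation hf := (hf x0 delta).
Local Notation zf := (zf x0 delta).
Local Notation leb := (@lebesgue_rV R n).
Local Notation k := ((n%:R - 2) / 2).
Local Notation s := (n%:R - lam / 2).
Local Notation e := (n%:R - lam / 2 - (n%:R - 2) / 2).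
Hypothesis riesz_qf : forall x,
  (\int[leb]_y (riesz_kernel lam (x - y) * qf y `^ (- s))%:E =
   (kappa * qf x `^ (- (lam / 2)))%:E)%E.
Local Notation zmoment := (zmoment x0 delta).

Let n3R : 3 <= n%:R :> R. Proof. by rewrite ler_nat. Qed.

Lemma nrm1_ge0 B b : 0 <= nrm1 B b.
Proof. by rewrite addr_ge0// sumr_ge0. Qed.

(** Since [hf] is homogeneous in (B, b), identities that are homogeneous in it extend from small
    coefficients to all of them. *)
Lemma nrm1_rescale B b : exists2 t : R, 0 < t & nrm1 (t *: B) (t * b) <= 2^-1.
Proof.
have N0 := nrm1_ge0 B b.
have N1 : 0 < nrm1 B b + 1 by rewrite ltr_wpDl.
exists ((nrm1 B b + 1)^-1 / 2); first by rewrite divr_gt0// invr_gt0.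
rewrite nrm1Z; last by rewrite divr_ge0// invr_ge0 ltW.
by rewrite mulrAC ler_piMl ?invr_ge0// mulrC ler_pdivrMr// mul1r lerDl.
Qed.

Lemma convolution_riesz_hf B b x :
  convolution (riesz_kernel lam) (fun y => qf y `^ (- s) * hf B b y) x =
  kappa * (lam / 2 / s) * qf x `^ (- (lam / 2)) * hf B b x.
Proof.
have [t t0 u] := nrm1_rescale B b.
have H := riesz_hf delta0 lam0 lamn riesz_qf x u.
apply: (mulfI (lt0r_neq0 t0)).
transitivity (\int[leb]_y (riesz_kernel lam (x - y) * qf y `^ (- s) * hf (t *: B) (t * b) y)).
  rewrite /convolution -RintegralZl//; last first.
    have iF := integrable_riesz_qf riesz_qf x.
    have := integrable_bounded_mul iF (measurable_hf x0 delta0 B b) (fun y => hf_le x0 delta0 B b y).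
    by apply: eq_integrable => // y _ /=; rewrite mulrA.
  by apply: eq_Rintegral => y _; rewrite hfZ; ring.
by rewrite H hfZ; ring.
Qed.

Lemma bounded_Z B b : exists M : R, forall x, `|eval x0 (Z_expr delta B b) x| <= M.
Proof.
have [|K K0 HK] := @qf_powR_le _ _ x0 delta delta0 (- k) 0; first by have := n3R; lra.
have [C C0 HC] := symbol_bound delta0 (symbol_Z x0 delta B b).
exists (C * K) => x; apply: le_trans (HC x) _; rewrite ler_wpM2l//.
by have := HK x; rewrite powRr0 mulr1.
Qed.

(* The derivative of the bounded function hf B b is this quantity divided by
   qf^2; the terms of degree three cancel. *)
Lemma qf_Pf_wronskian_bound j B b : exists2 C, 0 <= C & forall x,
  `|qf x * (2 * b * (x - x0) ord0 j + 2 * (delta *: B) ord0 j)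
    - Pf x0 delta B b x * (2 * (x - x0) ord0 j)| <= C * qf x.
Proof.
have SB : 0 <= \sum_i `|B ord0 i| by rewrite sumr_ge0.
have d0 := ltW delta0.
exists (2 * delta * `|B ord0 j| + 4 * delta * (`|b| + \sum_i `|B ord0 i|)).
  by rewrite addr_ge0 ?mulr_ge0// addr_ge0.
move=> x; have q0 := qf_gt0 x0 delta0 x.
have h1 := coord_le_sqrt x0 delta0 x; have h2 := delta_le_sqrt x0 delta0 x.
have h3 : qf x `^ 2^-1 * qf x `^ 2^-1 = qf x.
  by rewrite -powRD ?(gt_eqF q0) ?implybT// -[RHS]powRr1 ?(ltW q0)//; congr (_ `^ _); field.
have -> : qf x * (2 * b * (x - x0) ord0 j + 2 * (delta *: B) ord0 j)
    - Pf x0 delta B b x * (2 * (x - x0) ord0 j) =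
  2 * delta * B ord0 j * qf x + (x - x0) ord0 j * (4 * delta * (b * delta - \sum_i B ord0 i * (x - x0) ord0 i)).
  by rewrite PfE qfE [(delta *: B) ord0 j]mxE; ring.
apply: le_trans (ler_normD _ _) _; rewrite [leRHS]mulrDl; apply: lerD.
  by rewrite normrM (gtr0_norm q0) normrM [`|2 * delta|]ger0_norm ?mulr_ge0.
rewrite -[X in _ <= _ * X]h3 [leRHS]mulrA [leRHS]mulrC normrM.
apply: ler_pM => //.
rewrite normrM [`|4 * _|]ger0_norm ?mulr_ge0// -[leRHS]mulrA ler_wpM2l ?mulr_ge0//.
apply: le_trans (ler_normB _ _) _; rewrite mulrDl; apply: lerD.
  by rewrite normrM (ger0_norm d0) ler_wpM2l.
rewrite mulr_suml; apply: le_trans (ler_norm_sum _ _ _) _.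
by apply: ler_sum => i _; rewrite normrM ler_wpM2l.
Qed.

Section wronskian.
Variables (B B' : 'rV[R]_n) (b b' : R).
Hypothesis u : nrm1 B b <= 2^-1.
Let Ze : expr := Z_expr delta B' b'.
Let psie : expr := psi_expr delta s B b.

(** The j-th component of Z grad psi - psi grad Z. By growth orders alone each product is of order
    q^(-(n - 3/2)), which is not integrable when n = 3; the derivatives of the common factor q^(-k)
    cancel in the difference, and [wronskian_bound] gains half a power. *)
Definition wronskian_expr j : expr :=
  eAdd (eMul Ze (ediff j psie)) (eMul (eCst (-1)) (eMul psie (ediff j Ze))).

Let wX j : wf x0 (wronskian_expr j).
Proof.
have wZ := wf_Z x0 delta0 B' b'; have wp := wf_psi x0 delta0 s u.
by split; split => //; [exact: wf_ediff|split=> //; exact: wf_ediff].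
Qed.

Lemma wronskian_bound j : exists2 C, 0 <= C & forall x,
  `|eval x0 (wronskian_expr j) x| <= C * qf x `^ (- (n%:R - 1)).
Proof.
have [C1 C10 H1] := qf_Pf_wronskian_bound j B b.
have [C2 C20 H2] := qf_Pf_wronskian_bound j B' b'.
have [D1 D10 G1] := zf_powR_bounded x0 delta0 (- s) u.
have [D2 D20 G2] := zf_powR_bounded x0 delta0 (- s - 1) u.
exists (`|s| * (nrm1 B' b' * D2 * C1) + D1 * C2).
  by rewrite addr_ge0// !mulr_ge0// nrm1_ge0.
move=> x; have q0 := qf_gt0 x0 delta0 x; have z0 := zf_gt0 x0 delta0 x u.
have Q0 := Qf_gt0 x0 delta0 u x.
pose L (C : 'rV[R]_n) (c : R) := qf x * (2 * c * (x - x0) ord0 j + 2 * (delta *: C) ord0 j)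
    - Pf x0 delta C c x * (2 * (x - x0) ord0 j).
have {}H1 : `|L B b| <= C1 * qf x by exact: H1.
have {}H2 : `|L B' b'| <= C2 * qf x by exact: H2.
have -> : eval x0 (wronskian_expr j) x =
  - s * (hf B' b' x * zf B b x `^ (- s - 1) * (L B b / qf x)) * qf x `^ (- (n%:R - 1))
  - (zf B b x `^ (- s) * (L B' b' / qf x)) * qf x `^ (- (n%:R - 1)).
  rewrite /L /= -/(qf x) -/(Qf x0 delta B b x) -/(Pf x0 delta B' b' x) !powRB1//.
  rewrite !mxE /hf (_ : Pf x0 delta B b x = Qf x0 delta B b x - qf x); last by rewrite Qf_qfPf addrC addKr.
  have -> : qf x `^ (- (n%:R - 1)) = qf x `^ (- k) * qf x `^ (- k) / qf x.
    by rewrite -powRD ?(gt_eqF q0) ?implybT// -powRB1//; congr (_ `^ _); field.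
  have -> : qf x `^ (s - k) = qf x `^ (- k) * qf x `^ s.
    by rewrite -powRD ?(gt_eqF q0) ?implybT//; congr (_ `^ _); ring.
  have -> : Qf x0 delta B b x `^ (- s) = (qf x `^ s)^-1 * zf B b x `^ (- s).
    by rewrite Qf_zf// powRM ?(ltW q0) ?(ltW z0)// powRN.
  have := powR_gt0 s q0.
  rewrite Qf_zf//.
  move: (qf x `^ s) (qf x `^ (- k)) (zf B b x `^ (- s)) (Pf x0 delta B' b' x) => a c w P a0.
  move: (qf x) (zf B b x) q0 z0 => q z q0 z0.
  by field; rewrite !gt_eqF.
have Lq C c D : `|L C c| <= D * qf x -> `|L C c / qf x| <= D.
  by rewrite normrM normfV (gtr0_norm q0) ler_pdivrMr.
apply: le_trans (ler_normB _ _) _; rewrite [leRHS]mulrDl.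
apply: lerD; rewrite normrM [`|qf x `^ _|]ger0_norm ?powR_ge0// ler_wpM2r ?powR_ge0//.
  rewrite normrM normrN ler_wpM2l// normrM; apply: ler_pM => //; last exact: Lq.
  by rewrite normrM; apply: ler_pM => //; exact: hf_le.
by rewrite normrM; apply: ler_pM => //; exact: Lq.
Qed.

(** Green's formula moves the Laplacian onto Z, where [laplacian_Z] gives n (n + 2). The result is
    again a moment of Z, because h times psi is Z times (1 + h_u)^(-s). *)
Lemma integral_Z_laplacian_psi :
  \int[leb]_x (eval x0 Ze x * - laplacian (eval x0 psie) x) =
  n%:R * (n%:R + 2) * delta ^+ 2 * zmoment (eval x0 Ze) s B b.
Proof.
have wZ := wf_Z x0 delta0 B' b'; have wp := wf_psi x0 delta0 s u.
have sZ := symbol_Z x0 delta B' b'; have sp := symbol_psi x0 delta0 s u.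
have nm : n%:R / 2 < n%:R - 1 :> R by have := n3R; lra.
pose X j x := eval x0 (ediff j (wronskian_expr j)) x.
(* The products of first derivatives cancel, and this form shows two derivatives on a single factor,
   hence order -2k - 1 = -(n - 1). *)
pose dX j := eAdd (eMul Ze (ediff j (ediff j psie))) (eMul (eCst (-1)) (eMul psie (ediff j (ediff j Ze)))).
have XE j x : X j x = eval x0 (dX j) x by rewrite /X /dX /=; ring.
have Xb j : exists2 C, 0 <= C & forall x, `|X j x| <= C * qf x `^ (- (n%:R - 1)).
  have : symbol x0 delta (dX j) (- (n%:R - 1)).
    have h2 e : symbol x0 delta e (- k) -> symbol x0 delta (ediff j (ediff j e)) (- k - 2^-1 - 2^-1).
      by move=> h; do 2 apply: symbol_ediff.
    have E1 : - (n%:R - 1) = - k + (- k - 2^-1 - 2^-1) :> R by field.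
    have E2 : - (n%:R - 1) = 0 + (- (n%:R - 1)) :> R by rewrite add0r.
    apply: symbol_add; first by rewrite E1; apply: symbol_mul => //; exact: h2.
    rewrite E2; apply: symbol_mul; first exact: symbol_cst.
    by rewrite E1; apply: symbol_mul => //; exact: h2.
  by move=> /(symbol_bound delta0)[C C0 HC]; exists C => // x; rewrite XE.
have iX j : leb.-integrable setT (EFin \o X j).
  have [C _ HC] := Xb j.
  by apply: (integrable_le_qf delta0 nm _ HC); exact: measurable_eval.
have X0 j : \int[leb]_x X j x = 0.
  have [C1 C10 H1] := Xb j; have [C2 C20 H2] := wronskian_bound j.
  apply: (@integral_partial_eq0 _ _ x0 delta delta0 _ _ (C1 + C2) _ nm (wX j)) => x.
    by apply: le_trans (H2 x) _; rewrite ler_wpM2r ?powR_ge0// lerDr.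
  by apply: le_trans (H1 x) _; rewrite ler_wpM2r ?powR_ge0// lerDl.
have [iS ES] := Rintegral_finite_sum (index_enum 'I_n) iX.
rewrite [RHS](_ : _ = \int[leb]_x (n%:R * (n%:R + 2) * delta ^+ 2 * (eval x0 Ze x *
   qf x `^ (- ((n%:R + 2) / 2)) * zf B b x `^ (- s)))); last first.
  have [M HM] := bounded_Z B' b'.
  rewrite RintegralZl//.
  exact: (integrable_zmoment x0 delta0 n3 (measurable_eval x0 Ze) HM s u).
have [M HM] := bounded_Z B' b'.
have iR := integrableZ_EFin (n%:R * (n%:R + 2) * delta ^+ 2)
  (integrable_zmoment x0 delta0 n3 (measurable_eval x0 Ze) HM s u).
have -> : (fun x => eval x0 Ze x * - laplacian (eval x0 psie) x) =
   (fun x => n%:R * (n%:R + 2) * delta ^+ 2 * (eval x0 Ze x *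
   qf x `^ (- ((n%:R + 2) / 2)) * zf B b x `^ (- s)) - \sum_j X j x).
  apply/funext => x.
  have -> : \sum_j X j x = eval x0 Ze x * laplacian (eval x0 psie) x
     - eval x0 psie x * laplacian (eval x0 Ze) x.
    rewrite !laplacian_eval// !mulr_sumr -sumrB; apply: eq_bigr => j _.
    by rewrite XE /=; ring.
  by rewrite laplacian_Z// eval_psi// eval_Z//; ring.
rewrite RintegralB// ES [X in _ - X]big1 ?subr0// => j _; exact: X0.
Qed.

End wronskian.

(** Both sides are multiples of the moment of exponent s. The left one is n (n + 2) by Green's
    formula, the right one n (n - 2) (p (1 + lambda/(2 s)) - 1) by [riesz_pairing] and
    [convolution_riesz_hf]; they agree because p (n - 2) = 2 s. *)
Lemma moment_relation_Z B' b' :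
  moment_relation x0 delta lam p (eval x0 (Z_expr delta B' b')).
Proof.
move=> B b u; set Z := eval x0 _.
have [M HM] := bounded_Z B' b'; have mZ := measurable_eval x0 (Z_expr delta B' b').
have s0 : 0 < s by have := lamn; have := lam0; have := n3R; lra.
have := integral_Z_laplacian_psi B' b' u.
rewrite (integral_laplacian_psi x0 lam delta0 n3 mZ HM u) => L.
have Q := riesz_pairing delta0 n3 riesz_qf mZ HM u.
have {}Q : p * (1 - nrm2 B b) `^ (- ((n%:R - lam) / 2)) * zmoment Z (lam / 2) B b =
   p * (lam / 2 / s) * zmoment Z s B b.
  apply: (mulfI (lt0r_neq0 kappa0)).
  rewrite [LHS](_ : _ = p * (kappa * (1 - nrm2 B b) `^ (- ((n%:R - lam) / 2)) * zmoment Z (lam / 2) B b)); last by ring.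
  rewrite -Q [RHS](_ : _ = p * (kappa * (lam / 2 / s) * zmoment Z s B b)); last by ring.
  congr (_ * _); rewrite -RintegralZl//; last exact: (integrable_zmoment x0 delta0 n3 mZ HM s u).
  apply: eq_Rintegral => x _; have q0 := qf_gt0 x0 delta0 x.
  have -> : convolution (riesz_kernel lam) (fun y => qf y `^ (- e) * Z y) x =
     kappa * (lam / 2 / s) * qf x `^ (- (lam / 2)) * hf B' b' x.
    rewrite -convolution_riesz_hf; congr convolution; apply/funext => y.
    have q1 := qf_gt0 x0 delta0 y.
    rewrite /Z eval_Z// mulrA -powRD ?(gt_eqF q1) ?implybT//; congr (_ `^ _ * _); ring.
  rewrite eval_psi// /Z eval_Z//.
  have -> : qf x `^ (- ((n%:R + 2) / 2)) = qf x `^ (- e) * qf x `^ (- (lam / 2)).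
    by rewrite -powRD ?(gt_eqF q0) ?implybT//; congr (_ `^ _); field.
  ring.
rewrite Q -[RHS]/(n%:R * (n%:R - 2) * _).
have d2 : delta ^+ 2 != 0 by rewrite expf_neq0// gt_eqF.
apply: (mulfI d2); rewrite mulrCA mulrA L pE.
have n2 : n%:R - 2 != 0 :> R by rewrite gt_eqF// subr_gt0 (lt_le_trans _ n3R)// ltr_nat.
have sn : s != 0 by rewrite gt_eqF.
have sn' : 2 * n%:R - lam != 0.
  by rewrite (_ : _ - lam = 2 * s) ?mulf_neq0//; field.
by field; rewrite n2 [n%:R * 2]mulrC sn'.
Qed.

End zero_modes.

(** * Vanishing of the moments *)

Section spectrum.
Context {R : realType}.
Variables (n : nat) (lam p : R).
Hypothesis n3 : (3 <= n)%N.
Hypothesis lam0 : 0 < lam.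
Hypothesis lamn : lam < n%:R.
Hypothesis pE : p = (2 * n%:R - lam) / (n%:R - 2).
Local Notation s := (n%:R - lam / 2).
Local Notation e := (n%:R - lam / 2 - (n%:R - 2) / 2).

Let n3R : 3 <= n%:R :> R. Proof. by rewrite ler_nat. Qed.

Lemma bcoef_shift (t : R) l : t * bcoef (t + 1) l = (t + l%:R) * bcoef t l.
Proof.
have := bcoefS_shift t l; rewrite bcoefS => H.
have l0 : l.+1%:R != 0 :> R by rewrite pnatr_eq0.
apply: oppr_inj; rewrite -mulNr -H; move: l.+1%:R l0 => v v0.
by field.
Qed.

Lemma bcoef_neq0 (t : R) l : 0 < t -> bcoef t l != 0.
Proof.
move=> t0; apply/prodf_neq0 => i _.
by rewrite mulf_neq0 ?invr_neq0 ?pnatr_eq0// oppr_eq0 gt_eqF// ltr_wpDr.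
Qed.

(** The ratio is the product over i < l of (t + i)/(t' + i): the factor i = 0 is t/t' and the others
    lie between 0 and 1. *)
Lemma bcoef_ratio (t t' : R) l : 0 < t -> t <= t' -> (0 < l)%N ->
  exists2 r, 0 <= r <= t / t' & bcoef t l = r * bcoef t' l.
Proof.
move=> t0 tt; have t'0 := lt_le_trans t0 tt.
have tq : 0 <= t / t' <= t / t' by rewrite lexx andbT divr_ge0// ltW.
elim: l => // -[|l] IH _.
  by exists (t / t') => //; rewrite !bcoef1; field; rewrite gt_eqF.
have [r /andP[r0 r1] E] := IH isT.
have l1 : 0 < t + l.+1%:R by rewrite ltr_wpDr.
have l1' : 0 < t' + l.+1%:R by rewrite ltr_wpDr.
exists ((t + l.+1%:R) / (t' + l.+1%:R) * r).
  apply/andP; split; first by rewrite mulr_ge0// divr_ge0// ltW.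
  by apply: le_trans r1; rewrite ler_piMl// ler_pdivrMr// mul1r lerD2r.
rewrite bcoefS E [bcoef t' l.+2]bcoefS; have u0 : l.+2%:R != 0 :> R by rewrite pnatr_eq0.
move: (bcoef t' l.+1) l.+2%:R u0 l1' => v w w0 l1'.
by field; rewrite w0 nat1r gt_eqF.
Qed.

(* Up to a positive factor, the difference of the eigenvalues of the two sides
   of the linearized equation on spherical harmonics of degree l. *)
Definition spectral_gap l : R :=
  4 * (e * (e - 1) * bcoef s l + s * (s + 1) * bcoef (s + 2) l
       - 2 * e * s * bcoef (s + 1) l)
  - n%:R * (n%:R - 2) * (p * bcoef (lam / 2) l + (p - 1) * bcoef s l).

(** Factoring out [bcoef s l] leaves (n - 2 + 2l)(n + 2l) - n (n - 2)(p - 1 + p r), r being the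
    ratio of [bcoef (lam / 2) l] to [bcoef s l]. For l >= 2, r <= lambda/(2 s) keeps the second term
    at most n (n + 2), its value in degree 1, while the first is larger. For l = 0, r = 1 and the
    difference is negative because p > 1. *)
Lemma spectral_gap_neq0 l : l != 1%N -> spectral_gap l != 0.
Proof.
move=> l1; have s0 : 0 < s by have := lamn; have := lam0; have := n3R; lra.
have b0 := bcoef_neq0 l s0.
have E1 : s * bcoef (s + 1) l = (s + l%:R) * bcoef s l by exact: bcoef_shift.
have E2 : s * (s + 1) * bcoef (s + 2) l = (s + l%:R) * (s + 1 + l%:R) * bcoef s l.
  have -> : s + 2 = (s + 1) + 1 by ring.
  by rewrite -mulrA bcoef_shift mulrCA E1; ring.
have [r [r0 Er Hr]] : exists r, [/\ 0 <= r, bcoef (lam / 2) l = r * bcoef s l &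
   if l is 0%N then r = 1 else r <= lam / 2 / s].
  case: l l1 {b0 E1 E2} => [|l] _.
    by exists 1; rewrite !bcoef0 mulr1.
  have [||r /andP[? ?] ?] := @bcoef_ratio (lam / 2) s l.+1 _ _ isT.
  - by rewrite divr_gt0.
  - by have := lamn; lra.
  by exists r.
have -> : spectral_gap l = bcoef s l * ((n%:R - 2 + 2 * l%:R) * (n%:R + 2 * l%:R)
   - n%:R * (n%:R - 2) * (p - 1 + p * r)).
  transitivity (4 * (e * (e - 1) * bcoef s l + s * (s + 1) * bcoef (s + 2) l
       - 2 * e * (s * bcoef (s + 1) l))
    - n%:R * (n%:R - 2) * (p * bcoef (lam / 2) l + (p - 1) * bcoef s l)).
    by rewrite /spectral_gap; ring.
  by rewrite E1 E2 Er; field.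
rewrite mulf_neq0//.
have n2 : 0 < n%:R - 2 :> R by have := n3R; lra.
have pn : p * (n%:R - 2) = 2 * s.
  by rewrite pE divfK ?gt_eqF//; field.
case: l l1 {b0 E1 E2 Er} Hr => [|[|l]]// _ Hr.
  rewrite Hr mulr1 mulr0 !addr0 lt_eqF// subr_lt0.
  have -> : n%:R * (n%:R - 2) * (p - 1 + p) = n%:R * (2 * (p * (n%:R - 2)) - (n%:R - 2)) by ring.
  rewrite pn mulrC ltr_pM2l; last by have := n3R; lra.
  have := lamn; have := n3R; lra.
rewrite gt_eqF// subr_gt0.
have H1 : n%:R * (n%:R - 2) * (p - 1 + p * r) <= n%:R * (n%:R + 2).
  rewrite -mulrA ler_wpM2l//.
  have -> : (n%:R - 2) * (p - 1 + p * r) = p * (n%:R - 2) * (1 + r) - (n%:R - 2) by ring.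
  rewrite pn; have : s * r <= lam / 2 by rewrite mulrC -ler_pdivlMr.
  by lra.
apply: le_lt_trans H1 _.
have l2 : 2 <= l.+2%:R :> R by rewrite ler_nat.
have := n3R; nra.
Qed.

End spectrum.

Section moments.
Context {R : realType} {n : nat}.
Variables (x0 : 'rV[R]_n) (delta lam p : R).
Hypothesis delta0 : 0 < delta.
Hypothesis n3 : (3 <= n)%N.
Hypothesis lam0 : 0 < lam.
Hypothesis lamn : lam < n%:R.
Hypothesis pE : p = (2 * n%:R - lam) / (n%:R - 2).
Implicit Types (x y B : 'rV[R]_n) (b : R).
Local Notation qf := (qf x0 delta).
Local Notation hf := (hf x0 delta).
Local Notation leb := (@lebesgue_rV R n).
Local Notation s := (n%:R - lam / 2).
Local Notation e := (n%:R - lam / 2 - (n%:R - 2) / 2).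
Variables (phi : 'rV[R]_n -> R) (M : R).
Hypothesis mphi : measurable_fun setT phi.
Hypothesis phiM : forall x, `|phi x| <= M.
Hypothesis rel : moment_relation x0 delta lam p phi.
Let F x := phi x * qf x `^ (- ((n%:R + 2) / 2)).
Local Notation moment l B b := (\int[leb]_x (F x * hf B b x ^+ l)).
Hypothesis moment1 : forall B b, nrm1 B b <= 2^-1 -> moment 1 B b = 0.

Let n3R : 3 <= n%:R :> R. Proof. by rewrite ler_nat. Qed.

(* In the moment relation at (t B, t b) the coefficient of t^l is the spectral
   gap times the l-th moment, once the lower moments vanish. *)
Lemma moment_eq0 l B b : nrm1 B b <= 2^-1 -> moment l B b = 0.
Proof.
move=> u; elim/ltn_ind: l => l IH.
have [->|l1] := eqVneq l 1%N; first exact: moment1.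
set m := moment l B b.
have iF : leb.-integrable setT (EFin \o F) by exact: (integrable_weighted x0 delta0 n3 mphi phiM).
have h1 x : `|hf B b x| <= 1.
  by apply: le_trans (hf_le x0 delta0 B b x) (le_trans u _); rewrite invf_le1// ler1n.
(* The induction hypothesis removes all terms below order l, so each [zmoment] reduces to its term
   in t^l up to O(t^(l+1)). *)
have ex sg : exists2 C : R, 0 <= C & forall t : R, 0 < t <= 2^-1 ->
    `|zmoment x0 delta phi sg (t *: B) (t * b) - bcoef sg l * t ^+ l * m| <= C * t ^+ l.+1.
  have [C C0 HC] := integral_powR_expansion sg l.+1 iF (measurable_hf x0 delta0 B b) h1.
  exists C => // t /andP[t0 t1].
  have := HC t; rewrite (ltW t0) t1 => /(_ isT).
  rewrite big_ord_recr/= big1 ?add0r -/m; last first.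
    by move=> j _; rewrite (IH j)// mulr0.
  have -> : zmoment x0 delta phi sg (t *: B) (t * b) =
      \int[leb]_x (F x * (1 + t * hf B b x) `^ (- sg)).
    by apply: eq_Rintegral => x _; rewrite zfZ.
  by [].
have [C1 C10 H1] := ex s; have [C2 C20 H2] := ex (s + 2).
have [C3 C30 H3] := ex (s + 1); have [C4 C40 H4] := ex (lam / 2).
have [C5 C50 H5] := taylor_powR1D 1 ((n%:R - lam) / 2).
have n20 := nrm2_ge0 B b.
apply: (mulfI (spectral_gap_neq0 n3 lam0 lamn pE l1)); rewrite mulr0.
pose D sg C := `|bcoef sg l * m| + C.
(* The first two lines gather the Taylor errors of the four moments; the last two come from
   replacing 1 - t^2 |u|^2 and its power by 1, an error of order t^2 times a moment that is already
   O(t^l). *)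
pose K := 4 * (`|e * (e - 1)| * C1 + `|s * (s + 1)| * C2 + `|2 * e * s| * C3)
   + `|n%:R * (n%:R - 2)| * (`|p| * C4 + `|p - 1| * C1)
   + 4 * `|s * (s + 1)| * nrm2 B b * D (s + 2) C2
   + `|n%:R * (n%:R - 2) * p| * (C5 * nrm2 B b) * D (lam / 2) C4.
apply: (@leading_coef_eq0 _ l _ K) => t t12; have /andP[t0 t1] := t12.
have tu : nrm1 (t *: B) (t * b) <= 2^-1.
  rewrite nrm1Z ?(ltW t0)//; have := nrm1_ge0 B b; nra.
have := rel tu; rewrite nrm2Z.
have {}H1 := H1 t t12; have {}H2 := H2 t t12; have {}H3 := H3 t t12; have {}H4 := H4 t t12.
have tn : `|- (t ^+ 2 * nrm2 B b)| <= 2^-1.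
  rewrite normrN ger0_norm ?mulr_ge0 ?sqr_ge0//; have := nrm2_le u; nra.
have {}H5 := H5 _ tn; rewrite big_ord1 /= bcoef0 mul1r expr0 expr1 in H5.
rewrite normrN [`|t ^+ 2 * _|]ger0_norm in H5; last by rewrite mulr_ge0// sqr_ge0.
have tl0 : 0 <= t ^+ l by rewrite exprn_ge0// ltW.
have ZD sg C z : 0 <= C -> `|z - bcoef sg l * t ^+ l * m| <= C * t ^+ l.+1 -> `|z| <= D sg C * t ^+ l.
  move=> C0 Hz; rewrite -[z](subrK (bcoef sg l * t ^+ l * m)).
  apply: le_trans (ler_normD _ _) _; rewrite /D mulrDl addrC; apply: lerD.
    by rewrite mulrAC normrM [`|t ^+ l|]ger0_norm.
  apply: le_trans Hz _; rewrite ler_wpM2l// exprS ler_piMl//.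
  by apply: le_trans t1 _; rewrite invf_le1// ler1n.
have Z2 := ZD _ _ _ C20 H2; have Z4 := ZD _ _ _ C40 H4.
move: H1 H2 H3 H4 H5 Z2 Z4; set z1 := zmoment _ _ _ s _ _; set z2 := zmoment _ _ _ (s + 2) _ _.
set z3 := zmoment _ _ _ (s + 1) _ _; set z4 := zmoment _ _ _ (lam / 2) _ _.
set a := _ `^ _ => H1 H2 H3 H4 H5 Z2 Z4 E.
have -> : t ^+ l * (spectral_gap n lam p l * m) =
  - (4 * (e * (e - 1) * (z1 - bcoef s l * t ^+ l * m)
         + s * (s + 1) * (z2 - bcoef (s + 2) l * t ^+ l * m)
         - 2 * e * s * (z3 - bcoef (s + 1) l * t ^+ l * m)))
  + n%:R * (n%:R - 2) * (p * (z4 - bcoef (lam / 2) l * t ^+ l * m)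
         + (p - 1) * (z1 - bcoef s l * t ^+ l * m))
  + 4 * (s * (s + 1)) * nrm2 B b * (t ^+ 2 * z2)
  + n%:R * (n%:R - 2) * p * ((a - 1) * z4).
  rewrite /spectral_gap; move: E; lra.
have nb (A r C : R) : `|r| <= C * t ^+ l.+1 -> `|A * r| <= `|A| * C * t ^+ l.+1.
  by move=> h; rewrite normrM -mulrA ler_wpM2l.
have t2l (D' z : R) : 0 <= D' -> `|z| <= D' * t ^+ l -> t ^+ 2 * `|z| <= D' * t ^+ l.+1.
  move=> D'0 h; apply: (@le_trans _ _ (t ^+ 2 * (D' * t ^+ l))).
    by rewrite ler_wpM2l ?sqr_ge0.
  rewrite mulrCA ler_wpM2l// expr2 exprS -mulrA ler_piMl ?mulr_ge0 ?(ltW t0)//.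
  by apply: le_trans t1 _; rewrite invf_le1// ler1n.
have D0 sg C : 0 <= C -> 0 <= D sg C by move=> C0; rewrite addr_ge0.
apply: le_trans (ler_normD _ _) _; rewrite [leRHS]mulrDl; apply: lerD; last first.
  rewrite normrM [`|(a - 1) * _|]normrM -[leRHS]mulrA -[leRHS]mulrA ler_wpM2l//.
  apply: (@le_trans _ _ ((C5 * nrm2 B b) * (t ^+ 2 * `|z4|))).
    by rewrite mulrA ler_wpM2r// (le_trans H5)// mulrA mulrAC.
  by rewrite ler_wpM2l ?mulr_ge0//; apply: t2l => //; exact: D0.
apply: le_trans (ler_normD _ _) _; rewrite [leRHS]mulrDl; apply: lerD; last first.
  rewrite -[_ * D _ _ * _]mulrA normrM [`|t ^+ 2 * _|]normrM [`|t ^+ 2|]ger0_norm ?sqr_ge0//.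
  apply: ler_pM => //; [by rewrite mulr_ge0 ?sqr_ge0| |by apply: t2l => //; exact: D0].
  by rewrite normrM [`|4 * _|]normrM [`|nrm2 B b|]ger0_norm// [`|4|]ger0_norm.
apply: le_trans (ler_normD _ _) _; rewrite [leRHS]mulrDl; apply: lerD; last first.
  rewrite normrM -[leRHS]mulrA ler_wpM2l//; apply: le_trans (ler_normD _ _) _.
  by rewrite [leRHS]mulrDl; apply: lerD; exact: nb.
rewrite normrN normrM ger0_norm// -[leRHS]mulrA ler_wpM2l//.
apply: le_trans (ler_normB _ _) _; rewrite [leRHS]mulrDl; apply: lerD; last exact: nb.
by apply: le_trans (ler_normD _ _) _; rewrite [leRHS]mulrDl; apply: lerD; exact: nb.
Qed.

End moments.

(** Termwise integration of the exponential series, the partial sums being dominated by exp(M)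
    |F|. *)
Lemma integral_expR_eq0 d (T : measurableType d) {R : realType}
    (mu : {measure set T -> \bar R}) (F h : T -> R) (M : R) :
  mu.-integrable setT (EFin \o F) -> measurable_fun setT h ->
  (forall x, `|h x| <= M) -> (forall l, \int[mu]_x (F x * h x ^+ l) = 0) ->
  \int[mu]_x (F x * expR (h x)) = 0.
Proof.
move=> iF mh hM mom.
have M0 (x : T) : 0 <= M by exact: le_trans (hM x).
have il l : mu.-integrable setT (EFin \o (fun x => l`!%:R^-1 * (F x * h x ^+ l))).
  apply: integrableZ_EFin; apply: (integrable_bounded_mul (M := `|M| ^+ l)) => //.
    exact: measurable_funX.
  by move=> x; rewrite normrX lerXn2r ?nnegrE// (le_trans (hM x))// ler_norm.
pose G N x := F x * series (exp_coeff (h x)) N.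
have GE N : G N = (fun x => \sum_(l <- index_iota 0 N) l`!%:R^-1 * (F x * h x ^+ l)).
  apply/funext => x; rewrite /G /series/= mulr_sumr; apply: eq_bigr => l _.
  by rewrite exp_coeffE/= mulrCA.
have iG N : mu.-integrable setT (EFin \o G N).
  by rewrite GE; have [] := Rintegral_finite_sum (index_iota 0 N) il.
have G0 N : \int[mu]_x G N x = 0.
  rewrite GE; have [_ ->] := Rintegral_finite_sum (index_iota 0 N) il.
  rewrite big1// => l _; rewrite RintegralZl ?mom ?mulr0//.
  apply: (integrable_bounded_mul (M := `|M| ^+ l)) => //.
    exact: measurable_funX.
  by move=> x; rewrite normrX lerXn2r ?nnegrE// (le_trans (hM x))// ler_norm.
have me : measurable_fun setT (fun x => expR (h x)).
  exact: (measurableT_comp (@measurable_expR R)).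
have ib : mu.-integrable setT (EFin \o (fun x => F x * expR (h x))).
  apply: (integrable_bounded_mul (M := expR M)) => // x.
  by rewrite ger0_norm ?expR_ge0// ler_expR (le_trans (ler_norm _)).
have C1 : {ae mu, forall x, setT x -> (G N x)%:E @[N --> \oo] --> (F x * expR (h x))%:E}.
  apply: aeW => x _; apply/cvg_EFin; first exact: nearW.
  by apply: cvgM; [exact: cvg_cst|exact: is_cvg_series_exp_coeff].
have C2 : {ae mu, forall x N, setT x -> (`|(G N x)%:E| <= (expR M * `|F x|)%:E)%E}.
  apply: aeW => x N _; rewrite lee_fin normrM mulrC ler_wpM2r// /series/=.
  apply: le_trans (ler_norm_sum _ _ _) _.
  apply: (@le_trans _ _ (series (exp_coeff M) N)).
    apply: ler_sum => l _; rewrite !exp_coeffE normrM ger0_norm ?invr_ge0//.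
    by rewrite ler_wpM2l ?invr_ge0// normrX lerXn2r ?nnegrE// (M0 x).
  apply: nondecreasing_cvgn_le; last exact: is_cvg_series_exp_coeff.
  apply/nondecreasing_seqP => l; rewrite /series/= big_nat_recr//= lerDl.
  exact/exp_coeff_ge0/(M0 x).
have [_ _ L] := dominated_convergence measurableT
   (fun N => measurable_int mu (iG N)) (measurable_int mu ib) C1
   (integrableZ_EFin _ (integrable_norm iF)) C2.
have L0 : [sequence (\int[mu]_x (G N x)%:E)%E]_N = fun=> 0%E.
  apply/funext => N /=; have := G0 N; rewrite /Rintegral => E0.
  by rewrite -[LHS]fineK ?E0//; exact: (integrable_fin_num measurableT (iG N)).
rewrite /Rintegral (_ : (\int[mu]_x _)%E = 0%E)//.
by rewrite L0 in L; rewrite -(cvg_lim (@ereal_hausdorff _) L) lim_cst.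
Qed.

(** * Completeness of the spherical harmonics *)

Section completeness.
Context {R : realType} {n : nat}.
Variables (x0 : 'rV[R]_n) (delta : R).
Hypothesis delta0 : 0 < delta.
Local Notation qf := (qf x0 delta).
Local Notation hf := (hf x0 delta).
Local Notation leb := (@lebesgue_rV R n).

(** With b = (a - x0_j)/delta, the quadratic terms of P and b q cancel and P - b q = 2 delta (x_j -
    a). Geometrically, half-spaces are the spherical caps whose boundary passes through the pole of
    the projection. *)
Lemma hf_halfspace j a x :
  (hf (delta_mx ord0 j) ((a - x0 ord0 j) / delta) x < (a - x0 ord0 j) / delta) =
  (x ord0 j < a).
Proof.
have q0 := qf_gt0 x0 delta0 x; set b := _ / delta.
rewrite /hf ltr_pdivrMr// PfE.
have -> : \sum_i (delta_mx ord0 j : 'rV[R]_n) ord0 i * (x - x0) ord0 i = x ord0 j - x0 ord0 j.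
  rewrite (bigD1 j)//= big1 ?addr0 => [|i ij].
    by rewrite !mxE !eqxx mul1r.
  by rewrite mxE (negPf ij) andbF mul0r.
rewrite qfE -subr_lt0.
have -> : b * (\sum_i (x - x0) ord0 i ^+ 2 - delta ^+ 2) + 2 * delta * (x ord0 j - x0 ord0 j)
   - b * (\sum_i (x - x0) ord0 i ^+ 2 + delta ^+ 2) = 2 * delta * (x ord0 j - a).
  by rewrite /b; field; rewrite gt_eqF.
by rewrite pmulr_rlt0 ?mulr_gt0// subr_lt0.
Qed.

Lemma hf_generate : (measurable : set (set 'rV[R]_n)) `<=`
  <<s [set A : set 'rV[R]_n | exists (w : 'rV[R]_n * R) c, A = [set x | hf w.1 w.2 x < c]] >>.
Proof.
set G := [set A | _].
rewrite {1}/measurable/=; apply: smallest_sub; first exact: smallest_sigma_algebra.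
have H j : preimage_set_system setT (fun x : 'rV[R]_n => x ord0 j) measurable `<=` <<s G >>.
  rewrite [X in preimage_set_system _ _ X](_ : _ = <<s RGenInftyO.G (R := R) >>); last first.
    exact: RGenInftyO.measurableE.
  rewrite -g_sigma_preimageE; apply: smallest_sub; first exact: smallest_sigma_algebra.
  move=> _ [_ [a ->] <-]; apply: sub_sigma_algebra.
  exists (delta_mx ord0 j, (a - x0 ord0 j) / delta), ((a - x0 ord0 j) / delta).
  rewrite setTI; apply/seteqP; split => x /=; rewrite in_itv/= hf_halfspace//.
apply: (big_ind (fun X => X `<=` <<s G >>)) => [//|X Y hX hY|i _]; last exact: H.
by rewrite subUset.
Qed.

Lemma orthogonal_harmonics_eq0 (F : 'rV[R]_n -> R) :
  leb.-integrable setT (EFin \o F) ->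
  (forall l B b, nrm1 B b <= 2^-1 -> \int[leb]_x (F x * hf B b x ^+ l) = 0) ->
  {ae leb, forall x, F x = 0}.
Proof.
move=> iF mom.
have mom' l B b : \int[leb]_x (F x * hf B b x ^+ l) = 0.
  have [t t0 u] := nrm1_rescale B b.
  have il : leb.-integrable setT (EFin \o (fun x => F x * hf B b x ^+ l)).
    apply: (integrable_bounded_mul (M := nrm1 B b ^+ l)) => //.
      by apply: measurable_funX; exact: measurable_hf.
    move=> x; have N0 := nrm1_ge0 B b.
    by rewrite normrX lerXn2r ?nnegrE ?normr_ge0//; exact: hf_le.
  have tl : t ^+ l != 0 by rewrite expf_neq0// gt_eqF.
  apply: (mulfI tl); rewrite mulr0 -(mom l _ _ u) -RintegralZl//.
  by apply: eq_Rintegral => x _; rewrite hfZ [(t * _) ^+ l]exprMn mulrCA.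
apply: (@orthogonal_exponentials_eq0 _ _ _ leb _ F (fun w : 'rV[R]_n * R => hf w.1 w.2)) => //.
- by move=> w; exact: measurable_hf.
- by move=> w; exists (nrm1 w.1 w.2) => x; exact: hf_le.
- by exists (0, 0) => x; exact: hf0.
- by move=> w w'; exists (w.1 + w'.1, w.2 + w'.2) => x; exact: hfD.
- move=> w; apply: (integral_expR_eq0 iF (measurable_hf x0 delta0 w.1 w.2) (M := nrm1 w.1 w.2)) => //.
  by move=> x; exact: hf_le.
- exact: hf_generate.
Qed.

End completeness.

(** * Projection onto the zero modes *)

Section projection.
Context {R : realType} {n : nat}.
Variables (x0 : 'rV[R]_n) (delta : R).
Hypothesis delta0 : 0 < delta.
Hypothesis n3 : (3 <= n)%N.
Implicit Types (x B : 'rV[R]_n) (b : R).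
Local Notation qf := (qf x0 delta).
Local Notation hf := (hf x0 delta).
Local Notation leb := (@lebesgue_rV R n).
Local Notation k := ((n%:R - 2) / 2).

Let n3R : 3 <= n%:R :> R. Proof. by rewrite ler_nat. Qed.
Let n0 : (0 < n)%N. Proof. exact: leq_trans n3. Qed.

Let iq : leb.-integrable setT (EFin \o (fun x => qf x `^ (- n%:R))).
Proof. by apply: integrable_qf => //; have := n3R; lra. Qed.

Lemma integral_qf_gt0 : 0 < \int[leb]_x qf x `^ (- n%:R).
Proof.
have m0 : 0 < n%:R + delta ^+ 2 :> R by rewrite ltr_wpDl// exprn_gt0.
(* The minimum of q^(-n) over the unit cube about x0 is at least c, since |x - x0|^2 <= n there. *)
pose c : R := (n%:R + delta ^+ 2) `^ (- n%:R).
have c0 : 0 < c by exact: powR_gt0.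
have EB := integral_box_shift x0 (ler01 : 0 <= 1 :> R).
have ib : leb.-integrable setT (EFin \o (fun x => \1_(@box R n 1) (x - x0) : R)).
  apply/integrableP; split.
    have mI : measurable_fun setT (\1_(@box R n 1) : 'rV[R]_n -> R).
      by apply/measurable_indicP; exact: measurable_box.
    have ms : measurable_fun setT (fun x : 'rV[R]_n => x - x0).
      apply: measurable_rVP => i; under eq_fun do rewrite !mxE.
      by apply: measurable_funB => //; exact: measurable_rV_coord.
    by apply/measurable_EFinP; exact: (measurableT_comp mI ms).
  rewrite (eq_integral (fun x => (\1_(@box R n 1) (x - x0))%:E)) ?EB ?ltry// => x _.
  by rewrite /= ger0_norm ?indicE ?ler0n.
apply: (@lt_le_trans _ _ (\int[leb]_x (c * \1_(@box R n 1) (x - x0)))).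
  rewrite RintegralZl//; apply: mulr_gt0 => //.
  by rewrite /Rintegral EB /= exprn_gt0// mulr1.
apply: le_Rintegral => //; first exact: integrableZ_EFin.
move=> x _; rewrite indicE; have [xb|_] := boolP (x - x0 \in @box R n 1); last first.
  by rewrite mulr0 powR_ge0.
move: xb; rewrite inE => xb; rewrite mulr1 /c !powRN lef_pV2 ?posrE ?powR_gt0 ?qf_gt0//.
apply: ge0_ler_powR; rewrite ?nnegrE ?(ltW m0) ?(ltW (qf_gt0 _ delta0 _))//.
rewrite qfE lerD2r -[n in leRHS]card_ord -sumr_const; apply: ler_sum => i _.
by rewrite -real_normK ?num_real// exprn_ile1// xb.
Qed.

Lemma hf_decomp B b x :
  hf B b x = \sum_j B ord0 j * hf (delta_mx ord0 j) 0 x + b * hf 0 1 x.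
Proof.
have -> : hf B b x = hf B 0 x + hf 0 b x by rewrite -hfD addr0 add0r.
congr (_ + _); last by rewrite -hfZ scaler0 mulr1.
rewrite {1}[B]row_sum_delta.
apply: (big_ind2 (fun C c => hf C 0 x = c)) => [|C c C' c' <- <-|j _]; first exact: hf0.
  by rewrite -hfD addr0.
by rewrite -hfZ mulr0.
Qed.

(** Polarization of [integral_hf], freed from the smallness condition by homogeneity. The Gram
    matrix of the coordinates on the sphere is thus a multiple of the identity. *)
Lemma gram_hf B b B' b' :
  \int[leb]_x (qf x `^ (- n%:R) * hf B' b' x * hf B b x) =
  (\sum_i B' ord0 i * B ord0 i + b' * b) *
  ((\int[leb]_x qf x `^ (- n%:R)) / (n%:R + 1)).
Proof.
set I := \int[leb]_x qf x `^ _.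
have n1 : n%:R + 1 != 0 :> R by rewrite gt_eqF// ltr_wpDl.
have i2 C c C' c' : leb.-integrable setT (EFin \o (fun x => qf x `^ (- n%:R) * hf C' c' x * hf C c x)).
  apply: (integrable_bounded_mul _ (measurable_hf x0 delta0 C c) (fun x => hf_le x0 delta0 C c x)).
  exact: (integrable_bounded_mul iq (measurable_hf x0 delta0 C' c') (fun x => hf_le x0 delta0 C' c' x)).
have diag C c : \int[leb]_x (qf x `^ (- n%:R) * hf C c x * hf C c x) = nrm2 C c / (n%:R + 1) * I.
  have [t t0 u] := nrm1_rescale C c.
  have t2 : t ^+ 2 != 0 by rewrite expf_neq0// gt_eqF.
  apply: (mulfI t2); rewrite !mulrA -nrm2Z -(integral_hf x0 delta0 n0 u) -RintegralZl//.
  by apply: eq_Rintegral => x _; rewrite hfZ; ring.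
have := diag (B + B') (b + b').
have -> : \int[leb]_x (qf x `^ (- n%:R) * hf (B + B') (b + b') x * hf (B + B') (b + b') x) =
  \int[leb]_x (qf x `^ (- n%:R) * hf B b x * hf B b x) +
  2 * \int[leb]_x (qf x `^ (- n%:R) * hf B' b' x * hf B b x) +
  \int[leb]_x (qf x `^ (- n%:R) * hf B' b' x * hf B' b' x).
  rewrite -RintegralZl// -RintegralD//; last exact: integrableZ_EFin.
  rewrite -RintegralD//; last exact: (integrableD measurableT (i2 _ _ _ _) (integrableZ_EFin 2 (i2 _ _ _ _))).
  by apply: eq_Rintegral => x _; rewrite hfD; ring.
rewrite !diag.
have -> : nrm2 (B + B') (b + b') = nrm2 B b + 2 * (\sum_i B' ord0 i * B ord0 i + b' * b) + nrm2 B' b'.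
  rewrite /nrm2 [\sum_i (B + B') ord0 i ^+ 2](_ : _ = \sum_i B ord0 i ^+ 2 +
    2 * (\sum_i B' ord0 i * B ord0 i) + \sum_i B' ord0 i ^+ 2); first by ring.
  rewrite mulr_sumr -!big_split/=; apply: eq_bigr => i _; rewrite mxE; ring.
move=> H; apply: (mulfI (_ : 2 != 0 :> R)) => //.
set W := \int[leb]_x _ in H *; set m := _ + b' * b in H *.
have -> : 2 * (m * (I / (n%:R + 1))) = 2 * m / (n%:R + 1) * I by ring.
by apply: (addrI (nrm2 B b / (n%:R + 1) * I)); apply: (addIr (nrm2 B' b' / (n%:R + 1) * I)); rewrite H; ring.
Qed.

Variables (phi : 'rV[R]_n -> R) (M : R).
Hypothesis mphi : measurable_fun setT phi.
Hypothesis phiM : forall x, `|phi x| <= M.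

(** As the Gram matrix is scalar, the coefficients of the projection are the first moments of phi
    divided by [c]. The Gram weight q^(-n) arises because Z carries q^(-k) and k + (n+2)/2 = n. *)
Lemma exists_projection : exists B' b', forall B b,
  \int[leb]_x ((phi x - eval x0 (Z_expr delta B' b') x) *
     qf x `^ (- ((n%:R + 2) / 2)) * hf B b x ^+ 1) = 0.
Proof.
pose F x := phi x * qf x `^ (- ((n%:R + 2) / 2)).
have iF : leb.-integrable setT (EFin \o F) by exact: (integrable_weighted x0 delta0 n3 mphi phiM).
have ih B b : leb.-integrable setT (EFin \o (fun x => F x * hf B b x)).
  exact: (integrable_bounded_mul iF (measurable_hf x0 delta0 B b) (fun x => hf_le x0 delta0 B b x)).
have ig B b B' b' : leb.-integrable setT (EFin \o (fun x => qf x `^ (- n%:R) * hf B' b' x * hf B b x)).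
  apply: (integrable_bounded_mul _ (measurable_hf x0 delta0 B b) (fun x => hf_le x0 delta0 B b x)).
  exact: (integrable_bounded_mul iq (measurable_hf x0 delta0 B' b') (fun x => hf_le x0 delta0 B' b' x)).
pose m B b := \int[leb]_x (F x * hf B b x).
pose c := (\int[leb]_x qf x `^ (- n%:R)) / (n%:R + 1).
have c0 : c != 0.
  by rewrite mulf_neq0 ?invr_neq0// gt_eqF ?integral_qf_gt0// ltr_wpDl.
have mE B b : m B b = \sum_j m (delta_mx ord0 j) 0 * B ord0 j + m 0 1 * b.
  have [iS ES] := Rintegral_finite_sum (index_enum 'I_n)
    (fun j => integrableZ_EFin (B ord0 j) (ih (delta_mx ord0 j) 0)).
  transitivity (\int[leb]_x (\sum_j B ord0 j * (F x * hf (delta_mx ord0 j) 0 x) + b * (F x * hf 0 1 x))).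
    apply: eq_Rintegral => x _; rewrite hf_decomp mulrDr mulr_sumr mulrCA; congr (_ + _).
    by apply: eq_bigr => j _; rewrite mulrCA.
  rewrite RintegralD//; last exact: integrableZ_EFin.
  rewrite ES RintegralZl// mulrC; congr (_ + _); apply: eq_bigr => j _.
  by rewrite RintegralZl// mulrC.
exists (\row_j (m (delta_mx ord0 j) 0 / c)), (m 0 1 / c) => B b.
set B' := \row_j _; set b' := _ / c.
transitivity (\int[leb]_x (F x * hf B b x - qf x `^ (- n%:R) * hf B' b' x * hf B b x)).
  apply: eq_Rintegral => x _; rewrite eval_Z// expr1 /F.
  have -> : qf x `^ (- n%:R) = qf x `^ (- k) * qf x `^ (- ((n%:R + 2) / 2)).
    by rewrite -powRD ?(gt_eqF (qf_gt0 x0 delta0 x)) ?implybT//; congr (_ `^ _); field.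
  ring.
rewrite RintegralB// -/(m B b) mE gram_hf -/c; apply/eqP; rewrite subr_eq0; apply/eqP.
rewrite mulrDl mulr_suml; congr (_ + _); last by rewrite /b'; field.
by apply: eq_bigr => j _; rewrite mxE; field.
Qed.

End projection.

(** * Essential bounds and integrals of measurable functions *)

Section measure_lemmas.
Context d (T : measurableType d) {R : realType} (mu : {measure set T -> \bar R}).
Implicit Types (f g : T -> R).

Lemma Lfun_oo_ae_bounded f : f \in Lfun mu +oo%E ->
  measurable_fun setT f /\ exists M : R, {ae mu, forall x, `|f x| <= M}.
Proof.
rewrite inE => /andP[]; rewrite !inE/= => mf; rewrite /finite_norm unlock/= => bf; split=> //.
have := bf; case: ifPn => [mu0 {}bf|]; last first.
  rewrite -leNgt measure_le0 => /eqP mu0 _; exists 0; exists setT; split=> //.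
have [M HM] := @ess_sup_inf.ess_supr_bounded _ _ _ mu (fun x => `|f x|) bf.
by exists M.
Qed.

(** Integrability is not assumed: if a part of f has infinite integral, both sides are 0 by the
    convention of [fine]. It allows the constants to leave the convolutions before these are known
    to converge. *)
Lemma RintegralZl_cst (c : R) f : measurable_fun setT f ->
  \int[mu]_x (c * f x) = c * \int[mu]_x f x.
Proof.
move=> mf.
have mp : measurable_fun setT (EFin \o f)^\+%E by apply: measurable_funepos; exact/measurable_EFinP.
have mn : measurable_fun setT (EFin \o f)^\-%E by apply: measurable_funeneg; exact/measurable_EFinP.
rewrite /Rintegral [in LHS]integralE [in RHS]integralE.
have -> : (fun x => (c * f x)%:E) = (fun x => (c%:E * (EFin \o f) x)%E).
  by apply/funext => x; rewrite EFinM.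
have P0 : (0 <= \int[mu]_x (EFin \o f)^\+ x)%E by exact: integral_ge0.
have N0 : (0 <= \int[mu]_x (EFin \o f)^\- x)%E by exact: integral_ge0.
have [c0|c0|->] := ltgtP c 0; last first.
- by rewrite ge0_funeposM// ge0_funenegM// !ge0_integralZl// !mul0e sube0 mul0r.
- rewrite ge0_funeposM ?(ltW c0)// ge0_funenegM ?(ltW c0)// !ge0_integralZl// ?lee_fin ?(ltW c0)//.
  have c1 : (0 < c%:E :> \bar R)%E by rewrite lte_fin.
  move: P0 N0; case: (integral _ _ _) => [P| |]; case: (integral _ _ _) => [N| |]// _ _;
    rewrite ?gt0_muley//= ?mulr0//; ring.
- rewrite le0_funeposM ?(ltW c0)// le0_funenegM ?(ltW c0)//.
  rewrite !ge0_integralZl// ?lee_fin ?oppr_ge0 ?(ltW c0)//.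
  have c1 : (0 < - c%:E :> \bar R)%E by rewrite lte_fin oppr_gt0.
  move: P0 N0; case: (integral _ _ _) => [P| |]; case: (integral _ _ _) => [N| |]// _ _;
    rewrite ?gt0_muley//= ?mulr0//; ring.
Qed.

Lemma ae_eq_Rintegral f g : measurable_fun setT f -> measurable_fun setT g ->
  {ae mu, forall x, f x = g x} -> \int[mu]_x f x = \int[mu]_x g x.
Proof.
move=> mf mg fg; congr fine; apply: ae_eq_integral => //.
- exact/measurable_EFinP.
- exact/measurable_EFinP.
- by apply: filterS fg => x -> _.
Qed.
End measure_lemmas.

(** * Functions satisfying the moment relation *)

Section classification.
Context {R : realType} {n : nat}.
Variables (x0 : 'rV[R]_n) (delta lam kappa p : R).
Hypothesis delta0 : 0 < delta.
Hypothesis n3 : (3 <= n)%N.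
Hypothesis lam0 : 0 < lam.
Hypothesis lamn : lam < n%:R.
Hypothesis kappa0 : 0 < kappa.
Hypothesis pE : p = (2 * n%:R - lam) / (n%:R - 2).
Implicit Types (x y B : 'rV[R]_n) (b : R).
Local Notation qf := (qf x0 delta).
Local Notation leb := (@lebesgue_rV R n).
Local Notation s := (n%:R - lam / 2).
Hypothesis riesz_qf : forall x,
  (\int[leb]_y (riesz_kernel lam (x - y) * qf y `^ (- s))%:E =
   (kappa * qf x `^ (- (lam / 2)))%:E)%E.

Lemma moment_relationB (f g : 'rV[R]_n -> R) (M N : R) :
  measurable_fun setT f -> (forall x, `|f x| <= M) ->
  measurable_fun setT g -> (forall x, `|g x| <= N) ->
  moment_relation x0 delta lam p f -> moment_relation x0 delta lam p g ->
  moment_relation x0 delta lam p (fun x => f x - g x).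
Proof.
move=> mf fM mg gN rf rg B b u.
have zB sg : zmoment x0 delta (fun x => f x - g x) sg B b =
    zmoment x0 delta f sg B b - zmoment x0 delta g sg B b.
  rewrite /zmoment -RintegralB//.
  - by apply: eq_Rintegral => x _; ring.
  - exact: (integrable_zmoment x0 delta0 n3 mf fM sg u).
  - exact: (integrable_zmoment x0 delta0 n3 mg gN sg u).
by have := rf _ _ u; have := rg _ _ u; rewrite !zB; lra.
Qed.

Lemma moment_relation_zero_mode (phi : 'rV[R]_n -> R) (M : R) :
  measurable_fun setT phi -> (forall x, `|phi x| <= M) ->
  moment_relation x0 delta lam p phi ->
  exists B b, {ae leb, forall x, phi x = eval x0 (Z_expr delta B b) x}.
Proof.
move=> mphi phiM rel.
have [B [b H]] := exists_projection x0 delta0 n3 mphi phiM.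
exists B, b.
have [N HN] := bounded_Z x0 delta0 n3 B b.
have mZ := measurable_eval x0 (Z_expr delta B b).
pose phi' x := phi x - eval x0 (Z_expr delta B b) x.
have mphi' : measurable_fun setT phi' by exact: measurable_funB.
have phi'M x : `|phi' x| <= M + N by apply: le_trans (ler_normB _ _) _; apply: lerD.
have rel' : moment_relation x0 delta lam p phi'.
  apply: (moment_relationB mphi phiM mZ HN rel).
  exact: (moment_relation_Z delta0 n3 lam0 lamn kappa0 pE riesz_qf).
have mom l B1 b1 (u : nrm1 B1 b1 <= 2^-1) := moment_eq0 delta0 n3 lam0 lamn pE mphi' phi'M rel'
  (fun B b _ => H B b) l u.
have := orthogonal_harmonics_eq0 delta0 (integrable_weighted x0 delta0 n3 mphi' phi'M) mom.
apply: filterS => x /eqP; rewrite mulf_eq0 (gt_eqF (powR_gt0 _ (qf_gt0 x0 delta0 x))) orbF.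
by rewrite subr_eq0 => /eqP.
Qed.

End classification.

(** * The equations at a bubble *)

Section bubble_equation.
Context {R : realType} {n : nat}.
Variables (x0 : 'rV[R]_n) (delta lam p c : R).
Hypothesis delta0 : 0 < delta.
Hypothesis n3 : (3 <= n)%N.
Hypothesis c0 : c != 0.
Hypothesis pE : p = (2 * n%:R - lam) / (n%:R - 2).
Implicit Types (x y : 'rV[R]_n) (phi : 'rV[R]_n -> R).
Local Notation qf := (qf x0 delta).
Local Notation leb := (@lebesgue_rV R n).
Local Notation k := ((n%:R - 2) / 2).
Local Notation s := (n%:R - lam / 2).
Local Notation e := (n%:R - lam / 2 - (n%:R - 2) / 2).
Local Notation U := (bubble c delta x0).
Local Notation A := (hartree_constant (N := n) lam * `|c| `^ p * `|c| `^ (p - 2)).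

Let n3R : 3 <= n%:R :> R. Proof. by rewrite ler_nat. Qed.
Let n2 : n%:R - 2 != 0 :> R. Proof. by rewrite gt_eqF// subr_gt0 (lt_le_trans _ n3R)// ltr_nat. Qed.

Lemma bubble_powR x m : `|U x| `^ m = `|c| `^ m * qf x `^ (- k * m).
Proof. by rewrite bubbleE// normrM [`|qf x `^ _|]ger0_norm ?powR_ge0// powRM ?powR_ge0// powRrM. Qed.

(** The critical exponent enters here through k p = s, and in [bubble_powp1] through k (p - 1) =
    e. *)
Lemma bubble_powp x : `|U x| `^ p = `|c| `^ p * qf x `^ (- s).
Proof. by rewrite bubble_powR; congr (_ * _ `^ _); rewrite pE; field. Qed.

Lemma bubble_powp1 x : `|U x| `^ (p - 2) * U x = `|c| `^ (p - 2) * c * qf x `^ (- e).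
Proof.
rewrite bubble_powR bubbleE// mulrACA -powRD ?(gt_eqF (qf_gt0 x0 delta0 x)) ?implybT//.
by congr (_ * _ `^ _); rewrite pE; field.
Qed.

Lemma measurable_riesz_qf x m g : measurable_fun setT g ->
  measurable_fun setT (fun y => riesz_kernel lam (x - y) * (qf y `^ m * g y)).
Proof.
move=> mg; apply: measurable_funM; first exact: measurable_riesz_sub.
by apply: measurable_funM => //; exact: measurable_qf_powR.
Qed.

Lemma convolution_bubble x :
  convolution (riesz_kernel lam) (fun y => `|U y| `^ p) x =
  `|c| `^ p * fine (\int[leb]_y (riesz_kernel lam (x - y) * qf y `^ (- s))%:E).
Proof.
rewrite -RintegralZl_cst//.
  by apply: eq_Rintegral => y _; rewrite bubble_powp mulrCA.
apply: measurable_funM; first exact: measurable_riesz_sub.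
exact: measurable_qf_powR.
Qed.

(** The equation fixes [A * fine (I x)] as a nonzero multiple of q^(-lambda/2), so A and
    [fine (I x)] are nonzero, whatever the Gamma factors are. The sign of kappa then follows from
    that of the integrand. *)
Lemma riesz_qf_of_hartree : hartree_solution lam p U ->
  exists kappa : R, [/\ 0 < kappa, A * kappa = n%:R * (n%:R - 2) * delta ^+ 2 &
  forall x, (\int[leb]_y (riesz_kernel lam (x - y) * qf y `^ (- s))%:E =
   (kappa * qf x `^ (- (lam / 2)))%:E)%E].
Proof.
move=> sol.
pose I x := (\int[leb]_y (riesz_kernel lam (x - y) * qf y `^ (- s))%:E)%E.
have N0 : 0 < n%:R * (n%:R - 2) * delta ^+ 2.
  by rewrite !mulr_gt0 ?exprn_gt0//; have := n3R; lra.
have E x : A * fine (I x) = n%:R * (n%:R - 2) * delta ^+ 2 * qf x `^ (- (lam / 2)).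
  have q0 := qf_gt0 x0 delta0 x.
  have := sol x; rewrite laplacian_bubble// convolution_bubble bubble_powp1 -/(I x) opprK.
  have -> : qf x `^ (- ((n%:R + 2) / 2)) = qf x `^ (- e) * qf x `^ (- (lam / 2)).
    by rewrite -powRD ?(gt_eqF q0) ?implybT//; congr (_ `^ _); field.
  move=> /eqP; rewrite subr_eq0 => /eqP H.
  have qe0 : c * qf x `^ (- e) != 0 by rewrite mulf_neq0// gt_eqF// powR_gt0.
  by apply: (mulfI qe0); lra.
have A0 : A != 0.
  apply/eqP => A0; have := E x0; rewrite A0 mul0r => /esym/eqP; rewrite gt_eqF//.
  by rewrite mulr_gt0// powR_gt0// qf_gt0.
pose kappa := n%:R * (n%:R - 2) * delta ^+ 2 / A.
have fE x : fine (I x) = kappa * qf x `^ (- (lam / 2)).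
  by apply: (mulfI A0); rewrite E [RHS]mulrA; congr (_ * _); rewrite [RHS]mulrC divfK.
have q0 x := powR_gt0 (- (lam / 2)) (qf_gt0 x0 delta0 x).
have kappa0 : kappa != 0.
  by rewrite mulf_neq0 ?invr_neq0// gt_eqF.
have I0 x : (0 <= I x)%E.
  by apply: integral_ge0 => y _; rewrite lee_fin mulr_ge0 ?powR_ge0.
exists kappa; split.
- rewrite lt_neqAle eq_sym kappa0/= -(pmulr_lge0 _ (q0 x0)) -fE.
  exact: fine_ge0.
- by rewrite [LHS]mulrC divfK.
(* Convergence of the integral: [fine] sends infinity to 0, whereas [fine (I x)] is not 0. *)
move=> x; rewrite -fE -/(I x) fineK//.
have : fine (I x) != 0 by rewrite fE mulf_neq0// gt_eqF.
by have := I0 x; case: (I x) => [r| |]//=; rewrite eqxx.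
Qed.

(** The nonlocal term carries the square of |c|^(p-2) c and the local one |c|^p |c|^(p-2); these
    agree because |c|^p = |c|^(p-2) c^2, and [Ak] trades the common constant for n (n - 2) delta^2 /
    kappa. *)
Lemma linearized_rhs_bubble kappa phi x : measurable_fun setT phi ->
  A * kappa = n%:R * (n%:R - 2) * delta ^+ 2 -> 0 < kappa ->
  (forall x, (\int[leb]_y (riesz_kernel lam (x - y) * qf y `^ (- s))%:E =
   (kappa * qf x `^ (- (lam / 2)))%:E)%E) ->
  linearized_rhs lam p U phi x = reduced_rhs x0 delta lam kappa p phi x.
Proof.
move=> mphi Ak kappa0 riesz_qf; have q0 := qf_gt0 x0 delta0 x.
have E1 : convolution (riesz_kernel lam) (fun y => `|U y| `^ (p - 2) * U y * phi y) x =
    `|c| `^ (p - 2) * c * convolution (riesz_kernel lam) (fun y => qf y `^ (- e) * phi y) x.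
  rewrite -RintegralZl_cst; last exact: measurable_riesz_qf.
  by apply: eq_Rintegral => y _; rewrite bubble_powp1; ring.
have E2 := convolution_bubble x; rewrite riesz_qf /= in E2.
rewrite /linearized_rhs E1 E2 bubble_powp1 {E1 E2}.
rewrite /reduced_rhs -Ak bubble_powR.
have cp : `|c| `^ p = `|c| `^ (p - 2) * c ^+ 2.
  have c1 : (`|c| == 0) = false by rewrite normr_eq0 (negPf c0).
  by rewrite -real_normK ?num_real// -powR_mulrn// -powRD ?c1 ?implybT// subrK.
have -> : qf x `^ (- k * (p - 2)) = qf x `^ (- 2) / qf x `^ (- (lam / 2)).
  rewrite -powRN -powRD ?(gt_eqF q0) ?implybT//; congr (_ `^ _).
  by rewrite pE; field.
have := powR_gt0 (- (lam / 2)) q0; rewrite cp.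
move: (qf x `^ (- (lam / 2))) (convolution _ _ _) => w v w0.
by field; rewrite !gt_eqF.
Qed.

End bubble_equation.

Lemma measurable_reduced_rhs (R : realType) n (x0 : 'rV[R]_n) (delta lam kappa p : R) phi :
  measurable_fun setT phi -> measurable_fun setT (reduced_rhs x0 delta lam kappa p phi).
Proof.
move=> mphi.
have mq m := measurable_qf_powR x0 delta m.
apply: measurable_funM => //; apply: measurable_funD.
  apply: measurable_funM => //; apply: measurable_funM; first exact: mq.
  by apply: measurable_convolution_riesz; apply: measurable_funM => //; exact: mq.
by apply: measurable_funM => //; apply: measurable_funM => //; exact: mq.
Qed.

(** The coefficients invert [partial_bubble] and [dilation_bubble]: B goes with the translations and
    b with the dilation. *)
Lemma zero_mode_span (R : realType) n (x0 : 'rV[R]_n) (delta c : R) (B : 'rV[R]_n) (b : R) x :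
  0 < delta -> (3 <= n)%N -> c != 0 ->
  eval x0 (Z_expr delta B b) x =
  \sum_(j < n) 2 * delta * B ord0 j / (c * (2 - n%:R)) * partial j (bubble c delta x0) x
  + - b / (c * ((n%:R - 2) / 2)) * dilation_generator x0 (bubble c delta x0) x.
Proof.
move=> delta0 n3 c0; have q0 := qf_gt0 x0 delta0 x.
have n3R : 3 <= n%:R :> R by rewrite ler_nat.
have n2 : n%:R - 2 != 0 :> R by rewrite gt_eqF// subr_gt0 (lt_le_trans _ n3R)// ltr_nat.
have n2' : 2 - n%:R != 0 :> R by rewrite -opprB oppr_eq0.
rewrite eval_Z// dilation_bubble//.
under eq_bigr do rewrite partial_bubble//.
have -> : \sum_(j < n) 2 * delta * B ord0 j / (c * (2 - n%:R)) *
    (c * (2 - n%:R) * qf x0 delta x `^ (- ((n%:R - 2) / 2)) * ((x - x0) ord0 j / qf x0 delta x)) =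
  qf x0 delta x `^ (- ((n%:R - 2) / 2)) *
    (2 * delta * (\sum_i B ord0 i * (x - x0) ord0 i) / qf x0 delta x).
  rewrite !(mulr_sumr, mulr_suml); apply: eq_bigr => j _.
  by field; rewrite c0 n2' gt_eqF.
rewrite /hf !PfE (_ : \sum_i (0 : 'rV[R]_n) ord0 i * (x - x0) ord0 i = 0); last first.
  by rewrite big1// => i _; rewrite mxE mul0r.
by field; rewrite c0 n2 gt_eqF.
Qed.

(** The moment argument wants a representative bounded at every point. Cutting to 0 where the bound
    fails never increases absolute values, so vanishing at infinity is inherited. *)
Lemma ae_bounded_truncation d (T : measurableType d) (R : realType)
    (mu : {measure set T -> \bar R}) (f : T -> R) (M : R) :
  measurable_fun setT f -> {ae mu, forall x, `|f x| <= M} ->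
  exists g : T -> R, [/\ measurable_fun setT g, forall x, `|g x| <= `|M|,
    forall x, `|g x| <= `|f x| & {ae mu, forall x, f x = g x}].
Proof.
move=> mf fM; pose A := [set x | `|f x| <= M].
have mA : measurable A.
  rewrite -[A]setTI; apply: measurable_fun_le => //; exact: measurableT_comp.
exists (fun x => f x * \1_A x); split.
- by apply: measurable_funM => //; exact: measurable_indic.
- move=> x; rewrite indicE; have [xA|_] := boolP (x \in A); last by rewrite mulr0 normr0.
  by rewrite mulr1; move: xA; rewrite inE => /le_trans; apply; exact: ler_norm.
- move=> x; rewrite indicE; case: (x \in A); first by rewrite mulr1.
  by rewrite mulr0 normr0.
by apply: filterS fM => x xM; rewrite indicE mem_set// mulr1.
Qed.

Theorem theorem1p4 (R : realType) (N : nat) (lam p c delta : R)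
    (x0 : 'rV[R]_N) (U : 'rV[R]_N -> R) :
  (3 <= N)%N -> 0 < lam < N%:R -> p = (2 * N%:R - lam) / (N%:R - 2) ->
  c != 0 -> 0 < delta -> U = bubble c delta x0 ->
  hartree_solution lam p U ->
  forall phi : 'rV[R]_N -> R,
    phi \in Lfun (@lebesgue_rV R N) +oo%E ->
    vanishes_at_infinity phi ->
    linearized_solution lam p U phi ->
  exists (a : 'I_N -> R) (b : R),
    phi = (fun x => \sum_(j < N) a j * partial j U x
                    + b * dilation_generator x0 U x)
      %[ae @lebesgue_rV R N].
Proof.
move=> N3 /andP[lam0 lamN] pE c0 delta0 -> sol phi /Lfun_oo_ae_bounded[mphi [M phiM]] phi0 lin.
have [kappa [kappa0 Ak riesz_qf]] := riesz_qf_of_hartree delta0 N3 c0 pE sol.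
have [f [mf fM fphi phif]] := ae_bounded_truncation mphi phiM.
have f0 : vanishes_at_infinity f.
  move=> r r0; have [rho Hrho] := phi0 r r0; exists rho => x /Hrho.
  exact: le_lt_trans.
have rhsE x : linearized_rhs lam p (bubble c delta x0) phi x = reduced_rhs x0 delta lam kappa p phi x.
  exact: (linearized_rhs_bubble delta0 N3 c0 pE).
(* The convolution is the same at every x, not only almost everywhere, because the integrands agree
   for almost all y. *)
have convE x : convolution (riesz_kernel lam) (fun y => qf x0 delta y `^ (- (N%:R - lam / 2 - (N%:R - 2) / 2)) * phi y) x =
   convolution (riesz_kernel lam) (fun y => qf x0 delta y `^ (- (N%:R - lam / 2 - (N%:R - 2) / 2)) * f y) x.
  apply: ae_eq_Rintegral; [exact: measurable_riesz_qf|exact: measurable_riesz_qf|].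
  by apply: filterS phif => y ->.
(* The weak formulation passes to the representative [f]; only test functions given by an [expr] are
   used later. *)
have weak a : wf x0 a -> test_function (eval x0 a) ->
    \int[@lebesgue_rV R N]_x (f x * - laplacian (eval x0 a) x) =
    \int[@lebesgue_rV R N]_x (reduced_rhs x0 delta lam kappa p f x * eval x0 a x).
  move=> wa ta; have ma := measurable_eval x0 a.
  have ml : measurable_fun setT (fun x => - laplacian (eval x0 a) x).
    have -> : (fun x => - laplacian (eval x0 a) x) =
        (fun x => - \sum_j eval x0 (ediff j (ediff j a)) x).
      by apply/funext => x; rewrite laplacian_eval.
    apply: measurable_funN; apply: measurable_sum => j; exact: measurable_eval.
  transitivity (\int[@lebesgue_rV R N]_x (phi x * - laplacian (eval x0 a) x)).
    apply: ae_eq_Rintegral; [exact: measurable_funM|exact: measurable_funM|].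
    by apply: filterS phif => x ->.
  rewrite lin//; under eq_Rintegral do rewrite rhsE.
  apply: ae_eq_Rintegral.
  - by apply: measurable_funM => //; exact: measurable_reduced_rhs.
  - by apply: measurable_funM => //; exact: measurable_reduced_rhs.
  by apply: filterS phif => x fx; rewrite /reduced_rhs convE fx.
have rel := moment_relation_solution delta0 N3 kappa0 riesz_qf mf fM f0 weak.
have [B [b HZ]] := moment_relation_zero_mode delta0 N3 lam0 lamN kappa0 pE riesz_qf mf fM rel.
exists (fun j => 2 * delta * B ord0 j / (c * (2 - N%:R))), (- b / (c * ((N%:R - 2) / 2))).
apply: filterS2 phif HZ => x -> -> _; exact: zero_mode_span.
Qed.
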